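(* Let $\mathcal{P}\subset\mathbb{R}^d$ be a bounded domain with piecewise smooth boundary, $\tilde{\mathcal{P}}\supset\mathcal{P}$ another bounded domain, and for $M\in\mathbb{N}$ let $\Pi_M=\{\mathbf{t}\in\mathbb{N}^d:\mathbf{t}/M\in\mathcal{P}\}$, $\tilde\Pi_M=\{\mathbf{t}\in\mathbb{N}^d:\mathbf{t}/M\in\tilde{\mathcal{P}}\}$. Let $\ell_1(s)=\sigma_0+\sum_j\sigma_js_j$ and $\hat\ell(s)=\hat\sigma_0+\sum_j\hat\sigma_js_j$ be non-constant inhomogeneous linear forms on $\mathbb{R}^d$ with $\hat\ell>\ell_1$ on $\mathrm{Int}(\mathcal{P})$ and $\max_{\tilde{\mathcal{P}}}\ell_1>\max_{\mathcal{P}}\hat\ell$, and for $\mathbf{t}\in\tilde\Pi_M$ put $\lambda_1(\mathbf{t})=M\ell_1(\mathbf{t}/M)$, $\hat\lambda(\mathbf{t})=M\hat\ell(\mathbf{t}/M)$. Let $\xi^M_{\mathbf{t}},\nu^M_{\mathbf{t}},\zeta^M_{\mathbf{t}},\xi^M_{\mathbf{t},p},\eta^M_{\mathbf{t},p}$ ($\mathbf{t}\in\tilde\Pi_M$) and the partitions $F_{\mathbf{t}}$ be as described in the context. Suppose there are $\mathbf{c}>0$, $R>0$ independent of $M$, and a set $E\subset\Omega$ (depending on $M$) with $\mathbb{P}(E^c)=\mathcal{O}(M^{-100d})$, such that: (h1) for any $\mathbf{t}\in\tilde\Pi_M$, $\mathbb{E}(\xi_{\mathbf{t}})=\mathcal{O}(M^{-d})$;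 (h2) for any $\mathbf{t}\in\tilde\Pi_M$, $\mathbb{P}(\xi_{\mathbf{t}}>1)=\mathcal{O}(M^{-2d})$; (h3) for $\mathbf{t}\neq\mathbf{t}'$ in $\tilde\Pi_M$, $\mathbb{P}(\xi_{\mathbf{t}}\ge1,\xi_{\mathbf{t}'}\ge1)=\mathcal{O}(M^{-2d})$; (h4) for $\mathbf{t},\mathbf{t}'\in\tilde\Pi_M$ with $\lambda_1(\mathbf{t})\ge\lambda_1(\mathbf{t}')+R\ln M$, any $p\in\{1,\dots,P\}$ and any $\omega\in E$: (a) $\mathbb{E}(\xi_{\mathbf{t}}|\mathcal{F}_{\mathbf{t}'})(\omega)=\mathbf{c}\,\mathfrak{m}(\mathfrak{X})M^{-d}+\mathcal{O}(M^{-2d})$; (b) $\mathbb{E}(\xi_{\mathbf{t},p}|\mathcal{F}_{\mathbf{t}'})(\omega)=\mathbf{c}\,\mathfrak{m}(K_p)M^{-d}+\mathcal{O}(M^{-2d})$; (c) $\mathbb{E}(\eta_{\mathbf{t},p}|\mathcal{F}_{\mathbf{t}'})(\omega)=\mathbf{c}\,\mathfrak{m}(K_p)M^{-d}+\mathcal{O}(M^{-2d})$; (h5) for $\mathbf{t},\bar{\mathbf{t}}\in\tilde\Pi_M$ with $\lambda_1(\bar{\mathbf{t}})>\lambda_1(\mathbf{t})+R\ln M$, any $p$ and any $\omega\in E$, $\xi_{\mathbf{t},p}$ is constant on $F_{\bar{\mathbf{t}}}(\omega)$; (h6) for $\mathbf{t},\bar{\mathbf{t}}\in\tilde\Pi_M$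 with $\lambda_1(\bar{\mathbf{t}})>\lambda_1(\mathbf{t})+R\ln M$ and any $\omega\in E$, $F_{\bar{\mathbf{t}}}(\omega)\subset F_{\mathbf{t}}(\omega)$; (h7) there is a sequence $\upsilon_M\to0$ such that if $\mathbf{t},\mathbf{t}'\in\tilde\Pi_M$ satisfy $\hat\lambda(\mathbf{t})\ge\lambda_1(\mathbf{t}')+R\ln M\ge\lambda_1(\mathbf{t})+2R\ln M$, then for any $\omega\in E$ with $\xi_{\mathbf{t}}(\omega)=1$ and any $j\in\{1,\dots,J\}$, $|\mathbb{P}(\zeta^M_{\mathbf{t}}\in\tilde K_j|\mathcal{F}_{\mathbf{t}'})(\omega)-\tilde{\mathfrak{m}}(\tilde K_j)|\le\upsilon_M$; (h8) for $\mathbf{t},\bar{\mathbf{t}}\in\tilde\Pi_M$ with $\lambda_1(\bar{\mathbf{t}})>\hat\lambda(\mathbf{t})+R\ln M$, any $j\in\{1,\dots,J\}$ and any $\omega\in E$ with $\xi_{\mathbf{t}}(\omega)=1$, $\mathbf{1}_{\zeta_{\mathbf{t}}\in\tilde K_j}$ is constant on $F_{\bar{\mathbf{t}}}(\omega)$. Then the sequence of point processes $$\left\{\Big(\nu^M_{\mathbf{t}},\zeta^M_{\mathbf{t}},\frac{\mathbf{t}}{M}\Big)\right\}_{\mathbf{t}\in\Pi_M,\ \xi^M_{\mathbf{t}}=1}$$ converges as $M\to\infty$ to a Poisson process with intensity $\mathbf{c}$ on $(\mathfrak{X}\times\tilde{\mathfrak{X}}\times\mathcal{P},\ \mathfrak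{m}\times\tilde{\mathfrak{m}}\times\mathrm{Leb})$.
   Context: $(\Omega,\mathbb{P})$ is a probability space with expectation $\mathbb{E}$. $(\mathfrak{X},\mathfrak{m})$ and $(\tilde{\mathfrak{X}},\tilde{\mathfrak{m}})$ are probability spaces with countable collections $\mathcal{Q}$, $\tilde{\mathcal{Q}}$ of finite partitions converging to the respective point partitions. For each $M$ there are random variables $\xi^M_{\mathbf{t}}$ with values in the non-negative integers, $\mathfrak{X}$-valued random variables $\nu^M_{\mathbf{t}}$ and $\tilde{\mathfrak{X}}$-valued random variables $\zeta^M_{\mathbf{t}}$ on $\Omega$. For each fixed $Q=(K_1,\dots,K_P)\in\mathcal{Q}$, $\xi^M_{\mathbf{t}}=\sum_{p=1}^P\xi^M_{\mathbf{t},p}$ with $\xi^M_{\mathbf{t},p}$ non-negative integer valued and, on $\{\xi^M_{\mathbf{t}}=1\}$, $\xi^M_{\mathbf{t},p}=\mathbf{1}_{\nu^M_{\mathbf{t}}\in K_p}$. Put $\eta^M_{\mathbf{t}}=\mathbf{1}_{\xi^M_{\mathbf{t}}=1}$ and $\eta^M_{\mathbf{t},p}=\mathbf{1}_{\xi^M_{\mathbf{t},p}=\xi^M_{\mathbf{t}}=1}$. The superscript $M$ is often dropped. For every $M$ a family of partitions $F_{\mathbf{t}}$ of $(\Omega,\mathbb{P})$ is given; $F_{\mathbf{t}}(\omega)$ is the element containing $\omega$ and $\mathcal{F}_{\mathbf{t}}$ is the $\sigma$-algebra generated by $F_{\mathbf{t}}$. The hypotheses are assumed for each fixed $Q=(K_1,\dots,K_P)\in\mathcal{Q}$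 and $\tilde Q=(\tilde K_1,\dots,\tilde K_J)\in\tilde{\mathcal{Q}}$; constants in $\mathcal{O}$ may depend on $Q,\tilde Q$ but not on $M,\mathbf{t},\mathbf{t}',\omega$. Convergence to a Poisson process means that for all such $Q,\tilde Q$ and every division of $\mathcal{P}$ into finitely many pieces $\mathcal{P}_s$ of positive volume (with piecewise smooth boundary), the numbers of points in $K_p\times\tilde K_j\times\mathcal{P}_s$ converge jointly in distribution to independent Poisson variables with parameters $\mathbf{c}\,\mathfrak{m}(K_p)\tilde{\mathfrak{m}}(\tilde K_j)\mathrm{Leb}(\mathcal{P}_s)$.
   Formalization: The domain P̃ is assumed to lie in [0,∞)^d (else Π_M may be empty), and the partitions F_t are assumed measurable in Rokhlin's sense, with conditional measures carried by their elements; F_t's σ-algebra consists of measurable unions of elements. *)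

(* Defs.v *)
From HB Require Import structures.
From mathcomp Require Import all_boot all_order all_algebra.
From mathcomp Require Import finmap.
From mathcomp Require Import all_classical all_reals all_analysis.
Import Order.TTheory GRing.Theory Num.Theory.
Import numFieldNormedType.Exports.

Set Implicit Arguments.
Unset Strict Implicit.
Unset Printing Implicit Defensive.

Local Open Scope classical_set_scope.
Local Open Scope ring_scope.

Section Geometry.
Variable R : realType.

Definition boundary (d : nat) (A : set 'rV[R]_d) : set 'rV[R]_d :=
  closure A `\` A°.

(* Agnostic about which boundary points belong to [A]: open domains, their
   closures and everything in between qualify. *)
Definition bounded_domain (d : nat) (A : set 'rV[R]_d) : Prop :=
  [/\ A° !=set0, connected A°, A `<=` closure A° & bounded_set A].

Definition C1_on (n d : nat) (U : set 'rV[R]_n) (g : 'rV[R]_n -> 'rV[R]_d) :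
    Prop :=
  forall x, U x -> differentiable g x /\
    forall v : 'rV[R]_n, {for x, continuous (fun y => 'D_v g y)}.

Definition unit_cube (n : nat) : set 'rV[R]_n :=
  [set x | forall i, 0 <= x ord0 i <= 1].

(* The boundary is a finite union of C^1 pieces parametrised by a closed
   (d-1)-dimensional cube.  Neither injectivity nor a rank condition is imposed
   on the parametrisations, so cusps, conical points, etc. are allowed. *)
Definition piecewise_smooth_boundary (d : nat) (A : set 'rV[R]_d) : Prop :=
  exists (n : nat) (g : 'I_n -> 'rV[R]_d.-1 -> 'rV[R]_d),
    (forall i, exists U, [/\ open U, @unit_cube d.-1 `<=` U & C1_on U (g i)]) /\
    boundary A = \bigcup_(i in [set: 'I_n]) (g i @` @unit_cube d.-1).

Definition box (d : nat) (a b : 'rV[R]_d) : set 'rV[R]_d :=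
  [set x | forall i, a ord0 i <= x ord0 i < b ord0 i].

Definition box_volume (d : nat) (a b : 'rV[R]_d) : R :=
  \prod_(i < d) Num.max 0 (b ord0 i - a ord0 i).

(* d-dimensional Lebesgue outer measure; on Lebesgue measurable sets (in
   particular on sets with piecewise smooth boundary) it is the Lebesgue
   measure. *)
Definition Leb (d : nat) (A : set 'rV[R]_d) : \bar R :=
  ereal_inf [set s | exists a b : nat -> 'rV[R]_d,
    A `<=` \bigcup_n box (a n) (b n) /\
    s = (\sum_(0 <= n <oo) (box_volume (a n) (b n))%:E)%E].

(* Pieces may overlap along their boundaries and need not contain them. *)
Definition division (d : nat) (D : set 'rV[R]_d) (S : nat)
    (piece : 'I_S -> set 'rV[R]_d) : Prop :=
  [/\ forall s, piece s `<=` D,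
      forall s s', s != s' -> (piece s)° `&` (piece s')° = set0,
      D `<=` \bigcup_(s in [set: 'I_S]) closure (piece s),
      forall s, (0 < Leb (piece s))%E &
      forall s, piecewise_smooth_boundary (piece s)].

Definition affine_form (d : nat) (s0 : R) (s : 'rV[R]_d) (x : 'rV[R]_d) : R :=
  s0 + \sum_(j < d) s ord0 j * x ord0 j.

Definition rescale (d : nat) (M : nat) (t : 'rV[nat]_d) : 'rV[R]_d :=
  \row_i ((t ord0 i)%:R / M%:R).

Definition lattice_points (d : nat) (D : set 'rV[R]_d) (M : nat) :
    set 'rV[nat]_d :=
  [set t | D (rescale M t)].

End Geometry.

Section FinitePartition.
Context (R : realType) (d : measure_display) (X : measurableType d).
Variable m : probability X R.

Definition finite_partition (n : nat) (K : 'I_n -> set X) : Prop :=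
  partition [set: 'I_n] K [set: X] /\ forall p, measurable (K p).

(* Convergence to the point partition, in the sense of ergodic theory: every
   measurable set is approximated in measure by unions of atoms. *)
Definition cvg_point_partition (n : nat -> nat)
    (K : forall k, 'I_(n k) -> set X) : Prop :=
  forall A, measurable A -> forall e : R, 0 < e ->
    \forall k \near \oo, exists J : set 'I_(n k),
      let B := \bigcup_(p in J) K k p in
      (m ((A `\` B) `|` (B `\` A)) < e%:E)%E.

End FinitePartition.

Section Conditioning.
Context (R : realType) (d : measure_display) (T : measurableType d).
Variable P : probability T R.

(* The sigma-algebra generated by a partition, in the sense of Rokhlin: all
   measurable unions of elements.  For countable measurable partitions this is
   [<<s F >>]; for uncountable ones [<<s F >>] would be far too small (e.g. only
   countable and co-countable sets for the partition into points). *)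
Definition partition_algebra (F : set (set T)) : set (set T) :=
  [set A | measurable A /\ exists2 G, G `<=` F & A = \bigcup_(B in G) B].

(* [Y] is a version of the conditional expectation E(X | F). *)
Definition is_condexp (F : set (set T)) (X Y : T -> R) : Prop :=
  [/\ forall B : set R, measurable B -> partition_algebra F (Y @^-1` B),
      P.-integrable [set: T] (EFin \o Y) &
      forall A, partition_algebra F A ->
        (\int[P]_(w in A) (Y w)%:E = \int[P]_(w in A) (X w)%:E)%E].

(* "E(X | F)(w) = a + O(e) for all w in E", with implied constant 1: pointwise
   statements about a conditional expectation refer to some version of it. *)
Definition condexp_within (F : set (set T)) (X : T -> R) (E : set T)
    (a e : R) : Prop :=
  exists Y, is_condexp F X Y /\ forall w, E w -> `|Y w - a| <= e.

(* A measurable partition in the sense of Rokhlin, i.e. one admitting a system of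
   conditional measures carried by its elements.  This holds for every countable
   partition into measurable sets, and for the partition into the level sets of
   a measurable map between standard Borel spaces. *)
Definition measurable_partition (F : set (set T)) : Prop :=
  [/\ partition F id [set: T],
      F `<=` measurable &
      exists kappa : T -> probability T R,
        (forall A, measurable A ->
           is_condexp F \1_A (fun w => fine (kappa w A))) /\
        {ae P, forall w, kappa w (pblock F id w) = 1%E}].

End Conditioning.

Definition constant_on (T U : Type) (f : T -> U) (A : set T) : Prop :=
  forall w w', A w -> A w' -> f w = f w'.

Definition mutually_independent (R : realType) (d : measure_display)
    (T : measurableType d) (P : probability T R) (I : finType)
    (Z : I -> {RV P >-> nat}) : Prop :=
  forall A : I -> set nat,
    P (\bigcap_(i in [set: I]) (Z i @^-1` A i)) =
    (\prod_(i : I) P (Z i @^-1` A i))%E.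

(* Weak convergence of N^I-valued random vectors; N^I being discrete, all
   functions on it are continuous. *)
Definition cvg_in_distribution (R : realType)
    (d : measure_display) (T : measurableType d) (P : probability T R)
    (d' : measure_display) (T' : measurableType d') (Q : probability T' R)
    (I : finType) (N : nat -> I -> T -> nat) (Z : I -> T' -> nat) : Prop :=
  forall f : (I -> nat) -> R, (exists C, forall k, `|f k| <= C) ->
    (fun M => 'E_P[fun w => f (fun i => N M i w)]%E) @ \oo -->
      'E_Q[fun w => f (fun i => Z i w)]%E.

Definition number_in (T : choiceType) (A B : set T) : nat :=
  #|` fset_set (A `&` B)|.

(* [N M w] is the M-th random configuration of (distinct) points; it converges to
   the Poisson process of intensity [c] on [(X, m) * (Y, m') * (D, Leb)], tested
   on products of atoms of the partitions [K k], [K' l] and pieces of [D].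
   [poisson_prob] has a dummy second argument, and is the Dirac mass at 0 for
   the rate 0. *)
Definition cvg_poisson_process (R : realType)
    (dT : measure_display) (T : measurableType dT) (P : probability T R)
    (dX : measure_display) (X : measurableType dX) (m : probability X R)
    (n : nat -> nat) (K : forall k, 'I_(n k) -> set X)
    (dY : measure_display) (Y : measurableType dY) (m' : probability Y R)
    (n' : nat -> nat) (K' : forall l, 'I_(n' l) -> set Y)
    (d : nat) (D : set 'rV[R]_d) (c : R)
    (N : nat -> T -> set (X * Y * 'rV[R]_d)) : Prop :=
  forall (k l S : nat) (piece : 'I_S -> set 'rV[R]_d), division D piece ->
  exists (dZ : measure_display) (TZ : measurableType dZ)
         (PZ : probability TZ R)
         (Z : 'I_(n k) * 'I_(n' l) * 'I_S -> {RV PZ >-> nat}),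
    [/\ mutually_independent Z,
        forall p j s, distribution PZ (Z (p, j, s)) =1
          poisson_prob
            (c * fine (m (K k p)) * fine (m' (K' l j)) * fine (Leb (piece s))) 0 &
        cvg_in_distribution P PZ
          (fun M i w =>
             number_in (N M w) (K k i.1.1 `*` K' l i.1.2 `*` piece i.2))
          Z].

(* Main.v *)
Require Import Defs.
From HB Require Import structures.
From mathcomp Require Import all_boot all_order all_algebra.
From mathcomp Require Import finmap.
From mathcomp Require Import all_classical all_reals all_analysis.
From mathcomp Require Import measurable_realfun.
From mathcomp Require Import ring lra.
Import Order.TTheory GRing.Theory Num.Theory.
Import numFieldNormedType.Exports.

(** The joint law of the counts is identified through its generating function.
    For weights $u$ in $(0,1]$, indexed by the cells $(p, j, q)$, put
    $V_t(p,j) = 1 - \prod_{q : t/M \in \mathcal{P}_q} u(p,j,q)$.  The product of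
    the $u^N$ over all cells factorises over the sites $t$: the factor of a site
    is $1$ when $\xi_t \ne 1$, and $1 - V_t(p,j)$ when $\xi_t = 1$, the birth
    mark is in $K_p$ and the second mark in $\tilde K_j$ ([site_factor]).  For
    independent Poisson variables the generating function is explicit, and
    convergence of generating functions on $(0,1]$ already forces
    convergence of the expectations of all bounded functions of the counts
    ([cvg_pgf_cvg_counts]).

    So everything rests on the estimate that the expected product of the site
    factors is $\exp(-\sum_t q_t) + o(1)$, where
    $q_t = \mathbf{c} M^{-d} \sum_{p,j} m(K_p) \tilde m(\tilde K_j) V_t(p,j)$
    ([pgf_limit]).  Each site carries two events: its birth, at time
    $\lambda_1(t)$, and the reading of its mark, at time $\hat\lambda(t)$.  All
    events are ordered in time and undone one at a time, the latest first
    ([swap_all]): undoing the reading replaces the indicator of $\tilde K_j$ by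
    $\tilde m(\tilde K_j)$, and undoing the birth replaces the factor by
    $e^{-q_t}$.  When an event is undone, the remaining factors only involve
    earlier events.  Those older than the event by $3R\ln M$ are constant on the
    elements of a partition $F_{t'}$ whose time $\lambda_1(t')$ lies between $2R\ln M$
    and $R \ln M$ before the event; such a $t'$ exists because the times of
    lattice points leave only bounded gaps ([lattice_time]).  Conditionally on
    $F_{t'}$ they can be pulled out, and the laws of births and marks given the
    past bound the error ([conditional_estimate]).  The events in the window of
    width $3R\ln M$ belong to $O(M^{d-1}\ln M)$ sites ([card_le_slab]), and they
    only matter if one of these sites is occupied together with the site at
    hand, which has probability $O(M^{-2d})$.  Over the $O(M^d)$ sites the errors
    add up to $O(\upsilon_M + M^{-1}\ln M)$ ([one_scale_estimate]).  The sites
    that are born too early for a clock to exist, or whose mark is read too soon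
    after the birth, lie in two thin slabs; they are a small fraction of the
    sites and are discarded first ([few_bad_sites]).

    It remains to see that $\sum_t q_t$ converges.  The boundary of a piece is a
    finite union of Lipschitz images of a cube of dimension $d - 1$, hence few
    lattice points are near it ([thin_boundary]); therefore the number
    of lattice points in a piece, divided by $M^d$, tends to its Lebesgue measure
    ([lattice_density]) and the sites shared by two pieces are negligible ([cell_density]). *)

Set Implicit Arguments.
Unset Strict Implicit.
Unset Printing Implicit Defensive.

Local Open Scope classical_set_scope.
Local Open Scope ring_scope.

(** * Counting lattice points *)

Section Counting.
Variable R : realType.

Definition card_le_real (T : choiceType) (S : set T) (x : R) : Prop :=
  finite_set S /\ #|` fset_set S|%:R <= x.

Lemma card_le_real_sub (T : choiceType) (S S' : set T) (x y : R) :
  S `<=` S' -> x <= y -> card_le_real S' x -> card_le_real S y.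
Proof.
move=> SS' xy [fS' le]; have fS := sub_finite_set SS' fS'.
split=> //; apply: le_trans xy; apply: le_trans le; rewrite ler_nat.
by apply: fsubset_leq_card; rewrite -fset_set_sub.
Qed.

Lemma card_le_realW (T : choiceType) (S : set T) (x y : R) :
  x <= y -> card_le_real S x -> card_le_real S y.
Proof. by move=> xy [fS le]; split=> //; exact: le_trans xy. Qed.

Lemma card_le_realU (T : choiceType) (S S' : set T) (x y : R) :
  card_le_real S x -> card_le_real S' y -> card_le_real (S `|` S') (x + y).
Proof.
move=> [fS le] [fS' le']; split; first by rewrite finite_setU.
rewrite fset_setU//; apply: le_trans (lerD le le').
by rewrite -natrD ler_nat cardfsU leq_subr.
Qed.

Lemma card_le_real_bigcup (T : choiceType) (I : eqType) (s : seq I)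
    (S : I -> set T) (x : I -> R) :
  (forall i, i \in s -> card_le_real (S i) (x i)) ->
  card_le_real (\bigcup_(i in [set` s]) S i) (\sum_(i <- s) x i).
Proof.
elim: s => [_|i s IH H].
  rewrite big_nil (_ : \bigcup_(i in _) _ = set0).
    by split; rewrite ?fset_set0.
  by apply/seteqP; split => // t [].
rewrite big_cons (_ : \bigcup_(i in _) _ =
    S i `|` \bigcup_(j in [set` s]) S j); last first.
  apply/seteqP; split => [t [j /=]|t [St|[j /= js St]]].
  - by rewrite inE => /orP[/eqP ->|js] St; [left|right; exists j].
  - by exists i => //=; rewrite inE eqxx.
  - by exists j => //=; rewrite inE js orbT.
apply: card_le_realU.
  by apply: H; rewrite inE eqxx.
by apply: IH => j js; apply: H; rewrite inE js orbT.
Qed.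

(** Injectivity modulo given integers is an easy way to count the points of a
    box or of a slab: two points that are close in a coordinate agree there as
    soon as they agree modulo an integer larger than their distance. *)
Lemma card_le_residues (d : nat) (S : set 'rV[nat]_d) (q : 'I_d -> nat) :
  (forall i, (0 < q i)%N) ->
  (forall t t', S t -> S t' ->
     (forall i, t ord0 i = t' ord0 i %[mod q i]) -> t = t') ->
  card_le_real S (\prod_i (q i)%:R).
Proof.
move=> q0 inj.
pose h (t : 'rV[nat]_d) : {dffun forall i : 'I_d, 'I_(q i)} :=
  [ffun i => Ordinal (ltn_pmod (t ord0 i) (q0 i))].
have hinj : {in S &, injective h}.
  move=> t t' /set_mem St /set_mem St' /ffunP hh; apply: inj => // i.
  by have := hh i; rewrite !ffunE => /(congr1 val).
have fS : finite_set S.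
  have : finite_set [set: {dffun forall i : 'I_d, 'I_(q i)}] by exact: finite_finset.
  move=> /(finite_image (fun y => xget 0 [set t | S t /\ h t = y])).
  apply: sub_finite_set => t St; exists (h t) => //.
  by case: xgetP => [t' _ [St' ht']|/(_ t) /=[]//]; apply: hinj; rewrite ?inE.
split=> //; rewrite -natr_prod ler_nat.
have -> : #|` fset_set S| = #|` [fset h t | t in fset_set S]%fset|.
  rewrite card_in_imfset//= => x y; rewrite !in_fset_set// => xS yS.
  exact: hinj.
have -> : (\prod_(i < d) q i = #|{dffun forall i : 'I_d, 'I_(q i)}|)%N.
  rewrite card_dep_ffun foldrE big_map big_enum /=.
  by apply: eq_bigr => i _; rewrite card_ord.
rewrite -(card_finset predT); apply: fsubset_leq_card.
by apply/fsubsetP => x _; rewrite !inE.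
Qed.

Lemma eqn_mod_small (q a b : nat) : a = b %[mod q] -> (a < b + q)%N ->
  (b < a + q)%N -> a = b.
Proof.
wlog ab : a b / (a <= b)%N.
  by move=> H; case/orP: (leq_total a b) => ab e ? ?; [|apply/esym]; exact: H.
move=> /esym/eqP; rewrite eqn_mod_dvd// => /dvdnP[[|k] e] _ H.
  by apply/eqP; rewrite eqn_leq ab -subn_eq0 e.
by exfalso; move: H; rewrite -ltn_subLR// e mulSn ltnNge leq_addr.
Qed.

End Counting.

Section Lattice.
Variable R : realType.

Lemma coord_le_norm (d : nat) (x : 'rV[R]_d) i : `|x ord0 i| <= `|x|.
Proof.
change (`|x ord0 i| <= mx_norm x).
by rewrite mx_normrE; apply: (le_bigmax _ (fun k => `|x k.1 k.2|) (ord0, i)).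
Qed.

Lemma norm_le_coord (d : nat) (x : 'rV[R]_d) (e : R) : 0 <= e ->
  (forall i, `|x ord0 i| <= e) -> `|x| <= e.
Proof.
move=> e0 H; change (mx_norm x <= e); rewrite mx_normrE.
by apply/bigmax_leP; split => // -[j i] _ /=; rewrite (ord1 j).
Qed.

Lemma bounded_coord (d : nat) (A : set 'rV[R]_d) : bounded_set A ->
  exists2 B : nat, (0 < B)%N &
    forall x, A x -> forall i, `|x ord0 i| <= B%:R.
Proof.
move=> [b [br H]]; exists (Num.truncn (b + 1)).+1 => // x Ax i.
apply: le_trans (H (Num.truncn (b + 1)).+1%:R _ x Ax); last first.
  by apply: lt_trans (truncnS_gt _); rewrite ltrDl.
exact: coord_le_norm.
Qed.

Lemma affine_form_rescale (d M : nat) (s0 : R) (s : 'rV[R]_d) (t : 'rV[nat]_d) :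
  (0 < M)%N -> M%:R * affine_form s0 s (rescale R M t) =
    M%:R * s0 + \sum_(j < d) s ord0 j * (t ord0 j)%:R.
Proof.
move=> M0; rewrite /affine_form mulrDr mulr_sumr; congr (_ + _).
apply: eq_bigr => j _; rewrite mxE.
by field; rewrite pnatr_eq0 -lt0n.
Qed.

Lemma dist_small_eq (q a b : nat) (w : R) : `|a%:R - b%:R| <= w -> w < q%:R ->
  a = b %[mod q] -> a = b.
Proof.
move=> ab wq e; have {ab} ab := le_lt_trans ab wq.
move: ab; rewrite ltr_norml => /andP[h1 h2].
by apply: (eqn_mod_small e); rewrite -(ltr_nat R) natrD; lra.
Qed.

Lemma card_le_box (d M : nat) (a b : 'rV[R]_d) : (0 < M)%N ->
  card_le_real
    [set t : 'rV[nat]_d | forall i, a ord0 i <= rescale R M t ord0 i <= b ord0 i]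
    (\prod_(i < d) (M%:R * Num.max 0 (b ord0 i - a ord0 i) + 1)).
Proof.
move=> M0; have M0' : 0 < M%:R :> R by rewrite ltr0n.
pose w i : R := M%:R * Num.max 0 (b ord0 i - a ord0 i).
have w0 i : 0 <= w i by apply: mulr_ge0 => //; rewrite le_max lexx.
apply: (@card_le_realW _ _ _ (\prod_(i < d) (Num.truncn (w i)).+1%:R)).
  apply: ler_prod => i _; rewrite ler0n /= -natr1 lerD2r.
  by rewrite truncn_le.
apply: card_le_residues => // t t' St St' tt'.
apply/rowP => i; apply: (@dist_small_eq _ _ _ (w i)) (tt' i); last first.
  exact: truncnS_gt.
have := St i; have := St' i; rewrite !mxE !ler_pdivlMr// !ler_pdivrMr//.
move=> /andP[h1 h2] /andP[h3 h4].
rewrite /w; apply: (@le_trans _ _ (M%:R * (b ord0 i - a ord0 i))); last first.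
  by rewrite ler_pM2l// le_max lexx orbT.
by rewrite ler_norml; apply/andP; split; lra.
Qed.

Lemma card_le_lattice_points (d : nat) (A : set 'rV[R]_d) : bounded_set A ->
  exists2 C : R, 0 < C & forall M, (0 < M)%N ->
    card_le_real (lattice_points A M) (C * M%:R ^+ d).
Proof.
move=> /bounded_coord[B B0 HB]; exists ((B%:R + 1) ^+ d).
  by rewrite exprn_gt0// ltr_wpDl.
move=> M M0; have M1 : 1 <= M%:R :> R by rewrite ler1n.
apply: card_le_real_sub (card_le_box 0 (const_mx B%:R) M0).
  move=> t At i; have := le_trans (ler_norm _) (HB _ At i).
  by rewrite !mxE => ->; rewrite divr_ge0.
under eq_bigr do rewrite !mxE subr0 maxEle ler0n.
rewrite prodr_const card_ord -exprMn lerXn2r// ?nnegrE.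
- by rewrite addr_ge0// mulr_ge0.
- by rewrite mulr_ge0// addr_ge0.
- by rewrite mulrC mulrDl mul1r lerD2l.
Qed.

(** All coordinates but the $j$-th, where $s_j \neq 0$, take $O(M)$ values each;
    once they are fixed, the slab leaves to the $j$-th one an interval of length
    $w / |s_j|$. *)
Lemma card_le_slab (d : nat) (A : set 'rV[R]_d) (s0 : R) (s : 'rV[R]_d) :
  bounded_set A -> s != 0 ->
  exists2 C : R, 0 < C & forall M, (0 < M)%N -> forall a w, 0 <= w ->
    card_le_real [set t | lattice_points A M t /\
        a <= M%:R * affine_form s0 s (rescale R M t) <= a + w]
      (C * M%:R ^+ d * (w + 1) / M%:R).
Proof.
move=> /bounded_coord[B B0 HB] /rV0Pn[j sj].
have sj0 : 0 < `|s ord0 j| by rewrite normr_gt0.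
have B1 : 0 < B%:R + 1 :> R by rewrite ltr_wpDl.
exists ((`|s ord0 j|^-1 + 1) * (B%:R + 1) ^+ d.-1).
  by rewrite mulr_gt0// ?exprn_gt0// ltr_wpDl// invr_ge0.
move=> M M0 a w w0; have M1 : 1 <= M%:R :> R by rewrite ler1n.
have M0' : 0 < M%:R :> R by rewrite ltr0n.
pose q i := if i == j then (Num.truncn (w / `|s ord0 j|)).+1 else (B * M).+1.
have wj0 : 0 <= w / `|s ord0 j| by rewrite divr_ge0// ltW.
apply: (@card_le_realW _ _ _ (\prod_(i < d) (q i)%:R)).
  rewrite (bigD1 j)//= {1}/q eqxx.
  have -> : \prod_(i < d | i != j) (q i)%:R = (B * M).+1%:R ^+ d.-1 :> R.
    rewrite (eq_bigr (fun=> (B * M).+1%:R)); last by move=> i /negbTE; rewrite /q => ->.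
    by rewrite prodr_const cardC1 card_ord.
  have -> : (`|s ord0 j|^-1 + 1) * (B%:R + 1) ^+ d.-1 * M%:R ^+ d * (w + 1) / M%:R
      = ((`|s ord0 j|^-1 + 1) * (w + 1)) * ((B%:R + 1) * M%:R) ^+ d.-1.
    have -> : M%:R ^+ d = M%:R ^+ d.-1 * M%:R :> R.
      by rewrite -exprSr prednK// (leq_trans _ (ltn_ord j)).
    by rewrite exprMn; field; rewrite gt_eqF//= gt_eqF.
  apply: ler_pM => //.
  - rewrite -natr1; apply: (@le_trans _ _ (w / `|s ord0 j| + 1)).
      by rewrite lerD2r truncn_le.
    have : 0 <= `|s ord0 j|^-1 by rewrite invr_ge0.
    by move: w0; set x := `|_|^-1 => ? ?; nra.
  - rewrite lerXn2r// ?nnegrE ?mulr_ge0 ?addr_ge0//.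
    by rewrite -natr1 natrM mulrDl mul1r lerD2l.
apply: card_le_residues => [i|t t' [St at_] [St' at'] tt'].
  by rewrite /q; case: ifP.
have ne i : i != j -> t ord0 i = t' ord0 i.
  move=> ij; have := tt' i; rewrite /q (negbTE ij).
  have bnd u : lattice_points A M u -> (u ord0 i <= B * M)%N.
    move=> /HB/(_ i)/(le_trans (ler_norm _)).
    by rewrite mxE ler_pdivrMr// -natrM ler_nat.
  have := bnd _ St; have := bnd _ St' => h1 h2 e.
  by apply: (eqn_mod_small e); rewrite addnS ltnS; [apply: (leq_trans h2)|apply: (leq_trans h1)]; rewrite leq_addl.
apply/rowP => i; have [->{i}|/ne//] := eqVneq i j.
have := tt' j; rewrite /q eqxx; apply: dist_small_eq (truncnS_gt _).
rewrite ler_pdivlMr// -normrM mulrC mulrBr.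
move: at_ at'; rewrite !affine_form_rescale// !(bigD1 j (P := xpredT))//=.
rewrite (eq_bigr (fun i => s ord0 i * (t' ord0 i)%:R)); last first.
  by move=> i /ne ->.
by move=> /andP[? ?] /andP[? ?]; rewrite ler_norml; apply/andP; split; lra.
Qed.

End Lattice.

(** * Sets with few lattice points nearby *)

Section Lipschitz.
Variable R : realType.

Lemma unit_cube_compact (n : nat) : compact (@unit_cube R n).
Proof.
apply: bounded_closed_compact.
  exists 1; split => // b b1 x cx; apply: norm_le_coord => [|i].
    by rewrite (le_trans _ (ltW b1)).
  by have /andP[x0 x1] := cx i; rewrite ger0_norm// (le_trans x1)// ltW.
rewrite (_ : @unit_cube R n =
    \bigcap_(i in setT) ((fun x : 'rV[R]_n => x ord0 i) @^-1` `[0, 1])).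
  apply: closed_bigI => i _; apply: preimage_closed => [x _|].
    exact: coord_continuous.
  exact: itv_closed.
apply/seteqP; split => x cx i; first by move=> _ /=; rewrite in_itv/=; exact: cx.
by have := cx i I; rewrite /= in_itv.
Qed.

Lemma continuous_on_compact_bounded (n d : nat) (A : set 'rV[R]_n)
    (f : 'rV[R]_n -> 'rV[R]_d) :
  compact A -> (forall x, A x -> {for x, continuous f}) ->
  exists2 b : R, 0 <= b & forall x, A x -> `|f x| <= b.
Proof.
move=> cA cf.
have : compact (f @` A).
  apply: continuous_compact cA; apply: continuous_in_subspaceT => x /set_mem.
  exact: cf.
move=> /compact_bounded[b [_ H]]; exists (Num.max 0 (b + 1)).
  by rewrite le_max lexx.
move=> x Ax; apply: (H (Num.max 0 (b + 1))); last by exists x.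
by rewrite lt_max; apply/orP; right; rewrite ltrDl.
Qed.

(** The cube is convex, so the mean value theorem applies along segments, in
    each coordinate of the image; the partial derivatives are continuous on the
    compact cube, hence bounded. *)
Lemma C1_lipschitz_cube (n d : nat) (U : set 'rV[R]_n)
    (g : 'rV[R]_n -> 'rV[R]_d) : @unit_cube R n `<=` U -> C1_on U g ->
  exists2 L : R, 0 <= L & forall x y, unit_cube x -> unit_cube y ->
    `|g x - g y| <= L * `|x - y|.
Proof.
move=> cU C1.
have /choice[B HB] : forall i : 'I_n, exists b : R, 0 <= b /\
    forall x, unit_cube x -> `|'D_('e_i) g x| <= b.
  move=> i; have [|b b0 Hb] := @continuous_on_compact_bounded n d
      (@unit_cube R n) (fun y => 'D_('e_i) g y) (@unit_cube_compact n).
    by move=> x /cU /C1[_ +]; apply.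
  by exists b.
exists (\sum_i B i).
  by rewrite sumr_ge0// => i _; have [] := HB i.
move=> x y cx cy; apply: norm_le_coord => [|j].
  by rewrite mulr_ge0// sumr_ge0// => i _; have [] := HB i.
pose v : 'rV[R]_n := x - y.
pose h (s : R) := g (y + s *: v).
have cubes (s : R) : 0 <= s <= 1 -> unit_cube (y + s *: v).
  move=> /andP[s0 s1] i; rewrite !mxE.
  have /andP[? ?] := cx i; have /andP[? ?] := cy i.
  by apply/andP; split; nra.
have shiftE s : (fun e : R => e^-1 *: ((h \o shift s) (e *: (1 : R)) - h s)) =
    (fun e => e^-1 *: ((g \o shift (y + s *: v)) (e *: v) - g (y + s *: v))).
  apply/funext => e; rewrite /h /= [e *: (1 : R)]mulr1.
  by congr (_ *: (g _ - _)); rewrite scalerDl addrCA.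
have dh (s : R) : 0 <= s <= 1 -> derivable h s 1 /\ 'D_1 h s = 'D_v g (y + s *: v).
  move=> /cubes/cU/C1[dg _]; split; last by rewrite /derive shiftE.
  by rewrite /derivable shiftE; exact: diff_derivable.
have dhj (s : R) : 0 <= s <= 1 ->
    is_derive s 1 (fun s : R => h s ord0 j) (('D_v g (y + s *: v)) ord0 j).
  move=> s01; have [dh1 dh2] := dh s s01; split.
    by move/derivable_mxP: dh1; apply.
  by rewrite -dh2 derive_mx// mxE.
have [|||c c01 e] := @MVT_segment R (fun s : R => h s ord0 j)
    (fun s : R => ('D_v g (y + s *: v)) ord0 j) 0 1 => //.
- by move=> s; rewrite in_itv/= => /andP[s0 s1]; apply: dhj; rewrite !ltW.
- apply: derivable_within_continuous => s; rewrite in_itv/= => s01.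
  by have [] := dhj s s01.
move: c01; rewrite in_itv /= => c01.
have h1 : h 1 = g x by rewrite /h scale1r /v addrC subrK.
have h0 : h 0 = g y by rewrite /h scale0r addr0.
rewrite subr0 mulr1 h1 h0 in e.
rewrite !mxE e; apply: le_trans (coord_le_norm _ _) _.
have [dg _] := C1 _ (cU _ (cubes _ c01)).
rewrite deriveE// [X in 'd _ _ X](row_sum_delta v) linear_sum /=.
apply: le_trans (ler_norm_sum _ _ _) _; rewrite mulr_suml ler_sum// => i _.
rewrite linearZ/= normrZ mulrC; apply: ler_pM => //.
  by rewrite -deriveE//; have [_] := HB i; apply; exact: cubes.
exact: coord_le_norm.
Qed.

End Lipschitz.

Section Thin.
Variable R : realType.

Definition near_set (d : nat) (A : set 'rV[R]_d) (rho : R) : set 'rV[R]_d :=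
  [set x | exists2 y, A y & forall i, `|x ord0 i - y ord0 i| <= rho].

(** Zero Jordan content, measured by counting lattice points instead of
    volumes of boxes. *)
Definition thin (d : nat) (A : set 'rV[R]_d) : Prop :=
  forall e : R, 0 < e -> exists2 rho : R, 0 < rho & exists M0 : nat,
    forall M, (M0 < M)%N ->
      card_le_real (lattice_points (near_set A rho) M) (e * M%:R ^+ d).

Lemma thin_sub (d : nat) (A B : set 'rV[R]_d) : A `<=` B -> thin B -> thin A.
Proof.
move=> AB tB e /tB[rho rho0 [M0 H]]; exists rho => //; exists M0 => M /H.
by apply: card_le_real_sub => // t [y /AB By ?]; exists y.
Qed.

Lemma thinU (d : nat) (A B : set 'rV[R]_d) : thin A -> thin B -> thin (A `|` B).
Proof.
move=> tA tB e e0; have e2 : 0 < e / 2 by rewrite divr_gt0.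
have [r1 r10 [M1 H1]] := tA _ e2; have [r2 r20 [M2 H2]] := tB _ e2.
exists (Num.min r1 r2); first by rewrite lt_min r10.
exists (maxn M1 M2) => M; rewrite gtn_max => /andP[/H1 h1 /H2 h2].
rewrite (splitr e) mulrDl; apply: card_le_real_sub (card_le_realU h1 h2) => //.
by move=> t [y [Ay|By] H]; [left|right]; exists y => // i;
  apply: le_trans (H i) _; rewrite ge_min lexx ?orbT.
Qed.

Lemma thin0 (d : nat) : thin (@set0 'rV[R]_d).
Proof.
move=> e e0; exists 1 => //; exists 0%N => M _; rewrite /lattice_points.
rewrite (_ : [set t | _] = set0).
  by split; rewrite ?fset_set0 ?mulr_ge0 ?exprn_ge0// ltW.
by apply/seteqP; split => // t [y].
Qed.

Lemma thin_bigcup (d n : nat) (A : 'I_n -> set 'rV[R]_d) :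
  (forall i, thin (A i)) -> thin (\bigcup_(i in [set: 'I_n]) A i).
Proof.
elim: n A => [|n IH] A tA; first by apply: thin_sub (thin0 _) => x [[]].
apply: thin_sub (thinU (tA ord0) (IH (fun i => A (lift ord0 i)) _)) => // x [i _].
by case: (unliftP ord0 i) => [j|] -> Ax; [right; exists j|left].
Qed.

(** The cube of dimension $d - 1$ has a net of $(n+1)^{d-1}$ nodes with mesh
    $1/n$.  The image of a cell around a node, enlarged by $1/n$, lies in a box of
    side $2(L+1)/n$; the boxes have total volume $O(1/n)$. *)
Lemma thin_lipschitz_image (d : nat) (g : 'rV[R]_d.-1 -> 'rV[R]_d) (L : R) :
  (0 < d)%N -> 0 <= L ->
  (forall x y, unit_cube x -> unit_cube y -> `|g x - g y| <= L * `|x - y|) ->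
  thin (g @` @unit_cube R d.-1).
Proof.
move=> d0 L0 lip e e0.
pose C : R := 2 ^+ d.-1 * (2 * L + 3) ^+ d.
have L3 : 0 < 2 * L + 3 by lra.
have C0 : 0 < C by rewrite mulr_gt0// exprn_gt0.
(* The boxes contain at most $(C/n) M^d$ lattice points once $M > n$. *)
pose n := (Num.truncn (C / e)).+1.
have n0 : 0 < n%:R :> R by rewrite ltr0n.
have Cn : C / n%:R <= e.
  by rewrite ler_pdivrMr// mulrC -ler_pdivrMr//; exact/ltW/truncnS_gt.
exists n%:R^-1; first by rewrite invr_gt0.
exists n => M nM; have M0 : (0 < M)%N by exact: leq_trans nM.
have M0' : 0 < M%:R :> R by rewrite ltr0n.
pose node (k : {ffun 'I_d.-1 -> 'I_n.+1}) : 'rV[R]_d.-1 :=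
  \row_i ((k i)%:R / n%:R).
have node_cube k : unit_cube (node k).
  move=> i; rewrite mxE divr_ge0//= ler_pdivrMr// mul1r ler_nat -ltnS.
  exact: ltn_ord.
pose S k : set 'rV[nat]_d := [set t | forall i,
  (g (node k) - const_mx ((L + 1) / n%:R)) ord0 i <= rescale R M t ord0 i
    <= (g (node k) + const_mx ((L + 1) / n%:R)) ord0 i].
have Sk k : card_le_real (S k) ((M%:R / n%:R) ^+ d * (2 * L + 3) ^+ d).
  apply: card_le_realW (card_le_box _ _ M0).
  under eq_bigr do rewrite !mxE.
  have -> : (M%:R / n%:R) ^+ d * (2 * L + 3) ^+ d =
      \prod_(i < d) (M%:R / n%:R * (2 * L + 3)).
    by rewrite prodr_const card_ord -exprMn.
  apply: ler_prod => i _.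
  have Ln : 0 <= (L + 1) / n%:R by apply: divr_ge0 => //; lra.
  rewrite max_r; last by lra.
  apply/andP; split; first by rewrite addr_ge0// mulr_ge0//; lra.
  have -> : M%:R / n%:R * (2 * L + 3) =
      M%:R * (g (node k) ord0 i + (L + 1) / n%:R - (g (node k) ord0 i - (L + 1) / n%:R)) + M%:R / n%:R.
    by field; rewrite gt_eqF.
  by rewrite lerD2l ler_pdivlMr// mul1r ler_nat ltnW.
apply: card_le_real_sub (card_le_real_bigcup (s := index_enum {ffun 'I_d.-1 -> 'I_n.+1}) (fun k _ => Sk k)).
  move=> t [_ [x cx <-]] H.
  pose k : {ffun 'I_d.-1 -> 'I_n.+1} := [ffun i => inord (Num.truncn (n%:R * x ord0 i))].
  exists k; first by rewrite /= mem_index_enum.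
  have xk : `|x - node k| <= n%:R^-1.
    apply: norm_le_coord => [|i]; first by rewrite invr_ge0 ltW.
    have /andP[x0 x1] := cx i.
    have nx0 : 0 <= n%:R * x ord0 i by rewrite mulr_ge0// ltW.
    have /andP[h1 h2] := truncn_itv nx0.
    rewrite !mxE ffunE inordK; last first.
      by rewrite ltnS -(ler_nat R) (le_trans h1)// ler_piMr// ltW.
    rewrite ger0_norm; last by rewrite subr_ge0 ler_pdivrMr// [leRHS]mulrC.
    rewrite lerBlDr -[X in X + _]mul1r -mulrDl ler_pdivlMr// [leLHS]mulrC.
    by move: h2; rewrite -natr1 addrC => /ltW.
  move=> i; have gi : `|g x ord0 i - g (node k) ord0 i| <= L / n%:R.
    have := coord_le_norm (g x - g (node k)) i; rewrite !mxE => /le_trans; apply.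
    apply: le_trans (lip _ _ cx (node_cube k)) _.
    exact: ler_wpM2l.
  have addE a : (g (node k) + const_mx a) ord0 i = g (node k) ord0 i + a.
    by rewrite !mxE.
  have subE a : (g (node k) - const_mx a) ord0 i = g (node k) ord0 i - a.
    by rewrite !mxE.
  have := H i; rewrite addE subE.
  move: gi; rewrite !ler_norml mulrDl mul1r => /andP[? ?] /andP[? ?].
  by apply/andP; split; lra.
rewrite sumr_const card_ffun !card_ord.
set K := (2 * L + 3) ^+ d; have K0 : 0 <= K by rewrite exprn_ge0// ltW.
apply: (@le_trans _ _ (C / n%:R * M%:R ^+ d)); last first.
  by rewrite ler_pM2r// exprn_gt0.
have -> : C / n%:R * M%:R ^+ d =
    (M%:R / n%:R) ^+ d * K * (2 * n%:R) ^+ d.-1.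
  have E (x : R) : x ^+ d = x * x ^+ d.-1 by rewrite -exprS prednK.
  rewrite /C -/K !E [(2 * _) ^+ _]exprMn [(M%:R / _) ^+ _]exprMn exprVn; field.
  by rewrite expf_neq0 ?gt_eqF.
rewrite -[leLHS]mulr_natr ler_wpM2l//.
  by rewrite mulr_ge0// exprn_ge0// divr_ge0// ltW.
rewrite natrX lerXn2r// ?nnegrE ?mulr_ge0 ?ler0n//.
have : 1 <= n%:R :> R by rewrite ler1n.
by rewrite -[n.+1%:R]natr1; lra.
Qed.

Lemma thin_boundary (d : nat) (A : set 'rV[R]_d) : (0 < d)%N ->
  piecewise_smooth_boundary A -> thin (boundary A).
Proof.
move=> d0 [n [g [Hg ->]]]; apply: thin_bigcup => i.
have [U [_ cU gC1]] := Hg i.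
have [L L0 lip] := C1_lipschitz_cube cU gC1.
exact: thin_lipschitz_image lip.
Qed.

End Thin.

(** * Lattice density and Lebesgue measure *)

Section Volume.
Variable R : realType.

(** The segment is connected, so it cannot pass from the interior of the set
    to the complement of its closure without meeting the boundary. *)
Lemma segment_boundary (d : nat) (A : set 'rV[R]_d) (x y : 'rV[R]_d) :
  A x -> ~ A y ->
  exists2 s : R, 0 <= s <= 1 & boundary A (y + s *: (x - y)).
Proof.
move=> Ax nAy; pose g (s : R) := y + s *: (x - y).
have cg : continuous g.
  move=> s; apply: cvgD; first exact: cvg_cst.
  by apply: cvgZr_tmp.
have g1 : g 1 = x by rewrite /g scale1r addrC subrK.
have g0 : g 0 = y by rewrite /g scale0r addr0.
apply: contrapT => H.
have nb (s : R) : `[0, 1]%classic s -> closure A (g s) -> A° (g s).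
  rewrite /= in_itv/= => s01 cl; apply: contrapT => ni; apply: H.
  by exists s.
pose B := `[0, 1]%classic `&` g @^-1` (A°).
have BE : B = `[0, 1]%classic.
  apply: (@segment_connected R 0 1).
  - exists 1; split; rewrite /= ?in_itv/= ?ler01 ?lexx//.
    apply: nb; first by rewrite /= in_itv/= ler01 lexx.
    by rewrite g1; apply: subset_closure.
  - exists (g @^-1` (A°)) => //; apply: open_comp => // *; exact: open_interior.
  - exists (g @^-1` (closure A)).
      by apply: preimage_closed => //; exact: closed_closure.
    apply/seteqP; split => s [s01 gs]; split=> //.
      by apply: subset_closure; exact: interior_subset gs.
    exact: nb.
have : B 0 by rewrite BE /= in_itv/= lexx ler01.
by move=> [_ /=]; rewrite g0 => /interior_subset.
Qed.

Lemma prod_perturb (d : nat) (v : 'I_d -> R) (e : R) : 0 < e ->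
  exists2 dl : R, 0 < dl & \prod_i (v i + dl) <= \prod_i v i + e.
Proof.
move=> e0.
have : (fun x : R => \prod_i (v i + x)) @ (0 : R) --> \prod_i v i.
  apply: cvg_big => [|i _]; first exact: mul_continuous.
  by rewrite -[X in _ --> X]addr0; apply: cvgD; [exact: cvg_cst|exact: cvg_id].
move=> /cvgrPdist_le/(_ _ e0)/nbhs_ballP[r /= r0 /(_ (r / 2))].
rewrite /ball /= sub0r normrN gtr0_norm ?divr_gt0// => H.
exists (r / 2); first by rewrite divr_gt0.
have : r / 2 < r by lra.
by move=> /H; rewrite distrC ler_norml => /andP[_]; rewrite lerBlDl.
Qed.

Lemma Leb_ge0 (d : nat) (A : set 'rV[R]_d) : (0 <= Leb A)%E.
Proof.
apply: le_ereal_inf_tmp => _ [a [b [_ ->]]]; apply: nneseries_ge0 => n _ _.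
by rewrite lee_fin prodr_ge0// => i _; rewrite le_max lexx.
Qed.

(** The cubes of side $1/M$ whose lower corner is a lattice point of the set or
    close to its boundary cover the set: if the corner of the cube containing a
    point of the set is outside, the segment between the two crosses the
    boundary. *)
Lemma Leb_le_count (d : nat) (A : set 'rV[R]_d) (e : R) : (0 < d)%N ->
  bounded_set A -> (forall x, A x -> forall i, 0 <= x ord0 i) ->
  thin (boundary A) -> 0 < e ->
  exists M0 : nat, forall M, (M0 < M)%N ->
    (Leb A <=
      (#|` fset_set (lattice_points A M)|%:R / M%:R ^+ d + e)%:E)%E.
Proof.
move=> d0 bA pA tA e0; have [rho rho0 [M0 HM0]] := tA _ e0.
exists (maxn M0 (Num.truncn rho^-1)) => M; rewrite gtn_max => /andP[MM0 Mrho].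
have M1 : (0 < M)%N by exact: leq_ltn_trans MM0.
have M1' : 0 < M%:R :> R by rewrite ltr0n.
have Mr : M%:R^-1 <= rho.
  rewrite invf_ple ?posrE//; apply: ltW; apply: lt_le_trans (truncnS_gt _) _.
  by rewrite ler_nat.
have [C _ /(_ _ M1) [finA _]] := card_le_lattice_points bA.
pose S := lattice_points A M `|` lattice_points (near_set (boundary A) rho) M.
have [fS cS] : card_le_real S
    (#|` fset_set (lattice_points A M)|%:R + e * M%:R ^+ d).
  by apply: card_le_realU (HM0 _ MM0).
pose l : seq 'rV[nat]_d := fset_set S.
pose a n : 'rV[R]_d := if (n < size l)%N then rescale R M (nth 0 l n) else 0.
pose b n : 'rV[R]_d := if (n < size l)%N then
  rescale R M (nth 0 l n) + const_mx M%:R^-1 else 0.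
apply: (@le_trans _ _ (\sum_(0 <= n <oo) (box_volume (a n) (b n))%:E)%E).
  apply: ereal_inf_lbound; exists a, b; split=> // x Ax.
  pose t : 'rV[nat]_d := \row_i Num.truncn (M%:R * x ord0 i).
  have tx i : rescale R M t ord0 i <= x ord0 i < rescale R M t ord0 i + M%:R^-1.
    have x0 : 0 <= M%:R * x ord0 i by rewrite mulr_ge0// ?pA.
    have /andP[h1 h2] := truncn_itv x0.
    rewrite !mxE; apply/andP; split; first by rewrite ler_pdivrMr// [leRHS]mulrC.
    by rewrite -[X in _ + X]mul1r -mulrDl ltr_pdivlMr// [ltLHS]mulrC natr1.
  have St : S t.
    have [At|nAt] := pselect (A (rescale R M t)); [by left|right].
    have [s /andP[s0 s1] bs] := segment_boundary Ax nAt.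
    exists (rescale R M t + s *: (x - rescale R M t)) => // i.
    rewrite !mxE opprD addNKr normrN normrM ger0_norm//.
    have := tx i; rewrite !mxE => /andP[h1 h2]; rewrite ger0_norm ?subr_ge0//.
    apply: le_trans Mr; apply: le_trans (ler_piMl _ s1) _; first by rewrite subr_ge0.
    by rewrite lerBlDl ltW.
  have tl : t \in l by rewrite in_fset_set//; apply/mem_set.
  exists (index t l) => // i; rewrite /a /b index_mem tl nth_index//.
  by have := tx i; rewrite !mxE.
have vol0 n : (0 <= (box_volume (a n) (b n))%:E)%E.
  by rewrite lee_fin prodr_ge0// => i _; rewrite le_max lexx.
rewrite (@nneseries_split _ _ 0%N (size l))// add0n [X in (_ + X)%E]eseries0 ?adde0; last first.
  move=> n ln _; congr EFin; apply/eqP; rewrite prodf_seq_eq0; apply/hasP.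
  exists (Ordinal d0); first by rewrite mem_index_enum.
  by rewrite /= /a /b ltnNge ln /= !mxE subr0 maxxx.
rewrite big_nat (eq_bigr (fun=> ((M%:R^-1) ^+ d)%:E)); last first.
  move=> n /= nl; congr EFin; rewrite /box_volume.
  rewrite (eq_bigr (fun=> M%:R^-1)) ?prodr_const ?card_ord// => i _.
  rewrite /a /b nl !mxE.
  by rewrite [_ + _ - _]addrAC subrr add0r max_r// invr_ge0 ltW.
rewrite -big_nat sumEFin lee_fin sumr_const_nat subn0.
rewrite -[leLHS]mulr_natl exprVn ler_pdivrMr ?exprn_gt0// mulrDl.
by rewrite divfK// expf_neq0// gt_eqF.
Qed.

Lemma open_box_open (d : nat) (a b : 'rV[R]_d) :
  open [set x : 'rV[R]_d | forall i, a ord0 i < x ord0 i < b ord0 i].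
Proof.
rewrite (_ : [set x : 'rV[R]_d | _] =
    \bigcap_(i in [set` index_enum 'I_d])
      ((fun x : 'rV[R]_d => x ord0 i) @^-1` `]a ord0 i, b ord0 i[)).
  rewrite bigcap_seq; elim/big_ind : _ => [|A B|i _]; [exact: openT|exact: openI|].
  by apply: open_comp => [x _|]; [exact: coord_continuous|exact: itv_open].
apply/seteqP; split => x H i; first by move=> _ /=; rewrite in_itv/=; exact: H.
by have := H i (mem_index_enum i); rewrite /= in_itv.
Qed.

End Volume.

Section VolumeLimit.
Variable R : realType.

Lemma sum_half_lt1 (n : nat) : \sum_(0 <= k < n) (2 : R) ^- k.+1 <= 1.
Proof.
have -> : \sum_(0 <= k < n) (2 : R) ^- k.+1 = 1 - 2 ^- n.
  elim: n => [|n IH]; first by rewrite big_nil expr0 invr1 subrr.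
  rewrite big_nat_recr//= IH exprS; field.
  by rewrite expf_neq0.
by rewrite gerBl invr_ge0 exprn_ge0.
Qed.

(** Away from its boundary the set is compact, so finitely many boxes of a
    nearly optimal cover, slightly enlarged to be open, capture all the lattice
    points except the few that are close to the boundary. *)
Lemma count_le_Leb (d : nat) (A : set 'rV[R]_d) (e : R) :
  bounded_set A -> thin (boundary A) -> 0 < e -> Leb A \is a fin_num ->
  exists M0 : nat, forall M, (M0 < M)%N ->
    card_le_real (lattice_points A M) ((fine (Leb A) + e) * M%:R ^+ d).
Proof.
move=> bA tA e0 fL; pose e3 := e / 3; have e30 : 0 < e3 by rewrite divr_gt0.
have [_ [a [b [Aab ->]]] sumlt] := lb_ereal_inf_adherent e30 fL.
have [rho rho0 [M1 HM1]] := tA _ e30.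
have vol0 n : 0 <= box_volume (a n) (b n).
  by rewrite prodr_ge0// => i _; rewrite le_max lexx.
pose v n i := Num.max 0 (b n ord0 i - a n ord0 i).
have v0 n i : 0 <= v n i by rewrite le_max lexx.
have /choice[dl Hdl] : forall n, exists dl : R, 0 < dl /\
    \prod_i (v n i + dl) <= box_volume (a n) (b n) + e3 * 2 ^- n.+1.
  move=> n; have [|dl dl0 H] := @prod_perturb R d (v n) (e3 * 2 ^- n.+1).
    by rewrite mulr_gt0// invr_gt0 exprn_gt0.
  by exists dl.
have dl0 n : 0 < dl n by have [] := Hdl n.
pose N := \bigcup_(y in boundary A) ball y rho.
pose K := closure A `&` ~` N.
have NE x : N x -> near_set (boundary A) rho x.
  move=> [y By]; rewrite mx_norm_ball /ball_ /= => /ltW yx; exists y => // i.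
  apply: le_trans yx; rewrite distrC.
  by have := coord_le_norm (y - x) i; rewrite !mxE.
have bK : bounded_set K.
  have [B B0 HB] := bounded_coord bA.
  exists B%:R; split => // c Bc x [cAx _]; apply: norm_le_coord => [|i].
    by apply: le_trans (ltW Bc).
  have : closed [set x : 'rV[R]_d | `|x ord0 i| <= B%:R].
    rewrite (_ : [set x : 'rV[R]_d | _] =
      (fun x : 'rV[R]_d => `|x ord0 i|) @^-1` [set y | y <= B%:R]) //.
    apply: preimage_closed; last exact: closed_le.
    move=> y _; apply: continuous_comp; first exact: coord_continuous.
    exact: norm_continuous.
  move=> /closure_id cl; have : closure [set x : 'rV[R]_d | `|x ord0 i| <= B%:R] x.
    by apply: closure_subset cAx => y Ay; exact: HB.
  by rewrite -cl /= => /le_trans; apply; exact: ltW.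
have cK : compact K.
  apply: bounded_closed_compact => //; apply: closedI; first exact: closed_closure.
  by apply: open_closedC; apply: bigcup_open => y _; exact: ball_open.
have KA : K `<=` A.
  move=> x [cAx nN]; apply: contrapT => nAx; apply: nN; exists x.
    by split=> // /interior_subset.
  by apply: ballxx.
(* Half of the enlargement [dl n] makes the box open; the other half absorbs the
   extra lattice point per coordinate in the count. *)
pose O n : set 'rV[R]_d := [set x : 'rV[R]_d | forall i,
  (a n - const_mx (dl n / 2)) ord0 i < x ord0 i < (b n) ord0 i].
have boxO n x : box (a n) (b n) x -> O n x.
  move=> H i; have /andP[h1 h2] := H i; rewrite h2 andbT !mxE.
  by have := dl0 n; lra.
move: cK; rewrite compact_cover => /(_ nat setT O) [n _|x /KA /Aab[n _ bx]|D' _ KD'].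
- exact: open_box_open.
- by exists n => //; exact: boxO.
have [m Hm] : exists m, forall n, n \in D' -> (n < m)%N.
  exists (\max_(n <- D') n).+1 => n nD'; rewrite ltnS.
  by apply: (@leq_bigmax_seq _ _ xpredT (fun k : nat => k)).
have /choice[M2 HM2] : forall n, exists M2 : nat, forall M, (M2 < M)%N ->
    M%:R^-1 <= dl n / 2.
  move=> n; exists (Num.truncn (dl n / 2)^-1) => M h.
  have M0 : 0 < M%:R :> R by rewrite ltr0n (leq_ltn_trans _ h).
  rewrite invf_ple ?posrE ?divr_gt0//; apply: ltW.
  by apply: lt_le_trans (truncnS_gt _) _; rewrite ler_nat.
exists (maxn M1 (\max_(0 <= n < m) M2 n)) => M; rewrite gtn_max => /andP[MM1 MM2].
have M0 : (0 < M)%N by exact: leq_ltn_trans MM1.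
have M0' : 0 < M%:R :> R by rewrite ltr0n.
pose S n : set 'rV[nat]_d := [set t | forall i,
  (a n - const_mx (dl n / 2)) ord0 i <= rescale R M t ord0 i <= (b n) ord0 i].
have Sn n : n \in index_iota 0 m -> card_le_real (S n)
    ((box_volume (a n) (b n) + e3 * 2 ^- n.+1) * M%:R ^+ d).
  move=> nm; apply: card_le_realW (card_le_box _ _ M0).
  have [_] := Hdl n; rewrite -(ler_pM2r (exprn_gt0 d M0')).
  apply: le_trans.
  have -> : M%:R ^+ d = \prod_(i < d) M%:R :> R by rewrite prodr_const card_ord.
  rewrite -big_split /=; apply: ler_prod => i _.
  have mx0 : 0 <= Num.max 0 (b n ord0 i - (a n - const_mx (dl n / 2)) ord0 i).
    by rewrite le_max lexx.
  rewrite addr_ge0 ?mulr_ge0//=.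
  have MM : M%:R^-1 <= dl n / 2.
    apply: HM2; apply: leq_ltn_trans MM2.
    by apply: (@leq_bigmax_seq _ _ xpredT M2).
  have le1 : Num.max 0 (b n ord0 i - (a n - const_mx (dl n / 2)) ord0 i)
      <= v n i + dl n / 2.
    have := dl0 n; have := v0 n i => v00 dl00.
    rewrite ge_max; apply/andP; split; first by lra.
    rewrite !mxE; have : b n ord0 i - a n ord0 i <= v n i by rewrite le_max lexx orbT.
    by lra.
  set x := Num.max _ _ in le1 *.
  have -> : M%:R * x + 1 = (x + M%:R^-1) * M%:R.
    by rewrite mulrDl mulVf ?gt_eqF// mulrC.
  by rewrite ler_pM2r// [X in _ <= _ + X](splitr (dl n)) addrA lerD.
have := card_le_realU (HM1 _ MM1) (card_le_real_bigcup Sn).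
apply: card_le_real_sub => [t At|].
  have [Nt|nNt] := pselect (N (rescale R M t)); first by left; exact: NE.
  right; have [|n nD' On] := KD' (rescale R M t).
    by split=> //; exact: subset_closure.
  exists n; first by rewrite /= mem_index_iota Hm.
  by move=> i; have /andP[/ltW -> /ltW ->] := On i.
rewrite -mulr_suml -mulrDl ler_pM2r ?exprn_gt0// big_split/= -mulr_sumr.
have : \sum_(0 <= n < m) box_volume (a n) (b n) < fine (Leb A) + e3.
  rewrite -lte_fin -sumEFin EFinD fineK//; apply: le_lt_trans sumlt.
  by apply: nneseries_lim_ge => n _ _; rewrite lee_fin.
have : e3 * \sum_(0 <= n < m) 2 ^- n.+1 <= e3.
  by rewrite -[leRHS]mulr1 ler_pM2l//; exact: sum_half_lt1.
by rewrite /e3; lra.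
Qed.

Lemma Leb_fin_num (d : nat) (A : set 'rV[R]_d) : (0 < d)%N ->
  bounded_set A -> (forall x, A x -> forall i, 0 <= x ord0 i) ->
  thin (boundary A) -> Leb A \is a fin_num.
Proof.
move=> d0 bA pA tA; rewrite ge0_fin_numE ?Leb_ge0//.
have [M0 /(_ _ (ltnSn _)) H] := Leb_le_count d0 bA pA tA ltr01.
by apply: le_lt_trans H _; rewrite ltry.
Qed.

Lemma lattice_density (d : nat) (A : set 'rV[R]_d) : (0 < d)%N ->
  bounded_set A -> (forall x, A x -> forall i, 0 <= x ord0 i) ->
  thin (boundary A) ->
  (fun M : nat => #|` fset_set (lattice_points A M)|%:R / M%:R ^+ d : R) @ \oo
    --> fine (Leb A).
Proof.
move=> d0 bA pA tA; apply/cvgrPdist_le => e e0.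
have fL := Leb_fin_num d0 bA pA tA.
have [M1 H1] := Leb_le_count d0 bA pA tA e0.
have [M2 H2] := count_le_Leb bA tA e0 fL.
exists (maxn M1 M2).+1 => // M /=; rewrite gtn_max => /andP[/H1 h1 m2].
have [_ h2] := H2 _ m2.
have M0 : 0 < M%:R ^+ d :> R by rewrite exprn_gt0// ltr0n (leq_ltn_trans _ m2).
move: h1; rewrite -(fineK fL) lee_fin => h1.
rewrite -ler_pdivrMr// in h2.
by rewrite ler_norml; apply/andP; split; lra.
Qed.

End VolumeLimit.

(** * Times of lattice points under affine forms *)

Section LatticeTimes.
Variable R : realType.

Lemma affine_form_continuous (d : nat) (s0 : R) (s : 'rV[R]_d) :
  continuous (affine_form s0 s).
Proof.
move=> x; rewrite /affine_form.
apply: (@continuousD _ _ _ (fun=> s0) (fun y : 'rV[R]_d => \sum_j s ord0 j * y ord0 j)).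
  exact: cst_continuous.
have cst_sum (r : seq 'I_d) : {for x, continuous
    (fun y : 'rV[R]_d => \sum_(j <- r) s ord0 j * y ord0 j)}.
  elim: r => [|j r IH].
    rewrite (_ : (fun _ => _) = fun=> 0); first exact: cst_continuous.
    by apply/funext => y; rewrite big_nil.
  rewrite (_ : (fun _ => _) = (fun y : 'rV[R]_d => s ord0 j * y ord0 j) +
      (fun y : 'rV[R]_d => \sum_(j <- r) s ord0 j * y ord0 j)); last first.
    by apply/funext => y; rewrite big_cons.
  apply: continuousD IH.
  apply: (@continuousM _ _ (fun=> s ord0 j) (fun y : 'rV[R]_d => y ord0 j)).
    exact: cst_continuous.
  exact: coord_continuous.
exact: cst_sum.
Qed.

(** A value $v$ is attained in the interior, since the latter is connected;
    moving the point along a coordinate $j$ with $s_j \neq 0$ attains the values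
    near $v$, and rounding the point to the lattice changes $M\ell$ by at most
    $\sum_j |s_j|$.  Compactness of the interval of values makes the threshold on
    $M$ uniform, so the times of lattice points have bounded gaps. *)
Lemma lattice_time (d : nat) (A : set 'rV[R]_d) (s0 : R) (s x1 x2 : 'rV[R]_d) :
  connected A° -> (forall x, A x -> forall i, 0 <= x ord0 i) -> s != 0 ->
  A° x1 -> A° x2 ->
  exists M0 : nat, forall M, (M0 < M)%N -> forall v,
    affine_form s0 s x1 <= v <= affine_form s0 s x2 ->
    exists2 t, lattice_points A M t &
      `|M%:R * affine_form s0 s (rescale R M t) - M%:R * v|
        <= \sum_j `|s ord0 j|.
Proof.
move=> cA pA s_neq0 Ax1 Ax2; set v1 := affine_form s0 s x1.
set v2 := affine_form s0 s x2.
have /rV0Pn[j sj] := s_neq0; have sj0 : 0 < `|s ord0 j| by rewrite normr_gt0.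
have : compact `[v1, v2]%classic by exact: segment_compact.
move=> /compact_near_coveringP/(_ nat \oo (fun M v => (0 < M)%N ->
    exists2 t, lattice_points A M t &
      `|M%:R * affine_form s0 s (rescale R M t) - M%:R * v|
        <= \sum_j `|s ord0 j|)) /= H.
suff [M0 _ HM0] : \forall M \near \oo, `[v1, v2]%classic `<=`
    (fun v => (0 < M)%N -> exists2 t, lattice_points A M t &
      `|M%:R * affine_form s0 s (rescale R M t) - M%:R * v|
        <= \sum_j `|s ord0 j|).
  exists M0 => M M0M v v12; apply: (HM0 M (ltnW M0M) v).
    by rewrite /= in_itv.
  exact: leq_ltn_trans M0M.
apply: H => v; rewrite /= in_itv/= => v12.
have [x Ax xv] : exists2 x, A° x & affine_form s0 s x = v.
  have : connected (affine_form s0 s @` A°).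
    apply: connected_continuous_connected => //.
    by apply: continuous_subspaceT; exact: affine_form_continuous.
  move=> /connected_intervalP itv.
  have [||x Ax xv] := itv v1 v2 _ _ v v12; [by exists x1|by exists x2|].
  by exists x.
move: Ax => /nbhs_ballP[rho /= rho0 ballA].
exists (ball v (`|s ord0 j| * (rho / 2)), [set M | (Num.truncn (rho / 2)^-1 < M)%N]).
  split => /=; first by apply: nbhsx_ballx; rewrite mulr_gt0// divr_gt0.
  by exists (Num.truncn (rho / 2)^-1).+1.
move=> [v' M] [/= v'v Mrho] M0.
have M0' : 0 < M%:R :> R by rewrite ltr0n.
have Mr : M%:R^-1 < rho / 2.
  rewrite invf_plt ?posrE ?divr_gt0//.
  by apply: lt_le_trans (truncnS_gt _) _; rewrite ler_nat.
pose x' : 'rV[R]_d := \row_i (x ord0 i + if i == j then (v' - v) / s ord0 j else 0).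
have x'v : affine_form s0 s x' = v'.
  rewrite -[RHS](subrK v) [RHS]addrC -{1}xv /affine_form -addrA; congr (_ + _).
  under eq_bigr do rewrite mxE mulrDr.
  rewrite big_split/=; congr (_ + _).
  rewrite (bigD1 j)//= eqxx big1 ?addr0 => [|i /negbTE ->]; last by rewrite mulr0.
  by rewrite mulrCA divff// mulr1.
have x'x i : `|x' ord0 i - x ord0 i| < rho / 2.
  rewrite mxE addrAC subrr add0r; case: eqP => _; last by rewrite normr0 divr_gt0.
  rewrite normrM normfV ltr_pdivrMr// mulrC distrC.
  by move: v'v; rewrite /ball/=.
have near_A (y : 'rV[R]_d) : (forall i, `|y ord0 i - x ord0 i| < rho) -> A y.
  move=> H; apply: ballA; rewrite mx_norm_ball /ball_ /=.
  have [e /= e0 He] : exists2 e : R, 0 < e & forall i, `|y ord0 i - x ord0 i| <= rho - e.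
    pose m := \big[Num.max/0]_i `|y ord0 i - x ord0 i|.
    have mrho : m < rho by apply/bigmax_ltP; split.
    exists (rho - m); first by rewrite subr_gt0.
    by move=> k; rewrite subKr; exact: (le_bigmax _ (fun i => `|y ord0 i - x ord0 i|)).
  apply: (@le_lt_trans _ _ (Num.max 0 (rho - e))).
    apply: norm_le_coord => [|i]; first by rewrite le_max lexx.
    by rewrite le_max !mxE distrC He orbT.
  by rewrite gt_max rho0 ltrBlDr ltrDl.
have x'0 i : 0 <= x' ord0 i.
  apply: (pA x'); apply: near_A => k; apply: lt_trans (x'x k) _.
  by rewrite ltr_pdivrMr// ltr_pMr// ltr1n.
pose t : 'rV[nat]_d := \row_i Num.truncn (M%:R * x' ord0 i).
have tx i : `|(t ord0 i)%:R - M%:R * x' ord0 i| < 1.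
  have : 0 <= M%:R * x' ord0 i by rewrite mulr_ge0.
  have -> : t ord0 i = Num.truncn (M%:R * x' ord0 i) by rewrite [LHS]mxE.
  move=> /truncn_itv; rewrite -natr1 => /andP[h1 h2].
  by rewrite ltr_norml; apply/andP; split; lra.
exists t.
  apply: near_A => i.
  rewrite -(subrK (x' ord0 i) (rescale R M t ord0 i)) -addrA [rho]splitr.
  apply: le_lt_trans (ler_normD _ _) _; apply: ltrD (x'x i).
  apply: lt_trans Mr; rewrite mxE.
  have -> : (t ord0 i)%:R / M%:R - x' ord0 i = ((t ord0 i)%:R - M%:R * x' ord0 i) / M%:R.
    by field; rewrite gt_eqF.
  by rewrite normrM (@gtr0_norm _ M%:R^-1) ?invr_gt0// gtr_pMl ?invr_gt0.
rewrite affine_form_rescale// -x'v /affine_form mulrDr mulr_sumr.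
rewrite opprD addrACA subrr add0r -sumrB.
apply: le_trans (ler_norm_sum _ _ _) _; apply: ler_sum => i _.
by rewrite mulrCA -mulrBr normrM ler_piMr// ltW.
Qed.

End LatticeTimes.

Section Clock.
Variable R : realType.

Lemma affine_formN (d : nat) (s0 : R) (s x : 'rV[R]_d) :
  affine_form (- s0) (- s) x = - affine_form s0 s x.
Proof.
rewrite /affine_form opprD -sumrN; congr (_ + _); apply: eq_bigr => j _.
by rewrite mxE mulNr.
Qed.

Lemma affine_formB (d : nat) (s0 s0' : R) (s s' x : 'rV[R]_d) :
  affine_form (s0 - s0') (s - s') x = affine_form s0 s x - affine_form s0' s' x.
Proof.
rewrite /affine_form opprD addrACA -sumrB; congr (_ + _); apply: eq_bigr => j _.
by rewrite !mxE mulrBl.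
Qed.

Lemma affine_form_interior_lt (d : nat) (A : set 'rV[R]_d) (s0 : R) (s y : 'rV[R]_d)
    (v : R) : A `<=` closure A° -> A y -> affine_form s0 s y < v ->
  exists2 x, A° x & affine_form s0 s x < v.
Proof.
move=> AcA Ay yv.
have : nbhs y (affine_form s0 s @^-1` [set z | z < v]).
  apply: open_nbhs_nbhs; split => //; apply: open_comp; last exact: open_lt.
  by move=> x _; exact: affine_form_continuous.
by move=> /(AcA _ Ay)[x [Ax xv]]; exists x.
Qed.

Lemma affine_form_le_closure (d : nat) (A : set 'rV[R]_d) (s0 s0' : R) (s s' : 'rV[R]_d) :
  A `<=` closure A° ->
  (forall x, A° x -> affine_form s0 s x < affine_form s0' s' x) ->
  forall x, A x -> affine_form s0 s x <= affine_form s0' s' x.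
Proof.
move=> AcA lt x Ax; rewrite leNgt -subr_lt0 -affine_formB; apply/negP => h.
have [y Ay] := affine_form_interior_lt AcA Ax h.
by rewrite affine_formB subr_lt0 ltNge (ltW (lt _ Ay)).
Qed.

Lemma affine_form_bounded (d : nat) (A : set 'rV[R]_d) (s0 : R) (s : 'rV[R]_d) :
  bounded_set A -> exists2 B : R, 0 <= B &
    forall x, A x -> `|affine_form s0 s x| <= B.
Proof.
move=> /bounded_coord[b b0 Hb]; exists (`|s0| + \sum_j `|s ord0 j| * b%:R).
  by rewrite addr_ge0// sumr_ge0// => j _; rewrite mulr_ge0.
move=> x Ax; apply: le_trans (ler_normD _ _) _; rewrite lerD2l.
apply: le_trans (ler_norm_sum _ _ _) _; apply: ler_sum => j _.
by rewrite normrM ler_wpM2l// Hb.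
Qed.

Lemma nat_large (x : R) : exists M0 : nat, forall M, (M0 < M)%N -> x < M%:R.
Proof.
exists (Num.truncn x) => M h; apply: lt_le_trans (truncnS_gt x) _.
by rewrite ler_nat.
Qed.

Lemma ln_large (x : R) : exists M0 : nat, forall M, (M0 < M)%N -> x < ln M%:R.
Proof.
have [M0 H] := nat_large (expR x); exists M0 => M /H xM.
by rewrite -ltr_expR lnK// posrE (lt_trans (expR_gt0 x)).
Qed.

(** The bound $\ln y \le y$ applied to the square root of $M$. *)
Lemma ln_small (e : R) : 0 < e ->
  exists M0 : nat, forall M, (M0 < M)%N -> ln M%:R + 1 <= e * M%:R.
Proof.
move=> e0.
have [M0 H] := nat_large ((3 / e) ^+ 2); exists M0 => M MM0.
have M0' : 0 < M%:R :> R by rewrite ltr0n (leq_ltn_trans _ MM0).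
set x : R := M%:R; have x0 : 0 < x by [].
pose y := Num.sqrt x; have yy : y * y = x by rewrite -expr2 sqr_sqrtr// ltW.
have y0 : 0 < y by rewrite sqrtr_gt0.
have y1 : 1 <= y.
  by rewrite -[1](sqrtr1 R) ler_wsqrtr// /x ler1n (leq_ltn_trans _ MM0).
have ly : ln y <= y.
  have := @le_ln1Dx R (y - 1); rewrite [1 + _]addrC subrK => h.
  by apply: le_trans (h _) _; lra.
have -> : ln x = ln y + ln y by rewrite -yy lnM.
have ye : 3 / e < y.
  have := H _ MM0; rewrite -/x -yy -expr2 ltr_pXn2r// nnegrE ?ltW// divr_gt0//.
have : 3 <= e * y by rewrite mulrC -ler_pdivrMr// ltW.
move=> ey; have : 3 * y <= e * y * y by rewrite ler_pM2r.
by rewrite -yy mulrA; lra.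
Qed.

(** The excluded sites lie in two slabs whose widths shrink with $\delta$: the
    form $\ell_1$ is close to its infimum over $D'$, of which $x_1$ is an
    approximate minimiser, or $\hat\ell - \ell_1$ is small.  In the second case
    there is no slab when the difference is constant, but then it is a positive
    constant and nothing is excluded. *)
Lemma few_bad_sites (d : nat) (D D' : set 'rV[R]_d) (s0 sh0 : R) (s sh : 'rV[R]_d)
    (h : R) :
  bounded_domain D -> bounded_domain D' -> D `<=` D' -> s != 0 ->
  (forall x, D° x -> affine_form s0 s x < affine_form sh0 sh x) -> 0 < h ->
  exists2 delta, 0 < delta & exists2 x1, D'° x1 & exists M0 : nat,
    forall M, (M0 < M)%N -> card_le_real [set t | lattice_points D M t /\
      ~~ ((affine_form s0 s x1 + delta <= affine_form s0 s (rescale R M t)) &&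
        (affine_form s0 s (rescale R M t) + delta
          <= affine_form sh0 sh (rescale R M t)))] (h * M%:R ^+ d).
Proof.
move=> [[x0 Dx0] _ DcD bD] [_ _ D'cD' bD'] DD' sn0 lt h0.
have le := affine_form_le_closure DcD lt.
have [C C0 HC] := card_le_slab s0 bD sn0.
have [C' C'0 [delta0 delta00 HC']] : exists2 C', 0 <= C' & exists2 delta0 : R, 0 < delta0 &
    forall delta, 0 < delta <= delta0 -> forall M, (0 < M)%N ->
    card_le_real [set t | lattice_points D M t /\
      ~~ (affine_form s0 s (rescale R M t) + delta
          <= affine_form sh0 sh (rescale R M t))] (C' * M%:R ^+ d * (delta * M%:R + 1) / M%:R).
  have [e|ne] := eqVneq (sh - s) 0.
    exists 0 => //.
    have E x : affine_form sh0 sh x = affine_form s0 s x + (sh0 - s0).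
      move/eqP: e; rewrite subr_eq0 => /eqP ->; rewrite /affine_form; ring.
    have e0 : 0 < sh0 - s0 by have := lt _ Dx0; rewrite E; lra.
    exists (sh0 - s0) => // delta /andP[d0 d1] M M0.
    rewrite !mul0r (_ : [set t | _] = set0); first by split; rewrite ?fset_set0.
    by apply/seteqP; split => // t [_]; rewrite E lerD2l d1.
  have [C' C'0 H] := card_le_slab (sh0 - s0) bD ne.
  exists C'; first exact: ltW.
  exists 1 => // delta /andP[d0 _] M M0.
  have w0 : 0 <= delta * M%:R by rewrite mulr_ge0// ltW.
  apply: card_le_real_sub (H M M0 0 (delta * M%:R) w0) => // t [Dt].
  rewrite -ltNge => ltd; split => //; rewrite affine_formB.
  apply/andP; split; first by rewrite mulr_ge0// subr_ge0; exact: le.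
  by rewrite add0r mulrC ler_pM2r ?ltr0n//; lra.
pose K := 2 * C + C' + 1; have K0 : 0 < K by rewrite /K; lra.
pose delta := Num.min delta0 (h / 2 / K).
have de0 : 0 < delta by rewrite lt_min delta00 !divr_gt0.
have [B B0 HB] := affine_form_bounded s0 s bD'.
pose al := inf (affine_form s0 s @` D').
have D'0 : D' x0 by apply: DD'; exact: interior_subset.
have hi : has_inf (affine_form s0 s @` D').
  split; first by exists (affine_form s0 s x0), x0.
  by exists (- B) => _ [x D'x <-]; have := HB _ D'x; rewrite ler_norml => /andP[].
have alle x : D' x -> al <= affine_form s0 s x.
  by move=> D'x; apply: ge_inf; [case: hi|exists x].
have [_ [y D'y <-] yal] := inf_adherent de0 hi.
have [x1 D'x1 x1al] := affine_form_interior_lt D'cD' D'y yal.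
exists delta => //; exists x1 => //.
have [M0 HM0] := nat_large (2 * (C + C') / h).
exists M0 => M MM0; have M1 : (0 < M)%N by exact: leq_ltn_trans MM0.
have M1' : 0 < M%:R :> R by rewrite ltr0n.
have w0 : 0 <= 2 * delta * M%:R by rewrite !mulr_ge0// ltW.
have dd0 : 0 < delta <= delta0 by rewrite de0 ge_min lexx.
apply: card_le_real_sub (card_le_realU (HC M M1 (M%:R * al) _ w0) (HC' _ dd0 M M1)).
  move=> t [Dt]; rewrite negb_and -ltNge => /orP[ltx|nle]; [left|by right].
  split=> //; rewrite ler_pM2l// alle/=; last exact: DD'.
  have -> : M%:R * al + 2 * delta * M%:R = M%:R * (al + 2 * delta) by ring.
  rewrite ler_pM2l//; move: ltx x1al; rewrite -/al -/delta; lra.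
have -> : C * M%:R ^+ d * (2 * delta * M%:R + 1) / M%:R +
    C' * M%:R ^+ d * (delta * M%:R + 1) / M%:R =
  ((2 * C + C') * delta + (C + C') / M%:R) * M%:R ^+ d by field; rewrite gt_eqF.
rewrite ler_pM2r ?exprn_gt0//.
have h1 : (2 * C + C') * delta <= h / 2.
  apply: (@le_trans _ _ (K * delta)); first by rewrite ler_pM2r// /K; lra.
  by rewrite mulrC -ler_pdivlMr// ge_min lexx orbT.
have h2 : (C + C') / M%:R <= h / 2.
  have := ltW (HM0 _ MM0); rewrite ler_pdivrMr// ler_pdivrMr//; lra.
by lra.
Qed.

End Clock.

(** * Independent Poisson variables *)

Section PoissonVector.
Variable R : realType.

(** The generating function is a ratio of total masses: weighting the law of rate
    $\lambda$ by $u^k$ gives a multiple of the law of rate $\lambda u$. *)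
Lemma poisson_pgf (lam u : R) (n : nat) : 0 <= lam -> 0 < u ->
  (\int[poisson_prob lam n]_k (u ^+ k)%:E = (expR (lam * (u - 1)))%:E)%E.
Proof.
rewrite le_eqVlt => /orP[/eqP <-|lam0] u0.
  rewrite mul0r expR0 (eq_measure_integral (\d_0%N)) => [|A mA _]; last first.
    by rewrite /= /poisson_prob ltxx.
  by rewrite integral_dirac//= diracT mul1e expr0.
have lu0 : 0 < lam * u by rewrite mulr_gt0.
have -> : [set: nat] = \bigcup_k [set k].
  by apply/seteqP; split => // k _; exists k.
rewrite ge0_integral_bigcup//=; last 2 first.
- by move=> k _; rewrite lee_fin exprn_ge0// ltW.
- by move=> i j _ _ [x [/= -> ->]].
transitivity (\sum_(0 <= k <oo) ((expR (lam * (u - 1)))%:E *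
    (poisson_pmf (lam * u) k)%:E))%E.
  apply: eq_eseriesr => k _.
  rewrite (eq_integral (cst (u ^+ k)%:E)) => [|x /set_mem ->//].
  rewrite integral_cst// /= /poisson_prob lam0 esum_set1; last first.
    by rewrite lee_fin poisson_pmf_ge0.
  rewrite -!EFinM /poisson_pmf lam0 lu0; congr EFin.
  rewrite exprMn mulrBr mulr1 expRD [in RHS]expRN [X in _ = X * _]mulrC.
  rewrite expRN; field; rewrite !gt_eqF ?expR_gt0// ltr0n fact_gt0.
rewrite nneseriesZl; last by move=> k _; rewrite lee_fin poisson_pmf_ge0.
rewrite nneseries_esumT => [|k]; last by rewrite lee_fin poisson_pmf_ge0.
have := probability_setT (poisson_prob (lam * u) n).
by rewrite /= /poisson_prob lu0 => ->; rewrite mule1.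
Qed.

(** The product space is built one factor at a time, along an enumeration of
    the indices, and the integral of a product is computed by Tonelli's theorem. *)
Lemma independent_vector (I : eqType) (mu : I -> probability nat R) (s : seq I) :
  uniq s ->
  exists (d : measure_display) (T : measurableType d) (P : probability T R)
    (Z : I -> T -> nat),
    (forall i, measurable_fun setT (Z i)) /\
    forall g : I -> nat -> R, (forall i k, 0 <= g i k) ->
      (\int[P]_w (\prod_(i <- s) g i (Z i w))%:E =
       \prod_(i <- s) \int[mu i]_k (g i k)%:E)%E.
Proof.
elim: s => [_|i s IH /= /andP[ins us]].
  exists _, unit, (\d_tt : probability unit R), (fun _ _ => 0%N); split => // g g0.
  rewrite [RHS]big_nil (eq_integral (cst 1%E)) => [|w _ /=].
    by rewrite integral_cst// mul1e; exact: probability_setT.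
  by rewrite big_nil.
have [d [T [P [Z [mZ HZ]]]]] := IH us.
exists _, (nat * T)%type, (mu i \x P)%E,
  (fun k w => if k == i then w.1 else Z k w.2); split => [k|g g0].
  by case: eqP => _; [exact: measurable_fst|exact: measurableT_comp].
have mg k : measurable_fun setT (g k) by [].
have -> : (\int[mu i \x P]_w (\prod_(k <- i :: s)
    g k (if k == i then w.1 else Z k w.2))%:E =
  \int[mu i \x P]_w ((g i w.1)%:E * (\prod_(k <- s) g k (Z k w.2))%:E))%E.
  apply: eq_integral => w _; rewrite big_cons eqxx EFinM; congr (_ * _%:E)%E.
  by apply: eq_big_seq => k ks; rewrite (negbTE (memPn ins _ ks)).
have mp : measurable_fun setT (fun w => \prod_(k <- s) g k (Z k w)).
  by apply: measurable_prod => k _; exact: measurableT_comp.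
have p0 w : 0 <= \prod_(k <- s) g k (Z k w) by exact: prodr_ge0.
rewrite fubini_tonelli1/=; last 2 first.
- apply: emeasurable_funM; apply/measurable_EFinP.
    by apply: measurableT_comp; [exact: mg|exact: measurable_fst].
  by apply: (measurableT_comp mp); exact: measurable_snd.
- by move=> w; rewrite mule_ge0// lee_fin.
rewrite big_cons -HZ// -ge0_integralZr//; last 2 first.
- by move=> k _; rewrite lee_fin.
- by apply: integral_ge0 => w _; rewrite lee_fin.
apply: eq_integral => k _; rewrite /fubini_F/= ge0_integralZl//.
- by apply/measurable_EFinP.
- by move=> w _; rewrite lee_fin.
- by rewrite lee_fin.
Qed.

End PoissonVector.

Section JointLaw.
Variable R : realType.

Lemma prod_indicE (I : finType) (T : Type) (A : I -> set T) (w : T) :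
  \prod_i (\1_(A i) w : R) = \1_(\bigcap_(i in [set: I]) A i) w.
Proof.
rewrite [RHS]indicE; case: (boolP (_ \in _)) => [/set_mem H|/negP H].
  by rewrite big1// => i _; rewrite indicE mem_set//; exact: H.
apply/eqP/prodf_eq0; apply: contrapT => nex; apply: H; apply/mem_set => i _.
apply: contrapT => nA; apply: nex; exists i => //.
by rewrite indicE memNset.
Qed.

(** The generating function is read off from the product space, as the case
    $g_i(k) = u_i^k$ of the product formula; independence and the laws are the
    case of indicators. *)
Lemma poisson_vector (I : finType) (lam : I -> R) : (forall i, 0 <= lam i) ->
  exists (d : measure_display) (T : measurableType d) (P : probability T R)
    (Z : I -> {RV P >-> nat}),
    [/\ mutually_independent Z,
        forall i, distribution P (Z i) =1 poisson_prob (lam i) 0 &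
        forall u : I -> R, (forall i, 0 < u i) ->
          'E_P[fun w => (\prod_i u i ^+ Z i w)%R]%E =
            (\prod_i expR (lam i * (u i - 1)))%:E].
Proof.
move=> lam0.
have [d [T [P [Z' [mZ HZ]]]]] := @independent_vector R I
  (fun i => poisson_prob (lam i) 0 : probability nat R) (index_enum I)
  (index_enum_uniq I).
pose Z i : {RV P >-> nat} := mfun_Sub (mem_set (mZ i)).
have ZE i : Z i = Z' i :> (_ -> _) by [].
have indep A : P (\bigcap_(i in [set: I]) (Z i @^-1` A i)) =
    (\prod_(i : I) (poisson_prob (lam i) 0 : probability nat R) (A i))%E.
  transitivity (\int[P]_w (\1_(\bigcap_(i in [set: I]) (Z i @^-1` A i)) w)%:E)%E.
    rewrite integral_indic ?setIT//.
    by apply: fin_bigcap_measurable => // i _; exact: measurable_funPTI.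
  under eq_integral do rewrite -prod_indicE.
  rewrite (HZ (fun i => \1_(A i))) => [|i k]; last by rewrite indicE.
  by apply: eq_bigr => i _; rewrite integral_indic ?setIT.
have distr i A : P (Z i @^-1` A) = (poisson_prob (lam i) 0 : probability nat R) A.
  have := indep (fun k => if k == i then A else setT).
  rewrite (bigD1 i)//= eqxx [X in (_ * X)%E]big1 ?mule1 => [|k /negbTE ->]; last first.
    exact: probability_setT.
  move=> <-; congr (P _); apply/seteqP; split => [w Aw k _ /=|w /(_ i Logic.I)/=].
    by case: eqP => // ->.
  by rewrite eqxx.
exists d, T, P, Z; split.
- by move=> A; rewrite indep; apply: eq_bigr => i _; rewrite distr.
- by move=> i A; exact: distr.
- move=> u u0; rewrite unlock (HZ (fun i k => u i ^+ k)) => [|i k]; last first.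
    by rewrite exprn_ge0// ltW.
  rewrite -prodEFin; apply: eq_bigr => i _; exact: poisson_pgf.
Qed.

End JointLaw.

(** * Expectations of bounded variables *)

Section BoundedExpectation.
Context (R : realType) (d : measure_display) (T : measurableType d).
Variable P : probability T R.

Definition bounded_mfun (X : T -> R) : Prop :=
  measurable_fun setT X /\ exists C, forall w, `|X w| <= C.

Lemma bounded_mfun_integrable X : bounded_mfun X ->
  P.-integrable setT (EFin \o X).
Proof.
move=> [mX [C HC]]; apply: measurable_bounded_integrable => //.
  by apply: le_lt_trans (ltry 1); exact: probability_le1.
exists C; split; first exact: num_real.
by move=> b Cb w _; exact: le_trans (HC w) (ltW Cb).
Qed.

Lemma bounded_mfun_cst (a : R) : bounded_mfun (fun=> a).
Proof. by split; [exact: measurable_cst|exists `|a|]. Qed.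

Lemma bounded_mfun_indic (A : set T) : measurable A ->
  bounded_mfun (\1_A : T -> R).
Proof.
move=> mA; split; first exact: measurable_indic.
by exists 1 => w; rewrite indicE ger0_norm// lern1 leq_b1.
Qed.

Lemma bounded_mfunD X Y : bounded_mfun X -> bounded_mfun Y ->
  bounded_mfun (fun w => X w + Y w).
Proof.
move=> [mX [C HC]] [mY [C' HC']]; split; first exact: measurable_funD.
by exists (C + C') => w; apply: le_trans (ler_normD _ _) _; exact: lerD.
Qed.

Lemma bounded_mfunM X Y : bounded_mfun X -> bounded_mfun Y ->
  bounded_mfun (fun w => X w * Y w).
Proof.
move=> [mX [C HC]] [mY [C' HC']]; split; first exact: measurable_funM.
by exists (C * C') => w; rewrite normrM; exact: ler_pM.
Qed.

Lemma bounded_mfunZ (a : R) X : bounded_mfun X -> bounded_mfun (fun w => a * X w).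
Proof. by apply: bounded_mfunM; exact: bounded_mfun_cst. Qed.

Lemma bounded_mfunB X Y : bounded_mfun X -> bounded_mfun Y ->
  bounded_mfun (fun w => X w - Y w).
Proof.
move=> bX /(bounded_mfunZ (-1)) bY.
have -> : (fun w => X w - Y w) = (fun w => X w + -1 * Y w).
  by apply/funext => w; rewrite mulN1r.
exact: bounded_mfunD.
Qed.

Lemma bounded_mfun_norm X : bounded_mfun X -> bounded_mfun (fun w => `|X w|).
Proof.
move=> [mX [C HC]]; split; first exact: measurableT_comp.
by exists C => w; rewrite normr_id.
Qed.

Lemma bounded_mfun_sum (I : Type) (s : seq I) (p : pred I) (X : I -> T -> R) :
  (forall i, p i -> bounded_mfun (X i)) ->
  bounded_mfun (fun w => \sum_(i <- s | p i) X i w).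
Proof.
move=> bX; elim: s => [|i s IH].
  by under eq_fun do rewrite big_nil; exact: bounded_mfun_cst.
under eq_fun do rewrite big_cons.
by case: (boolP (p i)) => // pi; apply: bounded_mfunD => //; exact: bX.
Qed.

Lemma bounded_mfun_prod (I : Type) (s : seq I) (p : pred I) (X : I -> T -> R) :
  (forall i, p i -> bounded_mfun (X i)) ->
  bounded_mfun (fun w => \prod_(i <- s | p i) X i w).
Proof.
move=> bX; elim: s => [|i s IH].
  by under eq_fun do rewrite big_nil; exact: bounded_mfun_cst.
under eq_fun do rewrite big_cons.
by case: (boolP (p i)) => // pi; apply: bounded_mfunM => //; exact: bX.
Qed.

(** The variables below are bounded; on these the real-valued integral is linear
    without side conditions on infinite values. *)
Definition Ex (X : T -> R) : R := \int[P]_w X w.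

Lemma expectationEx X : bounded_mfun X -> 'E_P[X]%E = (Ex X)%:E.
Proof.
move=> bX; rewrite unlock /Ex /Rintegral fineK//.
exact: integrable_fin_num (bounded_mfun_integrable bX).
Qed.

Lemma ExD X Y : bounded_mfun X -> bounded_mfun Y ->
  Ex (fun w => X w + Y w) = Ex X + Ex Y.
Proof. by move=> bX bY; apply: RintegralD => //; exact: bounded_mfun_integrable. Qed.

Lemma ExB X Y : bounded_mfun X -> bounded_mfun Y ->
  Ex (fun w => X w - Y w) = Ex X - Ex Y.
Proof. by move=> bX bY; apply: RintegralB => //; exact: bounded_mfun_integrable. Qed.

Lemma ExZ (a : R) X : bounded_mfun X -> Ex (fun w => a * X w) = a * Ex X.
Proof. by move=> bX; apply: RintegralZl => //; exact: bounded_mfun_integrable. Qed.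

Lemma Ex_cst (a : R) : Ex (fun=> a) = a.
Proof.
rewrite /Ex Rintegral_cst// [X in fine X](_ : _ = 1%E) ?mulr1//.
exact: probability_setT.
Qed.

Lemma Ex_sum (I : Type) (s : seq I) (p : pred I) (X : I -> T -> R) :
  (forall i, p i -> bounded_mfun (X i)) ->
  Ex (fun w => \sum_(i <- s | p i) X i w) = \sum_(i <- s | p i) Ex (X i).
Proof.
move=> bX; elim: s => [|i s IH].
  by under eq_fun do rewrite big_nil; rewrite Ex_cst big_nil.
under eq_fun do rewrite big_cons.
rewrite big_cons; case: (boolP (p i)) => // pi.
rewrite ExD ?IH//; [exact: bX|exact: bounded_mfun_sum].
Qed.

Lemma Ex_le X Y : bounded_mfun X -> bounded_mfun Y ->
  (forall w, X w <= Y w) -> Ex X <= Ex Y.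
Proof.
move=> bX bY XY; apply: le_Rintegral => //; exact: bounded_mfun_integrable.
Qed.

Lemma Ex_norm X : bounded_mfun X -> `|Ex X| <= Ex (fun w => `|X w|).
Proof.
by move=> bX; apply: le_normr_Rintegral => //; exact: bounded_mfun_integrable.
Qed.

Lemma Ex_indic (A : set T) : measurable A -> Ex \1_A = fine (P A).
Proof. by move=> mA; rewrite /Ex /Rintegral integral_indic// setIT. Qed.

Lemma Ex_norm_le X Y : bounded_mfun X -> bounded_mfun Y ->
  (forall w, `|X w| <= Y w) -> `|Ex X| <= Ex Y.
Proof.
move=> bX bY XY; apply: le_trans (Ex_norm bX) _; apply: Ex_le => //.
exact: bounded_mfun_norm.
Qed.

Lemma eq_Ex X Y : X =1 Y -> Ex X = Ex Y.
Proof. by move=> /funext ->. Qed.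

End BoundedExpectation.

(** * Convergence in distribution from generating functions *)

Section GeneratingFunctions.
Context (R : realType) (d : measure_display) (T : measurableType d).
Context (d' : measure_display) (T' : measurableType d').
Variables (P : probability T R) (Q : probability T' R) (I : finType).

Definition bounded_counts (f : (I -> nat) -> R) : Prop :=
  exists C, forall k, `|f k| <= C.

(** There are countably many vectors of counts, so every function of measurable
    counts is measurable. *)
Lemma counts_bounded_mfun (d0 : measure_display) (T0 : measurableType d0)
    (Y : I -> T0 -> nat) (f : (I -> nat) -> R) :
  (forall i, measurable_fun setT (Y i)) -> bounded_counts f ->
  bounded_mfun (fun w => f (fun i => Y i w)).
Proof.
move=> mY [C HC]; split; last by exists C => w; exact: HC.
move=> _ B mB; rewrite setTI.
have -> : (fun w => f (fun i => Y i w)) @^-1` B =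
    \bigcup_(n : {ffun I -> nat}) ([set w | B (f n)] `&`
      \bigcap_(i in [set: I]) (Y i @^-1` [set n i])).
  apply/seteqP; split => w /=.
    move=> Bw; exists [ffun i => Y i w] => //=; split.
      by rewrite (_ : fun_of_fin _ = fun i => Y i w)//; apply/funext => i; rewrite ffunE.
    by move=> i _ /=; rewrite ffunE.
  move=> [n _ /= [Bn H]]; rewrite (_ : (fun i => Y i w) = n) //.
  by apply/funext => i; exact: H.
apply: countable_bigcupT_measurable => [|n]; first exact: countableP.
apply: measurableI.
  have [Bn|nBn] := pselect (B (f n)).
    by rewrite (_ : [set w | _] = setT)//; apply/seteqP; split.
  by rewrite (_ : [set w | _] = set0)//; apply/seteqP; split.
apply: fin_bigcap_measurable => // i _.
by rewrite -[X in measurable X]setTI; exact: mY.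
Qed.

Lemma bounded_countsD f g : bounded_counts f -> bounded_counts g ->
  bounded_counts (fun n => f n + g n).
Proof.
by move=> [C H] [C' H']; exists (C + C') => k;
  rewrite (le_trans (ler_normD _ _))// lerD.
Qed.

Lemma bounded_countsM f g : bounded_counts f -> bounded_counts g ->
  bounded_counts (fun n => f n * g n).
Proof.
by move=> [C H] [C' H']; exists (C * C') => k; rewrite normrM ler_pM.
Qed.

Variables (N : nat -> I -> T -> nat) (Z : I -> T' -> nat).
Variable M0 : nat.
Hypothesis mN : forall M, (M0 <= M)%N -> forall i, measurable_fun setT (N M i).
Hypothesis mZ : forall i, measurable_fun setT (Z i).

Let EN M (f : (I -> nat) -> R) := Ex P (fun w => f (fun i => N M i w)).
Let EZ (f : (I -> nat) -> R) := Ex Q (fun w => f (fun i => Z i w)).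

(** These test functions form a vector space closed under uniform limits; the
    lemmas below enlarge it from products of powers to all bounded functions. *)
Definition cvg_against (f : (I -> nat) -> R) : Prop :=
  bounded_counts f /\ (fun M => EN M f) @ \oo --> EZ f.

Let bN M f : (M0 <= M)%N -> bounded_counts f ->
  bounded_mfun (fun w => f (fun i => N M i w)).
Proof. by move=> /mN ?; exact: counts_bounded_mfun. Qed.

Let bZ f : bounded_counts f -> bounded_mfun (fun w => f (fun i => Z i w)).
Proof. exact: counts_bounded_mfun. Qed.

Lemma cvg_againstD f g : cvg_against f -> cvg_against g ->
  cvg_against (fun n => f n + g n).
Proof.
move=> [bf cf] [bg cg]; split; first exact: bounded_countsD.
have -> : EZ (fun n => f n + g n) = EZ f + EZ g by apply: ExD; exact: bZ.
apply: cvg_trans (cvgD cf cg); apply: near_eq_cvg.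
by exists M0 => // M /= h; rewrite /EN ExD//; exact: bN.
Qed.

Lemma cvg_againstZ a f : cvg_against f -> cvg_against (fun n => a * f n).
Proof.
move=> [bf cf]; split.
  by apply: bounded_countsM => //; exists `|a|.
have -> : EZ (fun n => a * f n) = a * EZ f by apply: ExZ; exact: bZ.
apply: cvg_trans (cvgM (cvg_cst a) cf); apply: near_eq_cvg.
by exists M0 => // M /= h; rewrite /EN ExZ//; exact: bN.
Qed.

Lemma cvg_against_cst a : cvg_against (fun=> a).
Proof.
split; first by exists `|a|.
rewrite /EN /EZ !Ex_cst; exact: cvg_cst.
Qed.

Lemma cvg_against_sum (J : Type) (s : seq J) (F : J -> (I -> nat) -> R) :
  (forall j, cvg_against (F j)) -> cvg_against (fun n => \sum_(j <- s) F j n).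
Proof.
move=> H; elim: s => [|j s IH].
  by under eq_fun do rewrite big_nil; exact: cvg_against_cst.
by under eq_fun do rewrite big_cons; exact: cvg_againstD.
Qed.

Lemma cvg_against_uniform f :
  (forall e : R, 0 < e -> exists2 g, cvg_against g &
     forall n, `|f n - g n| <= e) -> cvg_against f.
Proof.
move=> H; have bf : bounded_counts f.
  have [g [[C HC] _] Hg] := H 1 ltr01; exists (1 + C) => k.
  by rewrite -[f k](subrK (g k)) (le_trans (ler_normD _ _))// lerD.
split=> //; apply/cvgrPdist_le => e e0.
have e3 : 0 < e / 3 by rewrite divr_gt0.
have [g [bg cg] Hg] := H _ e3.
have close (d0 : measure_display) (T0 : measurableType d0) (mu : probability T0 R)
    (Y : I -> T0 -> nat) : (forall i, measurable_fun setT (Y i)) ->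
    `|Ex mu (fun w => f (fun i => Y i w)) - Ex mu (fun w => g (fun i => Y i w))|
      <= e / 3.
  move=> mY; rewrite -ExB; [|exact: counts_bounded_mfun..].
  rewrite -[leRHS](Ex_cst mu); apply: Ex_norm_le => //.
  - by apply: bounded_mfunB; exact: counts_bounded_mfun.
  - exact: bounded_mfun_cst.
move/cvgrPdist_le : cg => /(_ _ e3)[M1 _ HM1]; exists (maxn M0 M1) => // M.
rewrite /= geq_max => /andP[/mN mNM /HM1/=].
have := close _ _ P _ mNM; have := close _ _ Q _ mZ.
rewrite -/(EZ f) -/(EZ g) -/(EN M f) -/(EN M g) !ler_norml.
by move=> /andP[? ?] /andP[? ?] /andP[? ?]; apply/andP; split; lra.
Qed.

(** The sum removes $u^n$ when $n < a$; dividing by $u^a$ then leaves $1$ at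
    $n = a$ and at most $u$ for $n > a$. *)
Lemma indicator_from_powers (u : R) (a n : nat) : 0 < u <= 1 ->
  `|(n == a)%:R - u ^- a * (u ^+ n - \sum_(b < a) u ^+ b * (n == b)%:R)| <= u.
Proof.
move=> /andP[u0 u1]; have ua : u ^+ a != 0 by rewrite expf_neq0// gt_eqF.
have [na|an|->] := ltngtP n a.
- rewrite (bigD1 (Ordinal na))//= eqxx mulr1 big1 ?addr0 ?subrr ?mulr0.
    by rewrite subrr normr0 ltW.
  by move=> i /eqP ni; case: eqP => [e|_]; [case: ni; exact: val_inj|rewrite mulr0].
- rewrite big1 ?subr0 => [|i _]; last first.
    by rewrite gtn_eqF ?mulr0// (ltn_trans _ an).
  rewrite sub0r normrN normrM normfV !ger0_norm ?exprn_ge0 ?(ltW u0)//.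
  rewrite -(subnK (ltnW an)) exprD mulrCA mulVf// mulr1.
  have : (0 < n - a)%N by rewrite subn_gt0.
  case: (n - a)%N => // k _.
  by rewrite exprS ler_piMr ?(ltW u0)// exprn_ile1// ltW.
- rewrite big1 ?subr0 ?mulVf// ?subrr ?normr0 ?(ltW u0)// => i _.
  by rewrite gtn_eqF ?mulr0.
Qed.

(** Powers are traded for indicators one coordinate $j$ at a time and, within a
    coordinate, by induction on the value $a_j$: by [indicator_from_powers] the
    indicator of $n_j = a_j$ is a uniform limit of combinations of powers and of
    indicators of smaller values. *)
Lemma cvg_against_mixed :
  (forall u : I -> R, (forall i, 0 < u i <= 1) ->
     cvg_against (fun n => \prod_i u i ^+ n i)) ->
  forall (s : seq I) (a : I -> nat) (u : I -> R), uniq s ->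
    (forall i, 0 < u i <= 1) ->
    cvg_against (fun n => \prod_i
      (if i \in s then (n i == a i)%:R else u i ^+ n i)).
Proof.
move=> H0; elim => [|j s IH] a u; first by move=> _ /H0.
move=> /= /andP[js us] u01.
have [m] := ubnP (a j); elim: m a => // m IHm a; rewrite ltnS => am.
apply: cvg_against_uniform => e e0.
pose v := Num.min e 1; have v0 : 0 < v by rewrite lt_min e0 ltr01.
have v1 : v <= 1 by rewrite ge_min lexx orbT.
pose uv i := if i == j then v else u i.
pose ab b i := if i == j then b else a i.
pose rest (n : I -> nat) : R :=
  \prod_(i | i != j) (if i \in s then (n i == a i)%:R else u i ^+ n i).
have restE (n : I -> nat) (b : nat) (x : R) :
    \prod_i (if i == j then x else
      if i \in s then (n i == ab b i)%:R else uv i ^+ n i) = x * rest n.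
  rewrite (bigD1 j)//= eqxx; congr (_ * _); apply: eq_bigr => i /negbTE ij.
  by rewrite /ab /uv ij.
exists (fun n : I -> nat => v ^- a j * (v ^+ n j * rest n + \sum_(b < a j)
    (- v ^+ b) * ((n j == b :> nat)%:R * rest n))).
  apply: cvg_againstZ; apply: cvg_againstD; last apply: cvg_against_sum => b.
    have := IH a uv us _; rewrite (_ : (fun n => _) = (fun n : I -> nat => v ^+ n j * rest n)).
      apply => i; rewrite /uv; case: eqP => // _; by rewrite v0 v1.
    apply/funext => n; rewrite -(restE n (a j) (v ^+ n j)); apply: eq_bigr => i _.
    rewrite /ab; have [->|ij] := eqVneq i j; first by rewrite (negbTE js) /uv eqxx.
    by [].
  apply: cvg_againstZ.
  have := IHm (ab b) _; rewrite (_ : (fun n => _) = (fun n : I -> nat => (n j == b :> nat)%:R * rest n)).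
    by apply; rewrite /ab eqxx (leq_trans (ltn_ord b)).
  apply/funext => n; rewrite -(restE n b); apply: eq_bigr => i _.
  rewrite inE /ab /uv; have [->|ij] := eqVneq i j; first by [].
  by [].
move=> n; have rest01 : 0 <= rest n <= 1.
  apply/andP; split.
    apply: prodr_ge0 => i _; case: ifP => _ //; rewrite exprn_ge0//.
    by have /andP[/ltW] := u01 i.
  apply: prodr_ile1 => i _; case: ifP => _; first by rewrite ler0n lern1 leq_b1.
  have /andP[ui0 ui1] := u01 i.
  by rewrite exprn_ge0 ?exprn_ile1// ltW.
have -> : \prod_i (if i \in j :: s then (n i == a i)%:R else u i ^+ n i) =
    (n j == a j)%:R * rest n.
  rewrite (bigD1 j)//= inE eqxx; congr (_ * _); apply: eq_bigr => i /negbTE ij.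
  by rewrite inE ij.
have -> : v ^+ n j * rest n + \sum_(b < a j) (- v ^+ b) * ((n j == b :> nat)%:R * rest n)
    = (v ^+ n j - \sum_(b < a j) v ^+ b * (n j == b)%:R) * rest n.
  rewrite mulrBl; congr (_ + _); rewrite mulr_suml -sumrN.
  by apply: eq_bigr => b _; rewrite mulNr mulrA.
rewrite mulrA -mulrBl normrM; have /andP[r0 r1] := rest01.
rewrite (ger0_norm r0); apply: le_trans (ler_piMr _ r1) _ => //.
apply: le_trans (indicator_from_powers (u := v) _ _ _) _; first by rewrite v0 v1.
by rewrite ge_min lexx.
Qed.

Let in_cube (B : nat) (n : I -> nat) : R := [forall i, n i < B]%N%:R.

Lemma cvg_against_truncated f (B : nat) :
  (forall u : I -> R, (forall i, 0 < u i <= 1) ->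
     cvg_against (fun n => \prod_i u i ^+ n i)) ->
  cvg_against (fun n => in_cube B n * f n).
Proof.
move=> H0.
have -> : (fun n : I -> nat => in_cube B n * f n) = (fun n : I -> nat =>
    \sum_(m <- index_enum {ffun I -> 'I_B}) f (fun i => m i) *
      \prod_i (if i \in index_enum I then (n i == m i :> nat)%:R else 1 ^+ n i)).
  apply/funext => n; rewrite /in_cube; case: (boolP [forall i, _]) => [/forallP nB|].
    pose m0 : {ffun I -> 'I_B} := [ffun i => Ordinal (nB i)].
    rewrite mul1r (bigD1_seq m0) ?index_enum_uniq ?mem_index_enum//=.
    rewrite [X in _ + X]big1 ?addr0 => [|m mm0].
      rewrite big1 ?mulr1 => [|i _]; last by rewrite mem_index_enum ffunE eqxx.
      by congr f; apply/funext => i; rewrite ffunE.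
    have [i mi] : exists i, m i != m0 i.
      by apply/existsP; rewrite -negb_forall; apply: contra mm0 => /forallP e;
        apply/eqP/ffunP => i; exact/eqP.
    rewrite (bigD1 i)//= mem_index_enum; move: mi; rewrite ffunE -val_eqE /= eq_sym.
    by move=> /negbTE ->; rewrite mul0r mulr0.
  rewrite negb_forall => /existsP[i niB]; rewrite mul0r big1// => m _.
  rewrite (bigD1 i)//= mem_index_enum.
  rewrite (_ : n i == m i = false) ?mul0r ?mulr0//.
  by apply/eqP => e; move: niB; rewrite e ltn_ord.
apply: cvg_against_sum => m; apply: cvg_againstZ.
have := @cvg_against_mixed H0 (index_enum I) (fun i => m i) (fun=> 1).
by apply => [|i]; [exact: index_enum_uniq|rewrite ltr01 lexx].
Qed.

(** Convergence holds for functions that vanish outside a cube of counts.  In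
    particular the probability of the cube converges, so that the tightness of
    the limit passes to the sequence and truncation costs little. *)
Lemma cvg_pgf_cvg_counts :
  (forall u : I -> R, (forall i, 0 < u i <= 1) ->
     (fun M => EN M (fun n => \prod_i u i ^+ n i)) @ \oo
       --> EZ (fun n => \prod_i u i ^+ n i)) ->
  forall f, bounded_counts f -> (fun M => EN M f) @ \oo --> EZ f.
Proof.
move=> Hpgf f bf.
have H0 (u : I -> R) : (forall i, 0 < u i <= 1) ->
    cvg_against (fun n => \prod_i u i ^+ n i).
  move=> u01; split; last exact: Hpgf.
  exists 1 => n; rewrite ger0_norm; last first.
    by apply: prodr_ge0 => i _; rewrite exprn_ge0//; have /andP[/ltW] := u01 i.
  apply: prodr_ile1 => i _; have /andP[u0 u1] := u01 i.
  by rewrite exprn_ge0 ?exprn_ile1// ltW.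
have [C HC] := bf.
have C0 : 0 <= C by apply: le_trans (HC (fun=> 0%N)).
apply/cvgrPdist_le => e e0.
have C31 : 0 < 3 * C + 1 by lra.
pose e' := e / (3 * C + 1).
have e'0 : 0 < e' by rewrite divr_gt0.
have bcube B : bounded_counts (in_cube B).
  by exists 1 => n; rewrite ger0_norm ?ler0n// lern1 leq_b1.
have cube01 B n : 0 <= in_cube B n <= 1 by rewrite ler0n lern1 leq_b1.
have [B HB] : exists B, 1 - e' <= EZ (in_cube B).
  pose F B := \bigcap_(i in [set: I]) (Z i @^-1` [set k | (k < B)%N]).
  have mF B : measurable (F B).
    apply: fin_bigcap_measurable => // i _.
    by rewrite -[X in measurable X]setTI; exact: mZ.
  have FT : \bigcup_B F B = setT.
    apply/seteqP; split => // w _; exists (\max_i Z i w).+1 => // i _ /=.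
    by rewrite ltnS; exact: leq_bigmax.
  have EF B : EZ (in_cube B) = fine (Q (F B)).
    rewrite /EZ -Ex_indic//; apply: eq_Ex => w; rewrite indicE /in_cube.
    congr (_ : nat)%:R; congr (nat_of_bool _); apply/forallP/idP.
      by move=> H; apply/mem_set => i _; exact: H.
    by move=> /set_mem H i; exact: H.
  have := @nondecreasing_cvg_mu _ _ _ Q F mF.
  rewrite FT => /(_ measurableT) cQ.
  have {}cQ : fine (Q (F B)) @[B --> \oo] --> (1 : R).
    apply: (@fine_cvg _ _ _ _ _ 1); rewrite -[X in _ --> X](probability_setT Q).
    apply: cQ => B B' BB'; apply/subsetPset => w H i _.
    by apply: leq_trans BB'; exact: H.
  move/cvgrPdist_le : cQ => /(_ _ e'0)[B _ /(_ B (leqnn B))] /=.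
  by rewrite -EF ler_norml => /andP[_ ?]; exists B; lra.
have [_ c1] := cvg_against_truncated (fun=> 1) B H0.
have [_ c2] := cvg_against_truncated f B H0.
move/cvgrPdist_le : c1 => /(_ _ e'0)[M1 _ HM1].
move/cvgrPdist_le : c2 => /(_ _ e'0)[M2 _ HM2].
exists (maxn M0 (maxn M1 M2)) => // M /=.
rewrite !geq_max => /and3P[/mN mNM /HM1/= h1 /HM2/= h2].
have trunc (d0 : measure_display) (T0 : measurableType d0) (mu : probability T0 R)
    (Y : I -> T0 -> nat) : (forall i, measurable_fun setT (Y i)) ->
    `|Ex mu (fun w => f (fun i => Y i w)) -
      Ex mu (fun w => in_cube B (fun i => Y i w) * f (fun i => Y i w))|
      <= C * (1 - Ex mu (fun w => in_cube B (fun i => Y i w) * 1)).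
  move=> mY.
  have bF : bounded_mfun (fun w => f (fun i => Y i w)) by exact: counts_bounded_mfun.
  have bc : bounded_mfun (fun w => in_cube B (fun i => Y i w)).
    by apply: counts_bounded_mfun.
  have bc1 := bounded_mfunM bc (bounded_mfun_cst T0 1).
  rewrite -ExB//; last exact: bounded_mfunM.
  rewrite -[X in C * (X - _)](Ex_cst mu) -ExB//; last exact: bounded_mfun_cst.
  have b1 := bounded_mfunB (bounded_mfun_cst T0 1) bc1.
  rewrite -ExZ//; apply: Ex_norm_le.
  - by apply: bounded_mfunB => //; exact: bounded_mfunM.
  - exact: bounded_mfunZ.
  move=> w; rewrite mulr1 -[X in X - _]mul1r -mulrBl normrM mulrC.
  have /andP[_ c1] := cube01 B (fun i => Y i w).
  by rewrite [X in _ * X]ger0_norm ?subr_ge0// ler_wpM2r// subr_ge0.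
set x1 := EZ (fun n => in_cube B n * 1) in h1.
set x2 := EN M (fun n => in_cube B n * 1) in h1.
set y1 := EZ (fun n => in_cube B n * f n) in h2.
set y2 := EN M (fun n => in_cube B n * f n) in h2.
have t1 : `|EN M f - y2| <= C * (1 - x2) := trunc _ _ P _ mNM.
have t2 : `|EZ f - y1| <= C * (1 - x1) := trunc _ _ Q _ mZ.
move: h1 h2 t1 t2.
have x1e : 1 - e' <= x1.
  by apply: le_trans HB _; rewrite /x1 /EZ; under [leRHS]eq_Ex do rewrite mulr1.
rewrite !ler_norml => /andP[a1 a2] /andP[a3 a4] /andP[a5 a6] /andP[a7 a8].
have ee : C * e' * 3 + e' = e by rewrite /e'; field; rewrite gt_eqF.
have Cx1 : C * (1 - x1) <= C * e' by rewrite ler_wpM2l//; lra.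
have Cx2 : C * (1 - x2) <= C * (2 * e') by rewrite ler_wpM2l//; lra.
by apply/andP; split; lra.
Qed.

End GeneratingFunctions.

(** * Conditional measures of a partition *)

Section Tower.
Context (R : realType) (d : measure_display) (T : measurableType d).
Variables (P : probability T R) (kappa : T -> probability T R).
Hypothesis mkappa : forall A, measurable A ->
  measurable_fun setT (fun w => kappa w A).
Hypothesis kappaP : forall A, measurable A -> (\int[P]_w kappa w A = P A)%E.

Let k0 (_ : unit) : {measure set T -> \bar R} := P.
Let k1 (x : unit * T) : {measure set T -> \bar R} := kappa x.2.

Let mk0 A : measurable A -> measurable_fun setT (k0 ^~ A).
Proof. by move=> mA; exact: measurable_cst. Qed.

Let mk1 A : measurable A -> measurable_fun setT (k1 ^~ A).
Proof.
move=> mA; apply: (measurableT_comp (f := fun w => kappa w A) (g := snd)).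
  exact: mkappa.
exact: measurable_snd.
Qed.

Let k0T x : k0 x setT = 1%E. Proof. exact: probability_setT. Qed.
Let k1T x : k1 x setT = 1%E. Proof. exact: probability_setT. Qed.

HB.instance Definition _ := isKernel.Build _ _ _ _ R k0 mk0.
HB.instance Definition _ := Kernel_isProbability.Build _ _ _ _ R k0 k0T.
HB.instance Definition _ := isKernel.Build _ _ _ _ R k1 mk1.
HB.instance Definition _ := Kernel_isProbability.Build _ _ _ _ R k1 k1T.

(** Both measures are presented as kernels, the first with a one-point source:
    their composition then is the averaged measure. *)
Lemma ge0_tower (f : T -> \bar R) : (forall w, 0 <= f w)%E ->
  measurable_fun setT f -> (\int[P]_w f w = \int[P]_w \int[kappa w]_z f z)%E.
Proof.
move=> f0 mf; have := integral_kcomp k0 k1 tt f0 mf; rewrite /k0 /k1 /= => <-.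
by apply: eq_measure_integral => A mA _; rewrite /= -kappaP.
Qed.

Lemma bounded_mfun_tower (X : T -> R) : bounded_mfun X -> (forall w, 0 <= X w) ->
  bounded_mfun (fun w => Ex (kappa w) X) /\
  Ex P X = Ex P (fun w => Ex (kappa w) X).
Proof.
move=> bX X0; have [mX [C HC]] := bX.
have mI : measurable_fun setT (fun w => \int[kappa w]_z (X z)%:E)%E.
  apply: (@measurable_fun_integral_kernel _ _ _ _ _ (fun w => kappa w)) => //.
  exact/measurable_EFinP.
have bE : bounded_mfun (fun w => Ex (kappa w) X).
  split; first exact: (measurableT_comp _ mI).
  exists C => w; rewrite -(Ex_cst (kappa w) C); apply: Ex_norm_le => //.
  exact: bounded_mfun_cst.
split=> //; rewrite {1}/Ex /Rintegral ge0_tower; last 2 first.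
- by move=> w; rewrite lee_fin.
- exact/measurable_EFinP.
rewrite /Ex /Rintegral; congr fine; apply: eq_integral => w _.
by rewrite fineK//; exact: integrable_fin_num (bounded_mfun_integrable _ bX).
Qed.

End Tower.

Section Conditioning.
Context (R : realType) (d : measure_display) (T : measurableType d).
Variable P : probability T R.

Lemma pblock_mem (F : set (set T)) (w : T) : partition F id setT ->
  F (pblock F id w) /\ pblock F id w w.
Proof.
move=> [cF _ _]; rewrite /pblock /pblock_index.
have : [set: T] w by [].
rewrite -cF => -[B FB Bw].
by case: (getPex (ex_intro (fun i => F i /\ i w) B (conj FB Bw))).
Qed.

Lemma partition_algebraT (F : set (set T)) : partition F id setT ->
  partition_algebra F setT.
Proof. by move=> [cF _ _]; split => //; exists F. Qed.

(** The level set of $Y$ through $w$ is a union of elements of the partition, so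
    it contains the element of $w$. *)
Lemma version_constant (F : set (set T)) (Y : T -> R) (B : set T) (w w' : T) :
  partition F id setT ->
  (forall U : set R, measurable U -> partition_algebra F (Y @^-1` U)) ->
  F B -> B w -> B w' -> Y w = Y w'.
Proof.
move=> [_ tF _] HY FB Bw Bw'.
have [_ [G GF YG]] := HY [set Y w] (measurable_set1 _).
have : (Y @^-1` [set Y w]) w by [].
rewrite YG => -[B' GB' B'w].
have BB' : B' = B by apply: (tF B' B (GF _ GB') FB); exists w.
have : (\bigcup_(C in G) C) w' by exists B' => //; rewrite BB'.
by rewrite -YG.
Qed.

(** The set where $Y_2 < Y_1$ is a union of elements of the partition, hence an
    admissible test set, over which both versions have the same integral. *)
Lemma condexp_le_ae (F : set (set T)) (X Y1 Y2 : T -> R) :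
  partition F id setT -> is_condexp P F X Y1 -> is_condexp P F X Y2 ->
  {ae P, forall w, Y1 w <= Y2 w}.
Proof.
move=> pF [F1 i1 I1] [F2 i2 I2]; have [cF tF _] := pF.
have m1 := measurable_int _ i1; have m2 := measurable_int _ i2.
have my1 : measurable_fun setT Y1 by apply/measurable_EFinP.
have my2 : measurable_fun setT Y2 by apply/measurable_EFinP.
pose A := [set w | Y2 w < Y1 w].
have mA : measurable A.
  rewrite (_ : A = (fun w => Y2 w < Y1 w) @^-1` [set true]); last first.
    by apply/seteqP; split.
  by rewrite -[X in measurable X]setTI; exact: measurable_fun_ltr.
have FA : partition_algebra F A.
  split=> //; exists [set B | F B /\ B `<=` A]; first by move=> B [].
  apply/seteqP; split => [w Aw|w [B [_ BA] /BA //]].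
  have [FB Bw] := pblock_mem w pF; exists (pblock F id w) => //; split => // w' Bw'.
  rewrite /A /= (version_constant pF F1 FB Bw' Bw).
  by rewrite (version_constant pF F2 FB Bw' Bw).
have iA1 := integrableS measurableT mA (@subsetT _ _) i1.
have iA2 := integrableS measurableT mA (@subsetT _ _) i2.
have eqA : (\int[P]_(w in A) `|(Y1 w - Y2 w)%:E| = 0)%E.
  transitivity (\int[P]_(w in A) ((Y1 w)%:E - (Y2 w)%:E))%E.
    apply: eq_integral => w /set_mem Aw; rewrite -EFinB /= ger0_norm//.
    by rewrite subr_ge0 ltW.
  rewrite integralB// I1// I2// subee//.
  rewrite -I2//; exact: integrable_fin_num.
have mB : measurable_fun A (fun w => (Y1 w - Y2 w)%:E).
  by apply: measurable_funTS; apply/measurable_EFinP; exact: measurable_funB.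
move/(ae_eq_integral_abs P mA mB) : eqA; apply: filterS => w /= H.
rewrite leNgt; apply/negP => Aw.
by move: (H Aw) => /= -[/eqP]; rewrite subr_eq0 gt_eqF.
Qed.

Lemma condexp_unique_ae (F : set (set T)) (X Y1 Y2 : T -> R) :
  partition F id setT -> is_condexp P F X Y1 -> is_condexp P F X Y2 ->
  {ae P, forall w, Y1 w = Y2 w}.
Proof.
move=> pF c1 c2; have h1 := condexp_le_ae pF c1 c2; have h2 := condexp_le_ae pF c2 c1.
by apply: filterS2 h1 h2 => w a b; apply/le_anti; rewrite a b.
Qed.

Lemma Ex_norm_le_ae (X Y : T -> R) : bounded_mfun X -> bounded_mfun Y ->
  (forall w, 0 <= Y w) -> {ae P, forall w, `|X w| <= Y w} -> `|Ex P X| <= Ex P Y.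
Proof.
move=> bX bY Y0 XY; apply: le_trans (Ex_norm P bX) _.
have bnX := bounded_mfun_norm bX.
rewrite /Ex /Rintegral; apply: fine_le.
- exact: integrable_fin_num (bounded_mfun_integrable _ bnX).
- exact: integrable_fin_num (bounded_mfun_integrable _ bY).
apply: ae_ge0_le_integral => //.
- by apply/measurable_EFinP; case: bnX.
- by move=> w _; rewrite lee_fin.
- by apply/measurable_EFinP; case: bY.
- by apply: filterS XY => w H _; rewrite lee_fin.
Qed.

(** Only the values on a set of full measure matter; it will be an element of
    the partition and its conditional measure. *)
Lemma Ex_eq_on (Q : probability T R) (X Y : T -> R) (A : set T) :
  bounded_mfun X -> bounded_mfun Y -> measurable A -> Q A = 1%E ->
  (forall w, A w -> X w = Y w) -> Ex Q X = Ex Q Y.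
Proof.
move=> [mX _] [mY _] mA PA XY; rewrite /Ex /Rintegral; congr fine.
apply: ae_eq_integral => //; [by apply/measurable_EFinP|by apply/measurable_EFinP|].
exists (~` A); split; first exact: measurableC.
  by rewrite [LHS]probability_setC// PA subee.
by move=> w /= nXY Aw; apply: nXY => _; rewrite XY.
Qed.

(** At a point of $E$ the function $B$ is constant on the element of the
    partition, which carries the conditional measure, so $B$ can be pulled out of
    the conditional expectation. *)
Lemma conditional_estimate (F : set (set T)) (E G A : set T) (B : T -> R) (a e : R) :
  measurable_partition P F -> measurable E -> measurable A ->
  bounded_mfun B -> (forall w, 0 <= B w <= 1) ->
  (forall w, E w -> constant_on B (pblock F id w)) ->
  (forall w, E w -> B w != 0 -> G w) ->
  condexp_within P F \1_A G a e ->
  `|Ex P (fun w => B w * (\1_A w - a))|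
    <= `|e| * Ex P B + (1 + `|a|) * fine (P (~` E)).
Proof.
move=> [pF mF [kappa [kcond kblock]]] mE mA bB B01 Bcst BG [Y [condY YG]].
have fink w U : measurable U -> kappa w U \is a fin_num.
  exact: fin_num_measure.
have mk U : measurable U -> measurable_fun setT (fun w => kappa w U).
  move=> mU; have [_ /measurable_int mf _] := kcond U mU.
  by apply: eq_measurable_fun mf => w _ /=; rewrite fineK// fink.
have kP U : measurable U -> (\int[P]_w kappa w U = P U)%E.
  move=> mU; have [_ _ /(_ _ (partition_algebraT pF))] := kcond U mU.
  rewrite integral_indic// setIT => <-.
  by apply: eq_integral => w _; rewrite fineK// fink.
have bA : bounded_mfun (\1_A : T -> R) by exact: bounded_mfun_indic.
have b1 := bounded_mfunM bB bA.
have B0 w : 0 <= B w by have /andP[] := B01 w.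
have B1 w : B w <= 1 by have /andP[] := B01 w.
have A01 w : 0 <= (\1_A w : R) <= 1 by rewrite indicE ler0n lern1 leq_b1.
have BA0 w : 0 <= B w * \1_A w by have /andP[? _] := A01 w; rewrite mulr_ge0.
have BA1 w : B w * \1_A w <= 1.
  by have /andP[? ?] := A01 w; rewrite mulr_ile1.
have [bg1 eg1] := bounded_mfun_tower mk kP b1 BA0.
have [bg2 eg2] := bounded_mfun_tower mk kP bB B0.
have -> : Ex P (fun w => B w * (\1_A w - a)) =
    Ex P (fun w => Ex (kappa w) (fun z => B z * \1_A z) - a * Ex (kappa w) B).
  rewrite ExB//; last exact: bounded_mfunZ.
  rewrite ExZ// -eg1 -eg2 -ExZ// -ExB//; last exact: bounded_mfunZ.
  by apply: eq_Ex => w; rewrite mulrBr [B w * a]mulrC.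
have bC : bounded_mfun (\1_(~` E) : T -> R).
  by apply: bounded_mfun_indic; exact: measurableC.
have a0 : 0 <= 1 + `|a| by rewrite addr_ge0.
have -> : `|e| * Ex P B + (1 + `|a|) * fine (P (~` E)) =
    Ex P (fun w => `|e| * B w + (1 + `|a|) * \1_(~` E) w).
  rewrite ExD; [|exact: bounded_mfunZ|exact: bounded_mfunZ].
  by rewrite !ExZ// Ex_indic//; exact: measurableC.
apply: Ex_norm_le_ae.
- by apply: bounded_mfunB => //; exact: bounded_mfunZ.
- by apply: bounded_mfunD; exact: bounded_mfunZ.
- by move=> w; rewrite addr_ge0// mulr_ge0// indicE ler0n.
have Yk := condexp_unique_ae pF condY (kcond A mA).
apply: filterS2 kblock Yk => w kw Yw.
have [Ew|nEw] := pselect (E w); last first.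
  rewrite [\1_(~` E) w]indicE mem_set//= mulr1.
  rewrite -[X in X <= _]add0r; apply: lerD; first by rewrite mulr_ge0.
  apply: le_trans (ler_normB _ _) _; rewrite normrM lerD//.
    rewrite -(Ex_cst (kappa w) 1); apply: Ex_norm_le => //.
      exact: bounded_mfun_cst.
    by move=> z; rewrite ger0_norm.
  rewrite ler_piMr// -(Ex_cst (kappa w) 1); apply: Ex_norm_le => //.
    exact: bounded_mfun_cst.
  by move=> z; rewrite ger0_norm.
have [Fb bw] := pblock_mem w pF; have mb := mF _ Fb.
have -> : Ex (kappa w) (fun z => B z * \1_A z) = B w * Y w.
  rewrite Yw -(Ex_indic _ mA) -ExZ//; apply: (Ex_eq_on b1 _ mb kw) => [|z bz].
    exact: bounded_mfunZ.
  by rewrite (Bcst w Ew w z bw bz).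
have -> : Ex (kappa w) B = B w.
  rewrite -[RHS](Ex_cst (kappa w)); apply: (Ex_eq_on bB _ mb kw) => [|z bz].
    exact: bounded_mfun_cst.
  by rewrite (Bcst w Ew w z bw bz).
rewrite [a * _]mulrC -mulrBr normrM (ger0_norm (B0 w)).
rewrite indicE memNset//= mulr0 addr0 mulrC.
have [->|Bw0] := eqVneq (B w) 0; first by rewrite !mulr0.
rewrite ler_wpM2r//; apply: le_trans (ler_norm e).
by apply: YG; exact: BG.
Qed.

End Conditioning.

(** * Undoing events one at a time *)

(** Telescoping, with all the other factors bounded by one. *)
Lemma prod_diff_le (R : realDomainType) (I : eqType) (s : seq I) (p : pred I)
    (a b : I -> R) :
  (forall i, i \in s -> 0 <= a i <= 1) -> (forall i, i \in s -> 0 <= b i <= 1) ->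
  `|\prod_(i <- s | p i) a i - \prod_(i <- s | p i) b i|
    <= \sum_(i <- s | p i) `|a i - b i|.
Proof.
elim: s => [|i s IH] a01 b01; first by rewrite !big_nil subrr normr0.
have is_ : i \in i :: s by rewrite inE eqxx.
have sub j : j \in s -> j \in i :: s by rewrite inE => ->; rewrite orbT.
have {}IH := IH (fun j js => a01 j (sub j js)) (fun j js => b01 j (sub j js)).
rewrite !big_cons; case: (p i) => //.
set x := \prod_(_ <- _ | _) a _ in IH *; set y := \prod_(_ <- _ | _) b _ in IH *.
have y01 : 0 <= y <= 1.
  rewrite /y big_seq_cond; apply/andP; split.
    by apply: prodr_ge0 => j /andP[/sub js _]; have /andP[] := b01 j js.
  by apply: prodr_ile1 => j /andP[/sub js _]; exact: b01.
have -> : a i * x - b i * y = (a i - b i) * y + a i * (x - y) by ring.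
apply: le_trans (ler_normD _ _) _; rewrite !normrM; apply: lerD.
  by have /andP[y0 y1] := y01; rewrite ler_piMr// ger0_norm.
apply: le_trans IH; have /andP[a0 a1] := a01 i is_.
by rewrite ler_piMl// ger0_norm.
Qed.

(** An event is a pair of a site and a boolean: [false] for the birth, [true] for
    the reading of the mark; [tau] is its time.  The factor [phi t k] of a site
    depends on the number [k] of its events that are still in place.  The last
    hypothesis bounds the effect of undoing one event when the other sites only
    keep events older by at least [gap]. *)
Section Swapping.
Context (R : realType) (d : measure_display) (T : measurableType d).
Variables (P : probability T R) (J : eqType) (ts : seq J).
Variables (occ : J -> set T) (phi : J -> nat -> T -> R) (tau : J * bool -> R).
Variables (mu gap nb k1 k2 eps : R).
Hypothesis uts : uniq ts.
Hypothesis mocc : forall t, measurable (occ t).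
Hypothesis bphi : forall t k, bounded_mfun (phi t k).
Hypothesis phi01 : forall t k w, 0 <= phi t k w <= 1.
Hypothesis mu0 : 0 <= mu.
Hypothesis k20 : 0 <= k2.
Hypothesis phi_diff : forall t k k' w,
  `|phi t k w - phi t k' w| <= \1_(occ t) w + mu.
Hypothesis tau_lt : forall t, t \in ts -> tau (t, false) < tau (t, true).
Hypothesis Hnb : forall th,
  (count (fun t => [exists b, th - gap < tau (t, b) <= th]) ts)%:R <= nb.
Hypothesis Hk1 : forall t, t \in ts -> fine (P (occ t)) <= k1.
Hypothesis Hk2 : forall t t', t \in ts -> t' \in ts -> t != t' ->
  fine (P (occ t `&` occ t')) <= k2.
Hypothesis Heps : forall t (b : bool) (st : J -> nat), t \in ts ->
  (forall t', (0 < st t')%N -> tau (t', false) <= tau (t, b) - gap) ->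
  (forall t', (1 < st t')%N -> tau (t', true) <= tau (t, b) - gap) ->
  `|Ex P (fun w => \prod_(t' <- ts | t' != t) phi t' (st t') w *
                     (phi t b.+1 w - phi t b w))| <= eps.

(** A mark is read after the birth, so in an admissible list of events the
    number of events of a site tells which ones they are. *)
Let stage (l : seq (J * bool)) (t : J) : nat :=
  ((t, false) \in l) + ((t, true) \in l).

Let W (l : seq (J * bool)) (w : T) : R := \prod_(t <- ts) phi t (stage l t) w.

Let later (e e' : J * bool) := tau e' <= tau e.

Let good (l : seq (J * bool)) := [/\ uniq l, sorted later l,
  forall e, e \in l -> e.1 \in ts &
  forall t, (t, true) \in l -> (t, false) \in l].

Let err := eps + nb * (k2 + 2 * mu * k1 + mu ^+ 2).

Let later_trans : transitive later.
Proof. by move=> a b c h1 h2; exact: le_trans h2 h1. Qed.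


Let bocc t : bounded_mfun (\1_(occ t) : T -> R).
Proof. exact: bounded_mfun_indic. Qed.

Let bprod (p : pred J) (st : J -> nat) :
  bounded_mfun (fun w => \prod_(t <- ts | p t) phi t (st t) w).
Proof. exact: bounded_mfun_prod. Qed.

(** The factors of the other sites are first replaced by their values with the
    recent events dropped.  This changes the product only through the sites with
    an event in the window, and each of them enters with the product of two
    increments, bounded by the joint occupation of two sites. *)
Lemma swap_step e l : good (e :: l) ->
  good l /\ `|Ex P (W (e :: l)) - Ex P (W l)| <= err.
Proof.
case: e => t b [/= /andP[el ul] sl Hts closed].
have ltau e : e \in l -> tau e <= tau (t, b).
  by move: sl => /= /(order_path_min later_trans)/allP; exact.
have tts : t \in ts by apply: (Hts (t, b)); rewrite inE eqxx.
have nolater : b = false -> (t, true) \notin l.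
  move=> b0; apply/negP => /ltau; rewrite b0 leNgt tau_lt//.
have gl : good l.
  split=> //; [exact: path_sorted sl|by move=> e' e'l; apply: Hts; rewrite inE e'l orbT|].
  move=> t' t'l; have := closed t'; rewrite !inE t'l orbT => /(_ isT)/orP[|//].
  by case/eqP => tt' b0; move: t'l; rewrite tt' (negbTE (nolater (esym b0))).
split=> //.
have st_t : stage l t = b /\ stage ((t, b) :: l) t = b.+1.
  rewrite /stage !inE !xpair_eqE !eqxx /=.
  move: el closed nolater; case: (b) => /= el closed nolater.
    have := closed t; rewrite !inE eqxx xpair_eqE eqxx /= => /(_ isT) ->.
    by rewrite (negbTE el).
  by rewrite (negbTE el) (negbTE (nolater erefl)).
have st_ne t' : t' != t -> stage ((t, b) :: l) t' = stage l t'.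
  by move=> /negbTE tt'; rewrite /stage !inE !xpair_eqE tt'.
(* The events that remain once the recent ones are dropped. *)
pose lm := [seq e <- l | tau e <= tau (t, b) - gap].
pose D w := phi t b.+1 w - phi t b w.
pose A w := \prod_(t' <- ts | t' != t) phi t' (stage l t') w.
pose Am w := \prod_(t' <- ts | t' != t) phi t' (stage lm t') w.
pose nbr t' := [exists b', tau (t, b) - gap < tau (t', b') <= tau (t, b)].
have bD : bounded_mfun D by exact: bounded_mfunB.
have bA : bounded_mfun A by exact: bprod.
have bAm : bounded_mfun Am by exact: bprod.
have WE w : W ((t, b) :: l) w - W l w = Am w * D w + (A w - Am w) * D w.
  rewrite -mulrDl [Am w + _]addrC subrK /W !(bigD1_seq t)//=.
  have [-> ->] := st_t; rewrite /A mulrC /D mulrBr; congr (_ - _); last by rewrite mulrC.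
  by congr (_ * _); apply: eq_bigr => t' /st_ne ->.
have st_nbr t' : ~~ nbr t' -> stage l t' = stage lm t'.
  rewrite negb_exists => /forallP H; rewrite /stage !mem_filter.
  have E b' : ((t', b') \in l) = (tau (t', b') <= tau (t, b) - gap) && ((t', b') \in l).
    case: (boolP (_ \in l)) => [h|]; last by rewrite andbF.
    by have := H b'; rewrite (ltau _ h) andbT -leNgt => ->.
  by rewrite -!E.
have AAm w : `|A w - Am w| <= \sum_(t' <- ts | (t' != t) && nbr t') (\1_(occ t') w + mu).
  apply: le_trans (prod_diff_le _ _ _) _ => //.
  rewrite big_mkcondr; apply: ler_sum => t' _; case: ifPn => [_|/st_nbr ->].
    exact: phi_diff.
  by rewrite subrr normr0.
pose S w := \sum_(t' <- ts | (t' != t) && nbr t')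
    (\1_(occ t') w + mu) * (\1_(occ t) w + mu).
have bplus t' : bounded_mfun (fun w => \1_(occ t') w + mu).
  by apply: bounded_mfunD => //; exact: bounded_mfun_cst.
have bS : bounded_mfun S by apply: bounded_mfun_sum => t' _; exact: bounded_mfunM.
rewrite -ExB; [|exact: bprod|exact: bprod].
rewrite (eq_Ex _ WE) ExD; [|exact: bounded_mfunM|].
  apply: le_trans (ler_normD _ _) _; apply: lerD.
    apply: Heps => // [t'|t'].
    - rewrite /stage; case: (boolP ((t', false) \in lm)) => [|nf].
        by rewrite mem_filter => /andP[].
      case: (boolP ((t', true) \in lm)) => //; rewrite mem_filter => /andP[h1 h2] _.
      move: nf; rewrite mem_filter; have [_ _ _ /(_ _ h2) ->] := gl.
      rewrite andbT -ltNge => h3; have := tau_lt (_ : t' \in ts).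
      have [_ _ /(_ _ h2) /= t'ts _] := gl; move=> /(_ t'ts) h4.
      by have := lt_le_trans (lt_trans h3 h4) h1; rewrite ltxx.
    - rewrite /stage; case: (boolP ((t', true) \in lm)).
        by rewrite mem_filter => /andP[].
      by case: ((t', false) \in lm).
  apply: (@le_trans _ _ (Ex P S)).
    apply: Ex_norm_le => //; first by apply: bounded_mfunM => //; exact: bounded_mfunB.
    move=> w; rewrite normrM /S -mulr_suml; apply: ler_pM => //; exact: phi_diff.
  rewrite /S Ex_sum; last by move=> t' _; exact: bounded_mfunM.
  have k10 : 0 <= k1 by apply: le_trans (Hk1 tts); exact: fine_ge0.
  apply: (@le_trans _ _ (\sum_(t' <- ts | (t' != t) && nbr t') (k2 + 2 * mu * k1 + mu ^+ 2))).
    rewrite big_seq_cond [leRHS]big_seq_cond.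
    apply: ler_sum => t' /and3P[t'ts t't _].
    have -> : Ex P (fun w => (\1_(occ t') w + mu) * (\1_(occ t) w + mu)) =
        fine (P (occ t' `&` occ t)) + mu * fine (P (occ t')) + mu * fine (P (occ t)) + mu ^+ 2.
      have mI := measurableI _ _ (mocc t') (mocc t).
      have bI := bounded_mfun_indic R mI.
      have bmt := bounded_mfunZ mu (bocc t).
      have bmt' := bounded_mfunZ mu (bocc t').
      have b2 := bounded_mfunD bI bmt'; have b3 := bounded_mfunD b2 bmt.
      rewrite (@eq_Ex _ _ _ P _ (fun w => \1_(occ t' `&` occ t) w + mu * \1_(occ t') w
        + mu * \1_(occ t) w + mu ^+ 2)) => [|w]; last by rewrite indicI /=; ring.
      rewrite (ExD P b3 (bounded_mfun_cst T (mu ^+ 2))) (ExD P b2 bmt) (ExD P bI bmt').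
      by rewrite Ex_cst !ExZ// !Ex_indic.
    have := Hk1 tts; have := Hk1 t'ts; have := Hk2 t'ts tts t't.
    move=> h1 h2 h3; have := ler_wpM2l mu0 h2; have := ler_wpM2l mu0 h3.
    by lra.
  rewrite big_const_seq iter_addr addr0 -[leLHS]mulr_natl; apply: ler_wpM2r.
    by move: (mulr_ge0 mu0 k10) (sqr_ge0 mu) k20; lra.
  apply: le_trans (Hnb (tau (t, b))); rewrite ler_nat; apply: sub_count.
  by move=> t' /andP[].
by apply: bounded_mfunM => //; exact: bounded_mfunB.
Qed.

Lemma swap_path l : good l ->
  `|Ex P (W l) - Ex P (W [::])| <= (size l)%:R * err.
Proof.
elim: l => [|e l IH] gl; first by rewrite subrr normr0 mul0r.
have [/IH h1 h2] := swap_step gl.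
rewrite -[Ex P (W _)](subrK (Ex P (W l))) -addrA.
apply: le_trans (ler_normD _ _) _.
by rewrite /= -natr1 mulrDl mul1r [leRHS]addrC; exact: lerD.
Qed.

(** From all the events in place to none, the latest event being undone
    first. *)
Lemma swap_all :
  `|Ex P (fun w => \prod_(t <- ts) phi t 2%N w) -
    Ex P (fun w => \prod_(t <- ts) phi t 0%N w)| <= (2 * size ts)%:R * err.
Proof.
pose ev := [seq (t, b) | t <- ts, b <- [:: false; true]].
pose l := sort later ev.
have mem_l t b : ((t, b) \in l) = (t \in ts).
  rewrite mem_sort; apply/allpairsP/idP => [[[t' b'] /= [h _ [-> _]]]|h] //.
  by exists (t, b); split => //=; case: b.
have gl : good l.
  split.
  - rewrite sort_uniq; apply: allpairs_uniq => // -[? ?] [? ?] _ _ /= [-> ->] //.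
  - by apply: sort_sorted => a b; exact: le_total.
  - by move=> [t b]; rewrite mem_l.
  - by move=> t; rewrite !mem_l.
have -> : (2 * size ts)%:R = (size l)%:R :> R.
  by rewrite size_sort size_allpairs mulnC.
have := swap_path gl.
rewrite (@eq_Ex _ _ _ P (W l) (fun w => \prod_(t <- ts) phi t 2%N w)) => [|w].
  rewrite (@eq_Ex _ _ _ P (W [::]) (fun w => \prod_(t <- ts) phi t 0%N w)) //.
by rewrite /W; apply: eq_big_seq => t tts; rewrite /stage !mem_l tts.
Qed.

End Swapping.

(** * Generating function at one scale *)

(** The scale is fixed: [rho] stands for $R\ln M$, [mu] for $\mathbf{c}M^{-d}$, [k1]
    and [k2] bound the probabilities that one or two given sites are occupied, [nb]
    the number of sites with an event in a window of length [3 * rho], [e4] and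
    [ups] the errors in the conditional laws of births and marks, and [pE] the
    probability of the exceptional set. *)
Section OneScale.
Context (R : realType) (d : measure_display) (T : measurableType d).
Variables (P : probability T R) (J : eqType) (pts : set J) (ts : seq J).
Variables (n m : nat).
Variables (xi : J -> T -> nat) (xip : J -> 'I_n -> T -> nat).
Variables (zeta : J -> 'I_m -> set T) (F : J -> set (set T)).
Variables (lam1 lamh : J -> R) (E : set T).
Variables (mK : 'I_n -> R) (mJ : 'I_m -> R).
Variables (rho mu k1 k2 nb e4 ups pE : R).
Variables (V : J -> 'I_n -> 'I_m -> R).

Let occ t : set T := [set w | xi t w = 1%N].
Let eta t p : set T := [set w | xip t p w = 1%N /\ xi t w = 1%N].

Hypothesis uts : uniq ts.
Hypothesis tspts : forall t, t \in ts -> pts t.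
Hypothesis mocc : forall t, measurable (occ t).
Hypothesis meta : forall t p, measurable (eta t p).
Hypothesis mzeta : forall t j, measurable (zeta t j).
Hypothesis mE : measurable E.
Hypothesis eta_sum : forall t w, t \in ts ->
  \sum_p (\1_(eta t p) w : R) = \1_(occ t) w.
Hypothesis zeta_sum : forall t w, \sum_j (\1_(zeta t j) w : R) = 1.
Hypothesis mK0 : forall p, 0 <= mK p.
Hypothesis mJ0 : forall j, 0 <= mJ j.
Hypothesis mK1 : \sum_p mK p = 1.
Hypothesis mJ1 : \sum_j mJ j = 1.
Hypothesis V01 : forall t p j, 0 <= V t p j <= 1.
Hypothesis mu0 : 0 <= mu.
Hypothesis mu1 : mu <= 1.
Hypothesis k10 : 0 <= k1.
Hypothesis k20 : 0 <= k2.
Hypothesis HE : fine (P (~` E)) <= pE.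
Hypothesis lam_lt : forall t, t \in ts -> lam1 t < lamh t.
Hypothesis Hnb : forall th, (count (fun t => (th - 3 * rho < lam1 t <= th) ||
  (th - 3 * rho < lamh t <= th)) ts)%:R <= nb.
Hypothesis Hk1 : forall t, t \in ts -> fine (P (occ t)) <= k1.
Hypothesis Hk2 : forall t t', t \in ts -> t' \in ts -> t != t' ->
  fine (P (occ t `&` occ t')) <= k2.
Hypothesis clock : forall t (b : bool), t \in ts ->
  let th := if b then lamh t else lam1 t in
  exists2 t', pts t' & [/\ th - 2 * rho < lam1 t', lam1 t' <= th - rho &
    b -> lam1 t + rho < lam1 t'].
Hypothesis hF : forall t, pts t -> measurable_partition P (F t).
Hypothesis hbirth : forall t t', pts t -> pts t' -> lam1 t >= lam1 t' + rho ->
  forall p, condexp_within P (F t') \1_(eta t p) E (mu * mK p) e4.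
Hypothesis hxip : forall t t', pts t -> pts t' -> lam1 t' > lam1 t + rho ->
  forall p w, E w -> constant_on (xip t p) (pblock (F t') id w).
Hypothesis hxi : forall t, pts t -> forall w, xi t w = (\sum_p xip t p w)%N.
Hypothesis hmark : forall t t', pts t -> pts t' ->
  lamh t >= lam1 t' + rho -> lam1 t' + rho >= lam1 t + 2 * rho ->
  forall j, condexp_within P (F t') \1_(zeta t j) (E `&` occ t) (mJ j) ups.
Hypothesis hzeta : forall t t', pts t -> pts t' -> lam1 t' > lamh t + rho ->
  forall j w, E w -> xi t w = 1%N ->
    constant_on (\1_(zeta t j) : T -> R) (pblock (F t') id w).

(** These are the defects $1 - \varphi$ of the factor of a site: its mean [q]
    before the birth, [x1] averaged over the mark between the birth and the
    reading of the mark, and the actual one [x2] afterwards.  Before the birth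
    the factor is $e^{-q}$ rather than $1 - q$, which costs $O(\mu^2)$. *)
Let q t : R := mu * \sum_p \sum_j mK p * mJ j * V t p j.
Let x1 t (w : T) : R := \sum_p \sum_j \1_(eta t p) w * mJ j * V t p j.
Let x2 t (w : T) : R := \sum_p \sum_j \1_(eta t p) w * \1_(zeta t j) w * V t p j.
(** Outside the list of sites the factor is $1$, so that the bounds hold without
    membership conditions. *)
Let phi (t : J) (s : nat) (w : T) : R :=
  if t \in ts then (if s is 0%N then expR (- q t) else
    if s is 1%N then 1 - x1 t w else 1 - x2 t w) else 1.

Let ind01 (A : set T) w : 0 <= (\1_A w : R) <= 1.
Proof. by rewrite indicE ler0n lern1 leq_b1. Qed.
Let ind0 (A : set T) w : 0 <= (\1_A w : R).
Proof. by have /andP[] := ind01 A w. Qed.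
Let V0 t p j : 0 <= V t p j. Proof. by have /andP[] := V01 t p j. Qed.
Let V1 t p j : V t p j <= 1. Proof. by have /andP[] := V01 t p j. Qed.

Let double_le (a : 'I_n -> R) (b : 'I_m -> R) t :
  (forall p, 0 <= a p) -> (forall j, 0 <= b j) -> \sum_j b j = 1 ->
  0 <= \sum_p \sum_j a p * b j * V t p j <= \sum_p a p.
Proof.
move=> a0 b0 b1; apply/andP; split.
  by apply: sumr_ge0 => p _; apply: sumr_ge0 => j _; rewrite !mulr_ge0.
apply: ler_sum => p _; rewrite -[leRHS]mulr1 -b1 mulr_sumr.
by apply: ler_sum => j _; rewrite ler_piMr// mulr_ge0.
Qed.

Let q_bound t : 0 <= q t <= mu.
Proof.
have /andP[h1 h2] := double_le t mK0 mJ0 mJ1.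
by rewrite mulr_ge0//= ler_piMr// -mK1.
Qed.

Let x1_bound t w : t \in ts -> 0 <= x1 t w <= \1_(occ t) w.
Proof. by move=> tts; rewrite -eta_sum//; apply: double_le. Qed.

Let x2_bound t w : t \in ts -> 0 <= x2 t w <= \1_(occ t) w.
Proof. by move=> tts; rewrite -eta_sum//; apply: double_le. Qed.

Let expq t : 0 <= 1 - expR (- q t) <= mu.
Proof.
have /andP[h1 h2] := q_bound t.
have := expR_ge1Dx (- q t); have : expR (- q t) <= 1 by rewrite expR_le1 oppr_le0.
by move=> ? ?; apply/andP; split; lra.
Qed.

Let phi01 t s w : 0 <= phi t s w <= 1.
Proof.
rewrite /phi; case: ifP => tts; last by rewrite ler01 lexx.
have /andP[a1 a2] := ind01 (occ t) w.
case: s => [|[|s]].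
- by have := expR_gt0 (- q t); have /andP[? ?] := expq t; move=> ?; apply/andP; split; lra.
- by have /andP[? ?] := x1_bound w tts; apply/andP; split; lra.
- by have /andP[? ?] := x2_bound w tts; apply/andP; split; lra.
Qed.

Let phi_diff t s s' w : `|phi t s w - phi t s' w| <= \1_(occ t) w + mu.
Proof.
have H s0 : 0 <= 1 - phi t s0 w <= \1_(occ t) w + mu.
  have a1 := ind0 (occ t) w; have m0 := mu0.
  rewrite /phi; case: ifP => tts; last by rewrite subrr lexx addr_ge0.
  case: s0 => [|[|s0]].
  - by have /andP[? ?] := expq t; apply/andP; split; lra.
  - by have /andP[? ?] := x1_bound w tts; apply/andP; split; lra.
  - by have /andP[? ?] := x2_bound w tts; apply/andP; split; lra.
have /andP[? ?] := H s; have /andP[? ?] := H s'.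
by rewrite ler_norml; apply/andP; split; lra.
Qed.

Let beta t p : bounded_mfun (\1_(eta t p) : T -> R).
Proof. exact: bounded_mfun_indic. Qed.
Let bzeta t j : bounded_mfun (\1_(zeta t j) : T -> R).
Proof. exact: bounded_mfun_indic. Qed.

Let bx1 t : bounded_mfun (x1 t).
Proof.
apply: bounded_mfun_sum => p _; apply: bounded_mfun_sum => j _.
apply: bounded_mfunM; last exact: bounded_mfun_cst.
by apply: bounded_mfunM => //; exact: bounded_mfun_cst.
Qed.

Let bx2 t : bounded_mfun (x2 t).
Proof.
apply: bounded_mfun_sum => p _; apply: bounded_mfun_sum => j _.
apply: bounded_mfunM; last exact: bounded_mfun_cst.
exact: bounded_mfunM.
Qed.

Let bphi t s : bounded_mfun (phi t s).
Proof.
rewrite /phi; case: (t \in ts); last exact: bounded_mfun_cst.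
case: s => [|[|s]]; first exact: bounded_mfun_cst.
  by apply: bounded_mfunB => //; exact: bounded_mfun_cst.
by apply: bounded_mfunB => //; exact: bounded_mfun_cst.
Qed.

Let eta_const t t' p w w1 w2 : pts t -> pts t' -> lam1 t' > lam1 t + rho ->
  E w -> pblock (F t') id w w1 -> pblock (F t') id w w2 ->
  (\1_(eta t p) w1 : R) = \1_(eta t p) w2 /\ xi t w1 = xi t w2.
Proof.
move=> pt pt' h Ew b1 b2; have H p' := hxip pt pt' h p' Ew b1 b2.
have xe : xi t w1 = xi t w2 by rewrite !(hxi pt); apply: eq_bigr => p' _; exact: H.
have pe : xip t p w1 = xip t p w2 := H p.
split=> //; rewrite !indicE; congr (nat_of_bool _)%:R.
by apply/idP/idP => /set_mem[? ?]; apply/mem_set; split; congruence.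
Qed.

(** An occupied site has a mark that is constant on the element once it has been
    read; at an empty site the indicator of its mark may vary, but it is
    multiplied by zero. *)
Let phi_const t t' s w : t \in ts -> pts t' ->
  ((0 < s)%N -> lam1 t' > lam1 t + rho) ->
  ((1 < s)%N -> lam1 t' > lamh t + rho) ->
  E w -> constant_on (phi t s) (pblock (F t') id w).
Proof.
move=> tts pt' h1 h2 Ew w1 w2 b1 b2; rewrite /phi tts.
have pt := tspts tts; have [cF mF [kap [_ _]]] := hF pt'.
have [_ bw] := pblock_mem w cF.
case: s h1 h2 => [//|[|s]] h1 h2.
  congr (1 - _); apply: eq_bigr => p _; apply: eq_bigr => j _.
  by have [-> _] := eta_const p pt pt' (h1 isT) Ew b1 b2.
congr (1 - _); apply: eq_bigr => p _; apply: eq_bigr => j _; congr (_ * _).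
have [e1 x12] := eta_const p pt pt' (h1 isT) Ew b1 b2.
have [_ xw1] := eta_const p pt pt' (h1 isT) Ew bw b1.
rewrite -e1; have [x1w|x1w] := eqVneq (xi t w1) 1%N.
  by congr (_ * _); apply: (hzeta pt pt' (h2 isT) j Ew) => //; rewrite xw1.
rewrite [\1_(eta t p) w1]indicE memNset ?mul0r// /eta /= => -[_ xe].
by rewrite xe in x1w.
Qed.

Let past t (st : J -> nat) w : R := \prod_(t' <- ts | t' != t) phi t' (st t') w.

Let bpast t st : bounded_mfun (past t st).
Proof. exact: bounded_mfun_prod. Qed.

Let past01 t st w : 0 <= past t st w <= 1.
Proof.
apply/andP; split; first by apply: prodr_ge0 => i _; have /andP[] := phi01 i (st i) w.
by apply: prodr_ile1 => i _; exact: phi01.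
Qed.

Let Ex_01 (X : T -> R) : bounded_mfun X -> (forall w, 0 <= X w <= 1) ->
  0 <= Ex P X <= 1.
Proof.
move=> bX X01; rewrite -[X in X <= _ <= _](Ex_cst P) -[X in _ <= _ <= X](Ex_cst P).
by apply/andP; split; apply: Ex_le => //; (try exact: bounded_mfun_cst) => w;
  have /andP[] := X01 w.
Qed.

Let mK_le1 p : mK p <= 1.
Proof. by rewrite -mK1 (bigD1 p)//= lerDl sumr_ge0. Qed.
Let mJ_le1 j : mJ j <= 1.
Proof. by rewrite -mJ1 (bigD1 j)//= lerDl sumr_ge0. Qed.


Let Ex_sum2 (B : T -> R) (X : 'I_n -> 'I_m -> T -> R) (v : 'I_n -> 'I_m -> R) (y : R) :
  bounded_mfun B -> (forall p j, bounded_mfun (X p j)) ->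
  (forall p j, `|v p j| <= 1) ->
  (forall p j, `|Ex P (fun w => B w * X p j w)| <= y) ->
  `|Ex P (fun w => B w * \sum_p \sum_j X p j w * v p j)| <= (n * m)%:R * y.
Proof.
move=> bB bX v1 Hy.
rewrite (@eq_Ex _ _ _ P _ (fun w => \sum_p \sum_j v p j * (B w * X p j w))); last first.
  move=> w; rewrite mulr_sumr; apply: eq_bigr => p _; rewrite mulr_sumr.
  by apply: eq_bigr => j _; ring.
have b1 p j : bounded_mfun (fun w => v p j * (B w * X p j w)).
  by apply: bounded_mfunZ; exact: bounded_mfunM.
rewrite Ex_sum => [|p _]; last exact: bounded_mfun_sum.
apply: le_trans (ler_norm_sum _ _ _) _.
apply: (@le_trans _ _ (\sum_(p < n) \sum_(j < m) y)); last first.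
  by rewrite !sumr_const !card_ord -mulrnA -[leLHS]mulr_natl mulnC.
apply: ler_sum => p _; rewrite Ex_sum => [|j _]; last exact: b1.
apply: le_trans (ler_norm_sum _ _ _) _; apply: ler_sum => j _.
rewrite ExZ; last exact: bounded_mfunM.
by rewrite normrM; apply: le_trans (Hy p j); rewrite ler_piMl.
Qed.

(** The error of undoing one event, the birth or the reading of the mark: a sum
    over the pairs of atoms of conditional errors, and the error
    $|1 - q - e^{-q}|$. *)
Let epsv := (n * m)%:R * (`|e4| + `|ups| * k1 + 2 * pE) + mu ^+ 2.

(** The clock [t'] is at least [rho] older than the event, as the conditional laws
    require, and less than [2 * rho] older, so that events older by [3 * rho] are
    constant on the elements of its partition.  For a mark, the clock also comes
    more than [rho] after the birth, which is thus part of the past. *)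
Let one_swap t (b : bool) (st : J -> nat) : t \in ts ->
  let tau e := if e.2 then lamh e.1 else lam1 e.1 in
  (forall t', (0 < st t')%N -> tau (t', false) <= tau (t, b) - 3 * rho) ->
  (forall t', (1 < st t')%N -> tau (t', true) <= tau (t, b) - 3 * rho) ->
  `|Ex P (fun w => past t st w * (phi t b.+1 w - phi t b w))| <= epsv.
Proof.
move=> tts tau st0 st1; have pt := tspts tts.
have [t' pt' [clk1 clk2 clk3]] := clock b tts.
have past_const w : E w -> constant_on (past t st) (pblock (F t') id w).
  move=> Ew w1 w2 b1 b2; rewrite /past big_seq_cond [RHS]big_seq_cond.
  apply: eq_bigr => u /andP[uts' _].
  apply: (phi_const uts' pt') Ew w1 w2 b1 b2 => h.
    by have := st0 u h; rewrite /tau /=; move: clk1; case: (b) => /=; lra.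
  by have := st1 u h; rewrite /tau /=; move: clk1; case: (b) => /=; lra.
have nm0 : 0 <= (n * m)%:R :> R by [].
case: b st0 st1 clk1 clk2 clk3 => /= st0 st1 clk1 clk2 clk3.
(* Reading of the mark: given the past and the birth, the indicator of an atom
   of the mark has mean close to $m_J(j)$. *)
- have := Ex_sum2 (B := past t st) (X := fun p j w => \1_(eta t p) w * (\1_(zeta t j) w - mJ j))
    (v := fun p j => - V t p j) (y := `|ups| * k1 + 2 * pE).
  have EQ w : past t st w * (phi t 2 w - phi t 1 w) = past t st w *
      \sum_p \sum_j \1_(eta t p) w * (\1_(zeta t j) w - mJ j) * - V t p j.
    have -> : phi t 2 w - phi t 1 w = x1 t w - x2 t w by rewrite /phi tts; ring.
    congr (_ * _); rewrite /x1 /x2 -sumrB; apply: eq_bigr => p _; rewrite -sumrB; apply: eq_bigr => j _; ring.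
  rewrite (eq_Ex P EQ) => H; apply: le_trans (H _ _ _ _) _ => //.
  + by move=> p j; apply: bounded_mfunM => //; apply: bounded_mfunB => //; exact: bounded_mfun_cst.
  + by move=> p j; rewrite normrN ger0_norm.
  + move=> p j.
    rewrite (@eq_Ex _ _ _ P _ (fun w => (past t st w * \1_(eta t p) w) * (\1_(zeta t j) w - mJ j))); last first.
      by move=> w; rewrite mulrA.
    have bB : bounded_mfun (fun w => past t st w * \1_(eta t p) w) by exact: bounded_mfunM.
    have eta01 w := ind01 (eta t p) w.
    have le_occ w : past t st w * \1_(eta t p) w <= \1_(occ t) w.
      have /andP[? ?] := past01 t st w; have /andP[? ?] := eta01 w.
      apply: le_trans (_ : _ <= \1_(eta t p) w) _; first by rewrite ler_piMl.
      rewrite !indicE ler_nat; case: (boolP (w \in eta t p)) => // /set_mem[_ xe].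
      by rewrite mem_set.
    have Bconst w : E w -> constant_on (fun w => past t st w * \1_(eta t p) w)
        (pblock (F t') id w).
      move=> Ew w1 w2 b1 b2; rewrite (past_const w Ew w1 w2 b1 b2).
      by have [-> _] := eta_const p pt pt' (clk3 isT) Ew b1 b2.
    have B01 w : 0 <= past t st w * \1_(eta t p) w <= 1.
      have /andP[? ?] := past01 t st w; have /andP[? ?] := eta01 w.
      by rewrite mulr_ge0//= mulr_ile1.
    apply: le_trans (conditional_estimate (hF pt') mE (mzeta t j) bB B01 Bconst _
      (hmark pt pt' _ _ j)) _ => //.
    * move=> w Ew; rewrite mulf_eq0 negb_or => /andP[_ h]; split => //.
      move: h; rewrite indicE; case: (boolP (w \in eta t p)); last by rewrite eqxx.
      by move=> /set_mem[].
    * by move: clk2; lra.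
    * by move: (clk3 isT); lra.
    apply: lerD.
      rewrite ler_wpM2l//; apply: le_trans (Hk1 tts); rewrite -Ex_indic//.
      by apply: Ex_le => //; exact: bounded_mfun_indic.
    apply: ler_pM => //; first by rewrite fine_ge0.
    by rewrite ger0_norm//; have := mJ_le1 j; lra.
  + rewrite /epsv; have := ler_wpM2l nm0 (normr_ge0 e4); have := sqr_ge0 mu.
    by rewrite mulr0 => ? ?; rewrite !mulrDr; lra.
(* Birth: given the past, the indicator of a birth in an atom has mean close
   to $\mu\, m_K(p)$. *)
- have EQ w : past t st w * (phi t 1 w - phi t 0 w) = past t st w *
      \sum_p \sum_j (\1_(eta t p) w - mu * mK p) * - (mJ j * V t p j) +
      (1 - q t - expR (- q t)) * past t st w.
    have -> : \sum_p \sum_j (\1_(eta t p) w - mu * mK p) * - (mJ j * V t p j) = q t - x1 t w.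
      rewrite /x1 /q mulr_sumr -sumrB; apply: eq_bigr => p _.
      by rewrite mulr_sumr -sumrB; apply: eq_bigr => j _; ring.
    by rewrite /phi tts; ring.
  have beta' p : bounded_mfun (fun w => \1_(eta t p) w - mu * mK p).
    by apply: bounded_mfunB => //; exact: bounded_mfun_cst.
  have bsum : bounded_mfun (fun w => past t st w *
      \sum_p \sum_j (\1_(eta t p) w - mu * mK p) * - (mJ j * V t p j)).
    apply: bounded_mfunM => //; apply: bounded_mfun_sum => p _.
    apply: bounded_mfun_sum => j _; apply: bounded_mfunM => //.
    exact: bounded_mfun_cst.
  rewrite (eq_Ex P EQ) ExD//; last exact: bounded_mfunZ.
  rewrite ExZ//; apply: le_trans (ler_normD _ _) _; rewrite /epsv; apply: lerD.
    apply: le_trans (Ex_sum2 (X := fun p j w => \1_(eta t p) w - mu * mK p)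
       (v := fun p j => - (mJ j * V t p j)) (y := `|e4| + 2 * pE) _ _ _ _) _ => //.
    + by move=> p j; rewrite normrN ger0_norm ?mulr_ge0// mulr_ile1.
    + move=> p j.
      apply: le_trans (conditional_estimate (G := E) (hF pt') mE (meta t p) (bpast t st)
        (past01 t st) past_const _ (hbirth pt pt' _ p)) _ => //.
        by move: clk2; lra.
      have /andP[? ?] := Ex_01 (bpast t st) (past01 t st).
      apply: lerD; first by rewrite ler_piMr.
      apply: ler_pM => //; first by rewrite fine_ge0.
      have h : mu * mK p <= 1 by rewrite mulr_ile1.
      by rewrite ger0_norm ?mulr_ge0//; move: h; lra.
    + have := mulr_ge0 nm0 (mulr_ge0 (normr_ge0 ups) k10).
      by rewrite !mulrDr; lra.
  have /andP[? ?] := Ex_01 (bpast t st) (past01 t st).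
  have /andP[q0 qm] := q_bound t.
  rewrite normrM (ger0_norm (_ : 0 <= Ex P (past t st)))//.
  apply: (@le_trans _ _ (q t ^+ 2)); last by rewrite lerXn2r// nnegrE.
  apply: le_trans (ler_piMr _ _) _ => //.
  have e1 := expR_ge1Dx (- q t); have e2 := expR_ge1Dx (q t).
  have e3 : expR (- q t) * expR (q t) = 1 by rewrite -expRD addNr expR0.
  have e5 := expR_gt0 (- q t).
  rewrite ler_norml; apply/andP; split; last by have := sqr_ge0 (q t); lra.
  have : expR (- q t) * (1 + q t) <= 1.
    by rewrite -[leRHS]e3 ler_pM2l.
  have q3 : 0 <= q t * q t ^+ 2 by rewrite mulr_ge0// sqr_ge0.
  move=> e6; have : expR (- q t) <= 1 - q t + q t ^+ 2.
    rewrite -(ler_pM2r (_ : 0 < 1 + q t)); last by lra.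
    apply: le_trans e6 _.
    have -> : (1 - q t + q t ^+ 2) * (1 + q t) = 1 + q t * q t ^+ 2 by ring.
    by rewrite lerDl.
  by lra.
Qed.

Lemma one_scale_estimate :
  `|Ex P (fun w => \prod_(t <- ts) (1 - x2 t w)) - expR (- \sum_(t <- ts) q t)| <=
    (2 * size ts)%:R * (epsv + nb * (k2 + 2 * mu * k1 + mu ^+ 2)).
Proof.
pose tau (e : J * bool) := if e.2 then lamh e.1 else lam1 e.1.
have := @swap_all R d T P J ts occ phi tau mu (3 * rho) nb k1 k2 epsv uts mocc
  bphi phi01 mu0 k20 phi_diff.
have -> : Ex P (fun w => \prod_(t <- ts) phi t 2 w) =
    Ex P (fun w => \prod_(t <- ts) (1 - x2 t w)).
  by apply: eq_Ex => w; apply: eq_big_seq => t tts; rewrite /phi tts.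
have -> : Ex P (fun w => \prod_(t <- ts) phi t 0 w) = expR (- \sum_(t <- ts) q t).
  rewrite -[RHS](Ex_cst P); apply: eq_Ex => w; rewrite -sumrN expR_sum.
  by apply: eq_big_seq => t tts; rewrite /phi tts.
apply => [//|th|//|//|t b st tts s0 s1].
- apply: le_trans (Hnb th); rewrite ler_nat; apply: sub_count => t.
  by move=> /existsP[[] /=] ->; rewrite ?orbT.
- exact: one_swap.
Qed.

End OneScale.

(** * Generating function as the scale grows *)

Lemma near_of_ex (Q : nat -> Prop) :
  (exists M0 : nat, forall M, (M0 < M)%N -> Q M) -> \forall M \near \oo, Q M.
Proof. by move=> [M0 H]; exists M0.+1 => // M; exact: H. Qed.

Section FixedPartitions.
Context (R : realType) (dO : measure_display) (Omega : measurableType dO).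
Variables (P : probability Omega R) (d n m : nat) (D D' : set 'rV[R]_d).
Variables (s0 sh0 : R) (s sh : 'rV[R]_d).
Variables (lam1 lamh : nat -> 'rV[nat]_d -> R).
Variables (xi : nat -> 'rV[nat]_d -> Omega -> nat).
Variables (xip : nat -> 'rV[nat]_d -> 'I_n -> Omega -> nat).
Variables (zeta : nat -> 'rV[nat]_d -> 'I_m -> set Omega).
Variables (F : nat -> 'rV[nat]_d -> set (set Omega)) (E : nat -> set Omega).
Variables (mK : 'I_n -> R) (mJ : 'I_m -> R) (c r : R) (ups : nat -> R).

Let occ M t : set Omega := [set w | xi M t w = 1%N].
Let eta M t p : set Omega := [set w | xip M t p w = 1%N /\ xi M t w = 1%N].

Hypothesis hD : bounded_domain D.
Hypothesis hD' : bounded_domain D'.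
Hypothesis hDD' : D `<=` D'.
Hypothesis hpos : forall x, D' x -> forall i, 0 <= x ord0 i.
Hypothesis hs : s != 0.
Hypothesis hsh : sh != 0.
Hypothesis hlt : forall x, D° x -> affine_form s0 s x < affine_form sh0 sh x.
Hypothesis hmax : sup (affine_form sh0 sh @` D) < sup (affine_form s0 s @` D').
Hypothesis hlam1 : forall M t, lam1 M t = M%:R * affine_form s0 s (rescale R M t).
Hypothesis hlamh : forall M t, lamh M t = M%:R * affine_form sh0 sh (rescale R M t).
Hypothesis hc : 0 < c.
Hypothesis hr : 0 < r.
Hypothesis mocc : forall M t, measurable (occ M t).
Hypothesis meta : forall M t p, measurable (eta M t p).
Hypothesis mzeta : forall M t j, measurable (zeta M t j).
Hypothesis mE : forall M, measurable (E M).
Hypothesis eta_sum : forall M t w, (0 < M)%N -> lattice_points D' M t ->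
  \sum_p (\1_(eta M t p) w : R) = \1_(occ M t) w.
Hypothesis zeta_sum : forall M t w, \sum_j (\1_(zeta M t j) w : R) = 1.
Hypothesis mK0 : forall p, 0 <= mK p.
Hypothesis mJ0 : forall j, 0 <= mJ j.
Hypothesis mK1 : \sum_p mK p = 1.
Hypothesis mJ1 : \sum_j mJ j = 1.
Hypothesis hF : forall M t, (0 < M)%N -> lattice_points D' M t ->
  measurable_partition P (F M t).
Hypothesis hE : exists C : R, forall M, (0 < M)%N ->
  (P (~` E M) <= (C * M%:R ^- (100 * d))%:E)%E.
Hypothesis h1 : exists C : R, forall M t, (0 < M)%N -> lattice_points D' M t ->
  fine (P (occ M t)) <= C * M%:R ^- d.
Hypothesis h3 : exists C : R, forall M t t', (0 < M)%N ->
  lattice_points D' M t -> lattice_points D' M t' -> t != t' ->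
  fine (P (occ M t `&` occ M t')) <= C * M%:R ^- (2 * d).
Hypothesis h4 : exists C : R, forall M t t', (0 < M)%N ->
  lattice_points D' M t -> lattice_points D' M t' ->
  lam1 M t >= lam1 M t' + r * ln M%:R -> forall p : 'I_n,
  condexp_within P (F M t') \1_(eta M t p) (E M)
    (c * mK p * M%:R ^- d) (C * M%:R ^- (2 * d)).
Hypothesis hxi : forall M t, (0 < M)%N -> lattice_points D' M t ->
  forall w, xi M t w = (\sum_(p < n) xip M t p w)%N.
Hypothesis h5 : forall M t tb, (0 < M)%N ->
  lattice_points D' M t -> lattice_points D' M tb ->
  lam1 M tb > lam1 M t + r * ln M%:R ->
  forall (p : 'I_n) w, E M w ->
    constant_on (xip M t p) (pblock (F M tb) id w).
Hypothesis hups : ups @ \oo --> (0 : R).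
Hypothesis h7 : forall M t t', (0 < M)%N ->
  lattice_points D' M t -> lattice_points D' M t' ->
  lamh M t >= lam1 M t' + r * ln M%:R ->
  lam1 M t' + r * ln M%:R >= lam1 M t + 2 * r * ln M%:R ->
  forall j : 'I_m, condexp_within P (F M t') \1_(zeta M t j)
    (E M `&` occ M t) (mJ j) (ups M).
Hypothesis h8 : forall M t tb, (0 < M)%N ->
  lattice_points D' M t -> lattice_points D' M tb ->
  lam1 M tb > lamh M t + r * ln M%:R ->
  forall (j : 'I_m) w, E M w -> xi M t w = 1%N ->
    constant_on (\1_(zeta M t j) : Omega -> R) (pblock (F M tb) id w).

Let weights := 'rV[nat]_d -> 'I_n -> 'I_m -> R.
Let q M (V : weights) t : R :=
  c * M%:R ^- d * \sum_p \sum_j mK p * mJ j * V t p j.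
Let x2 M (V : weights) t (w : Omega) : R :=
  \sum_p \sum_j \1_(eta M t p) w * \1_(zeta M t j) w * V t p j.

Let sites M : seq 'rV[nat]_d := fset_set (lattice_points D M).

(** Regular sites are born and have their mark read late enough for clocks to
    exist. *)
Let regular (delta : R) (x1 : 'rV[R]_d) M (t : 'rV[nat]_d) : bool :=
  (affine_form s0 s x1 + delta <= affine_form s0 s (rescale R M t)) &&
  (affine_form s0 s (rescale R M t) + delta <= affine_form sh0 sh (rescale R M t)).

Let bD : bounded_set D. Proof. by case: hD. Qed.

Let mem_sites M t : (0 < M)%N -> (t \in sites M) = `[< lattice_points D M t >].
Proof.
move=> M0; have [C _ /(_ M M0) [fD _]] := card_le_lattice_points bD.
by rewrite in_fset_set//; apply/idP/asboolP => [/set_mem|/mem_set].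
Qed.

Let count_sites M (p : pred 'rV[nat]_d) (x : R) : (0 < M)%N ->
  card_le_real [set t | lattice_points D M t /\ p t] x ->
  (count p (sites M))%:R <= x.
Proof.
move=> M0 [fS]; apply: le_trans; rewrite ler_nat -size_filter.
apply: uniq_leq_size; first by rewrite filter_uniq// fset_uniq.
move=> t; rewrite mem_filter mem_sites// => /andP[pt /asboolP Dt].
by rewrite in_fset_set//; apply/mem_set.
Qed.

Let rho_large (K x : R) : 0 < x -> \forall M \near \oo,
  K < r * ln M%:R /\ 3 * (r * ln M%:R) < x * M%:R.
Proof.
move=> x0.
have [M1 H1] := @ln_large R (K / r).
have [M2 H2] := @ln_small R (x / (3 * r)) (divr_gt0 x0 (mulr_gt0 (ltr0n _ 3) hr)).
exists (maxn M1 M2).+1 => // M /=; rewrite gtn_max => /andP[/H1 h /H2 h'].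
split; first by rewrite mulrC -ltr_pdivrMr.
have := h'; rewrite mulrAC ler_pdivlMr; last by rewrite mulr_gt0.
by have := hr; lra.
Qed.

(** Aiming at the time $th - \rho - S$, where $S$ bounds the rounding error, yields
    a lattice time between $th - \rho - 2S$ and $th - \rho$, and $2S < \rho$ for large
    $M$.  The value aimed at is in the range of $\ell_1$ on [D'] because the site
    is regular, and because some point of [D'] has a larger value of $\ell_1$ than
    all marks. *)
Let clock_ticks (delta : R) (x1 x2' : 'rV[R]_d) :
  D'° x1 -> D'° x2' -> 0 < delta ->
  (forall x, D x -> affine_form sh0 sh x <= affine_form s0 s x2') ->
  \forall M \near \oo, forall t (b : bool), lattice_points D M t ->
    regular delta x1 M t ->
    let th := if b then lamh M t else lam1 M t in
    let rho := r * ln M%:R in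
    exists2 t', lattice_points D' M t' &
      [/\ th - 2 * rho < lam1 M t', lam1 M t' <= th - rho &
         b -> lam1 M t + rho < lam1 M t'].
Proof.
move=> Dx1 Dx2 de0 top; pose S := \sum_j `|s ord0 j|.
have S0 : 0 <= S by apply: sumr_ge0.
have [_ cD' _ _] := hD'.
have [M0 HM0] := lattice_time s0 cD' hpos hs Dx1 Dx2.
near=> M.
have Hr : 2 * S < r * ln M%:R /\ 3 * (r * ln M%:R) < delta * M%:R.
  by near: M; exact: rho_large.
move=> t b Dt /andP[e1 e2]; set th := if b then _ else _.
set rho := r * ln M%:R in Hr *; have [Sr rd] := Hr.
have MM0 : (M0 < M)%N by near: M; exists M0.+1.
have M1 : (0 < M)%N by exact: leq_ltn_trans MM0.
have M1' : 0 < M%:R :> R by rewrite ltr0n.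
pose v := (th - rho - S) / M%:R.
have Mv : M%:R * v = th - rho - S by rewrite mulrC divfK// gt_eqF.
have g1 : M%:R * affine_form s0 s x1 + delta * M%:R <= lam1 M t.
  by rewrite hlam1 [delta * _]mulrC -mulrDr ler_pM2l.
have g2 : lam1 M t + delta * M%:R <= lamh M t.
  by rewrite hlam1 hlamh [delta * _]mulrC -mulrDr ler_pM2l.
have dM : 0 < delta * M%:R by rewrite mulr_gt0.
have th1 : lam1 M t <= th by rewrite /th; case: (b) => //; lra.
have th2 : th <= M%:R * affine_form s0 s x2'.
  apply: (@le_trans _ _ (lamh M t)); first by rewrite /th; case: (b) => //; lra.
  by rewrite hlamh ler_pM2l//; exact: top.
have [|t' D't' ht'] := HM0 M MM0 v.
  by apply/andP; split; rewrite -(ler_pM2l M1') Mv; lra.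
exists t' => //; move: ht'; rewrite -hlam1 Mv -/S ler_norml => /andP[h1' h2'].
split; [lra|lra|].
by move=> bt; move: h1'; rewrite /th bt => h1'; lra.
Unshelve. all: by end_near.
Qed.

Let many_sites : exists2 C : R, 0 < C & forall M, (0 < M)%N ->
  (size (sites M))%:R <= C * M%:R ^+ d.
Proof.
have [C C0 H] := card_le_lattice_points bD; exists C => // M M0.
by have [_] := H M M0.
Qed.

Let few_neighbours : exists2 C : R, 0 < C & forall M, (0 < M)%N ->
  forall th w : R, 0 <= w ->
  (count (fun t => (th - w < lam1 M t <= th) || (th - w < lamh M t <= th))
    (sites M))%:R <= C * M%:R ^+ d * ((w + 1) / M%:R).
Proof.
have [C C0 HC] := card_le_slab s0 bD hs.
have [C' C'0 HC'] := card_le_slab sh0 bD hsh.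
exists (C + C'); first by rewrite addr_gt0.
move=> M M0 th w w0; apply: count_sites => //.
apply: card_le_real_sub (card_le_realU (HC M M0 (th - w) w w0) (HC' M M0 (th - w) w w0)).
  move=> t [Dt /orP[]/andP[a b]]; [left|right]; split=> //.
    by rewrite -hlam1 subrK b ltW.
  by rewrite -hlamh subrK b ltW.
by rewrite -!mulrDl mulrA.
Qed.

(** There are $O(M^d)$ sites.  Each contributes $O(M^{-2d})$ from the laws of
    births and the exceptional set, $O(\upsilon_M M^{-d})$ from the laws of marks, and
    $O(M^{d-1} \ln M \cdot M^{-2d})$ from the neighbours in its windows: [A1], [A2]
    and [A3] are the constants in the three resulting error terms. *)
Let scale_bound (delta : R) (x1 x2' : 'rV[R]_d) (e : R) :
  D'° x1 -> D'° x2' -> 0 < delta ->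
  (forall x, D x -> affine_form sh0 sh x <= affine_form s0 s x2') -> 0 < e ->
  \forall M \near \oo, forall V : weights, (forall t p j, 0 <= V t p j <= 1) ->
    let ts := [seq t <- sites M | regular delta x1 M t] in
    `|Ex P (fun w => \prod_(t <- ts) (1 - x2 M V t w)) -
      expR (- \sum_(t <- ts) q M V t)| <= e.
Proof.
move=> Dx1 Dx2 de0 top e0.
have [CD CD0 HCD] := many_sites.
have [Cs Cs0 HCs] := few_neighbours.
have [C1 HC1] := h1; have [C3 HC3] := h3; have [C4 HC4] := h4; have [CE HCE] := hE.
have d0 : (0 < d)%N.
  by case: (d) s hs => // s'; rewrite thinmx0 eqxx.
pose nm : R := (n * m)%:R.
have nm0 : 0 <= nm by [].
pose A1 := 2 * CD * (nm * (`|C4| + 2 * `|CE|) + c ^+ 2).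
pose A2 := 2 * CD * (nm * `|C1|).
pose A3 := 2 * CD * (Cs * (`|C3| + 2 * c * `|C1| + c ^+ 2)).
have CD0' := ltW CD0; have Cs0' := ltW Cs0; have c0' := ltW hc.
have A10 : 0 <= A1 by rewrite !(mulr_ge0, addr_ge0).
have A20 : 0 <= A2 by rewrite !(mulr_ge0, addr_ge0).
have A30 : 0 <= A3 by rewrite !(mulr_ge0, addr_ge0).
have ex (A : R) : 0 <= A -> 0 < e / 3 / (A + 1).
  by move=> A0; rewrite !divr_gt0// ltr_wpDl.
have le3 (A x : R) : 0 <= A -> 0 <= x -> x <= e / 3 / (A + 1) -> A * x <= e / 3.
  move=> A0 x0; rewrite ler_pdivlMr ?ltr_wpDl// mulrDr mulr1 [x * A]mulrC.
  by lra.
have r31 : 0 < 3 * r + 1 by have := hr; lra.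
near=> M.
move=> V V01; set ts := [seq t <- _ | _].
have M1 : (0 < M)%N by near: M; exists 1%N.
have M1' : 0 < M%:R :> R by rewrite ltr0n.
have M11 : 1 <= M%:R :> R by rewrite ler1n.
pose y : R := M%:R ^+ d; have y0 : 0 < y by rewrite exprn_gt0.
pose z := y^-1; have z0 : 0 < z by rewrite invr_gt0.
have yz : y * z = 1 by rewrite divff// gt_eqF.
have z2 : M%:R ^- (2 * d) = z ^+ 2 :> R by rewrite mulnC exprM exprVn.
have zM : z <= M%:R^-1.
  rewrite lef_pV2 ?posrE// /y -[leLHS]expr1 ler_weXn2l//.
have z1 : z <= 1 by apply: le_trans zM _; rewrite invf_le1.
have z100 : M%:R ^- (100 * d) <= z ^+ 2.
  rewrite -z2 lef_pV2 ?posrE ?exprn_gt0//.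
  by apply: ler_weXn2l => //; rewrite leq_mul2r orbT.
pose rho := r * ln M%:R.
have rho0 : 0 <= rho by rewrite mulr_ge0 ?ln_ge0// ltW.
pose L := (3 * rho + 1) / M%:R.
have L0 : 0 <= L by rewrite divr_ge0// addr_ge0// mulr_ge0.
have small1 : M%:R^-1 <= e / 3 / (A1 + 1).
  near: M; apply: near_of_ex.
  have [M0 H] := @nat_large R (e / 3 / (A1 + 1))^-1; exists M0 => M /H h.
  have ex1 := ex _ A10; have Mp : 0 < M%:R :> R.
    by apply: lt_trans h; rewrite invr_gt0.
  by rewrite invf_ple ?posrE//; exact: ltW.
have small2 : `|ups M| <= e / 3 / (A2 + 1).
  near: M; move/cvgrPdist_le : hups => /(_ _ (ex _ A20)).
  by apply: filterS => M; rewrite sub0r normrN.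
have small3 : L <= e / 3 / (A3 + 1).
  have : ln M%:R + 1 <= e / 3 / (A3 + 1) / (3 * r + 1) * M%:R.
    by near: M; apply: near_of_ex; exact: (ln_small (divr_gt0 (ex _ A30) r31)).
  rewrite mulrAC ler_pdivlMr// => h; rewrite ler_pdivrMr//.
  apply: le_trans h; rewrite /rho; have := ln_ge0 M11; have := hr; nra.
have cz1 : c * z <= 1.
  have h : c < M%:R by near: M; apply: near_of_ex; exact: nat_large.
  apply: (@le_trans _ _ (M%:R * M%:R^-1)); last by rewrite divff// gt_eqF.
  by apply: ler_pM => //; exact: ltW.
have tick : forall t (b : bool), lattice_points D M t ->
    regular delta x1 M t ->
    let th := if b then lamh M t else lam1 M t in
    let rho := r * ln M%:R in
    exists2 t', lattice_points D' M t' &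
      [/\ th - 2 * rho < lam1 M t', lam1 M t' <= th - rho &
         b -> lam1 M t + rho < lam1 M t'].
  by near: M; exact: (clock_ticks Dx1 Dx2 de0 top).
have tsP t : t \in ts -> lattice_points D M t /\ regular delta x1 M t.
  by rewrite mem_filter mem_sites// => /andP[-> /asboolP].
have ts' t : t \in ts -> lattice_points D' M t.
  by move=> /tsP[Dt _]; exact: hDD'.
have est := @one_scale_estimate R dO Omega P _ (lattice_points D' M) ts n m
  (xi M) (xip M) (zeta M) (F M) (lam1 M) (lamh M) (E M) mK mJ rho (c * z)
  (`|C1| * z) (`|C3| * z ^+ 2) (Cs * y * L) (C4 * z ^+ 2) (ups M) (`|CE| * z ^+ 2) V.
apply: le_trans (est _ _ _ _ _ _ _ _ _ _ _ _ _ _ _ _ _ _ _ _ _ _ _ _ _ _ _ _ _) _ => //.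
- by rewrite filter_uniq// fset_uniq.
- by move=> t; exact: mocc.
- by move=> t p; exact: meta.
- by move=> t w /ts'; exact: eta_sum.
- by rewrite mulr_ge0// ltW.
- by rewrite mulr_ge0// ltW.
- by rewrite mulr_ge0// sqr_ge0.
- have := HCE M M1; rewrite -[P _]fineK ?lee_fin; last first.
    by apply: fin_num_measure; exact: measurableC.
  move=> /le_trans; apply; apply: (@le_trans _ _ (`|CE| * M%:R ^- (100 * d))).
    by rewrite ler_wpM2r ?invr_ge0 ?exprn_ge0// ler_norm.
  by rewrite ler_wpM2l.
- move=> t /tsP[_ /andP[_ h]]; rewrite hlam1 hlamh ltr_pM2l//.
  by apply: lt_le_trans h; rewrite ltrDl.
- move=> th; apply: le_trans (HCs M M1 th (3 * rho) _); last by rewrite mulr_ge0.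
  by rewrite ler_nat count_filter; apply: sub_count => t /andP[].
- move=> t /ts' Dt; apply: le_trans (HC1 M t M1 Dt) _; rewrite -/y -/z.
  by rewrite ler_wpM2r ?(ltW z0)// ler_norm.
- move=> t t' /ts' Dt /ts' Dt' tt'; apply: le_trans (HC3 M t t' M1 Dt Dt' tt') _.
  by rewrite z2 ler_wpM2r ?sqr_ge0// ler_norm.
- by move=> t b /tsP[Dt et]; exact: (tick t b Dt et).
- by move=> t Dt; exact: hF.
- move=> t t' Dt Dt' h p; have := HC4 M t t' M1 Dt Dt' h p.
  by rewrite z2 -/y -/z mulrAC.
- by move=> t t' Dt Dt' h p w; exact: h5.
- by move=> t Dt; exact: hxi.
- by move=> t t' Dt Dt' h h' j; apply: h7 => //; rewrite -mulrA.
- by move=> t t' Dt Dt' h j w; exact: h8.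
have Nts : (size ts)%:R <= CD * y.
  apply: le_trans (HCD M M1); rewrite ler_nat size_filter; exact: count_size.
rewrite normrM (ger0_norm (sqr_ge0 z)) natrM.
have u0 := normr_ge0 (ups M); have iM0 : 0 <= (M%:R : R)^-1 by rewrite invr_ge0.
have t1 := le3 _ _ A10 iM0 small1; have t2 := le3 _ _ A20 u0 small2.
have t3 := le3 _ _ A30 L0 small3.
apply: (@le_trans _ _ (A1 * z + A2 * `|ups M| + A3 * L)); last first.
  have := ler_wpM2l A10 zM; lra.
have z0' := ltW z0; have y0' := ltW y0.
set big := _ + Cs * y * L * _.
have big0 : 0 <= big.
  rewrite /big; repeat first [by []|apply: addr_ge0|apply: sqr_ge0|apply: mulr_ge0].
apply: (@le_trans _ _ (2 * (CD * y) * big)).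
  by rewrite ler_wpM2r// ler_pM2l.
have -> : 2 * (CD * y) * big = (y * z) * (A1 * z + A2 * `|ups M|) + (y * z) ^+ 2 * (A3 * L).
  rewrite /big /A1 /A2 /A3 -/nm; ring.
by rewrite yz expr1n !mul1r.
Unshelve. all: by end_near.
Qed.

Let x2_occ M (V : weights) t w : (0 < M)%N -> lattice_points D' M t ->
  (forall t p j, 0 <= V t p j <= 1) -> 0 <= x2 M V t w <= \1_(occ M t) w.
Proof.
move=> M0 Dt V01; have V0 p j : 0 <= V t p j by have /andP[] := V01 t p j.
have i0 A : 0 <= (\1_A w : R) by rewrite indicE.
rewrite -eta_sum//; apply/andP; split.
  by apply: sumr_ge0 => p _; apply: sumr_ge0 => j _; rewrite !mulr_ge0.
apply: ler_sum => p _; rewrite -[leRHS]mulr1 -(zeta_sum M t w) mulr_sumr.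
apply: ler_sum => j _; rewrite ler_piMr ?mulr_ge0//.
by have /andP[] := V01 t p j.
Qed.

Let bx2 M (V : weights) t : bounded_mfun (x2 M V t).
Proof.
apply: bounded_mfun_sum => p _; apply: bounded_mfun_sum => j _.
apply: bounded_mfunM; last exact: bounded_mfun_cst.
by apply: bounded_mfunM; exact: bounded_mfun_indic.
Qed.

Let q_bound M (V : weights) t : (forall t p j, 0 <= V t p j <= 1) ->
  0 <= q M V t <= c * M%:R ^- d.
Proof.
move=> V01; have V0 p j : 0 <= V t p j by have /andP[] := V01 t p j.
have cM : 0 <= c * M%:R ^- d by rewrite mulr_ge0 ?invr_ge0 ?exprn_ge0// ltW.
apply/andP; split.
  rewrite mulr_ge0//; apply: sumr_ge0 => p _; apply: sumr_ge0 => j _.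
  by rewrite !mulr_ge0.
rewrite ler_piMr// -mK1; apply: ler_sum => p _.
rewrite -[leRHS]mulr1 -mJ1 mulr_sumr; apply: ler_sum => j _.
by rewrite ler_piMr ?mulr_ge0//; have /andP[] := V01 t p j.
Qed.

(** The supremum of $\ell_1$ over [D'] exceeds that of $\hat\ell$ over [D], and it
    is approached from the interior. *)
Let late_point : exists2 x2', D'° x2' &
  forall x, D x -> affine_form sh0 sh x <= affine_form s0 s x2'.
Proof.
have [_ _ D'c bD'] := hD'; have [[x0 Dx0] _ _ _] := hD.
have Dx0' : D x0 by exact: interior_subset.
have [B _ HB] := affine_form_bounded sh0 sh bD.
have hsD : has_sup (affine_form sh0 sh @` D).
  split; first by exists (affine_form sh0 sh x0), x0.
  by exists B => _ [x Dx <-]; have := HB _ Dx; rewrite ler_norml => /andP[].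
have ne : affine_form s0 s @` D' !=set0 by exists (affine_form s0 s x0), x0; [exact: hDD'|].
have [_ [y D'y <-] ygt] := sup_gt ne hmax.
have := affine_form_interior_lt (s0 := - s0) (s := - s)
  (v := - sup (affine_form sh0 sh @` D)) D'c D'y.
rewrite affine_formN ltrN2 => /(_ ygt)[x D'x].
rewrite affine_formN ltrN2 => xgt; exists x => // z Dz.
apply: le_trans (ltW xgt); apply: ub_le_sup; first by case: hsD.
by exists z.
Qed.

Let expR_diff (x y : R) : 0 <= x -> x <= y -> `|expR (- y) - expR (- x)| <= y - x.
Proof.
move=> x0 xy; have h : expR (- y) <= expR (- x) by rewrite ler_expR lerN2.
rewrite distrC ger0_norm ?subr_ge0//.
have -> : expR (- y) = expR (- x) * expR (- (y - x)) by rewrite -expRD; congr expR; ring.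
have e1 := expR_ge1Dx (- (y - x)).
have : expR (- x) <= 1 by rewrite expR_le1 oppr_le0.
have := expR_ge0 (- x); set a := expR (- x); set b := expR _ in e1 *.
have : b <= 1 by rewrite expR_le1 oppr_le0 subr_ge0.
by move=> b1 a0 a1; nra.
Qed.

(** Irregular sites are discarded: as there are at most $hM^d$ of them, they
    change both terms by $O(h)$.  To the remaining ones [scale_bound] applies. *)
Lemma pgf_limit (V : nat -> weights) : (forall M t p j, 0 <= V M t p j <= 1) ->
  (fun M => Ex P (fun w => \prod_(t <- sites M) (1 - x2 M (V M) t w)) -
            expR (- \sum_(t <- sites M) q M (V M) t)) @ \oo --> (0 : R).
Proof.
move=> V01; apply/cvgrPdist_le => e e0.
have [C1 HC1] := h1.
pose K := `|C1| + c; have K0 : 0 < K by rewrite ltr_wpDl.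
pose h := e / 2 / K; have hp : 0 < h by rewrite !divr_gt0.
have [x2' Dx2 top] := late_point.
have [delta de0 [x1 Dx1 [M0 bad]]] := few_bad_sites hD hD' hDD' hs hlt hp.
have e2 : 0 < e / 2 by rewrite divr_gt0.
near=> M.
have MM0 : (M0 < M)%N by near: M; exists M0.+1.
have M1 : (0 < M)%N by exact: leq_ltn_trans MM0.
have y0 : 0 < M%:R ^+ d :> R by rewrite exprn_gt0// ltr0n.
have est : forall W : weights, (forall t p j, 0 <= W t p j <= 1) ->
    let ts := [seq t <- sites M | regular delta x1 M t] in
    `|Ex P (fun w => \prod_(t <- ts) (1 - x2 M W t w)) -
      expR (- \sum_(t <- ts) q M W t)| <= e / 2.
  by near: M; exact: (scale_bound Dx1 Dx2 de0 top e2).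
have {est} /= est := est (V M) (V01 M).
have sitesP t : t \in sites M -> lattice_points D' M t.
  by rewrite mem_sites// => /asboolP/hDD'.
have nbad : (count (fun t => ~~ regular delta x1 M t) (sites M))%:R <= h * M%:R ^+ d.
  by apply: count_sites => //; exact: bad.
pose a t w := 1 - x2 M (V M) t w.
have a01 t w : t \in sites M -> 0 <= a t w <= 1.
  move=> /sitesP Dt; have /andP[? ?] := x2_occ w M1 Dt (V01 M).
  have : (\1_(occ M t) w : R) <= 1 by rewrite indicE lern1 leq_b1.
  by move=> ?; apply/andP; split; rewrite /a; lra.
have ba t : bounded_mfun (a t) by apply: bounded_mfunB => //; exact: bounded_mfun_cst.
have d1 : `|Ex P (fun w => \prod_(t <- sites M) a t w) -
    Ex P (fun w => \prod_(t <- [seq t <- sites M | regular delta x1 M t]) a t w)|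
    <= h * `|C1|.
  rewrite -ExB; [|exact: bounded_mfun_prod..].
  apply: (@le_trans _ _ (Ex P (fun w =>
      \sum_(t <- sites M | ~~ regular delta x1 M t) \1_(occ M t) w))).
    apply: Ex_norm_le.
    - by apply: bounded_mfunB; exact: bounded_mfun_prod.
    - by apply: bounded_mfun_sum => t _; exact: bounded_mfun_indic.
    move=> w; rewrite big_filter [X in _ - X]big_mkcond /=.
    apply: le_trans (prod_diff_le _ _ _) _ => [t /a01 //|t ts|].
      by case: ifP => _; [exact: a01|rewrite ler01 lexx].
    rewrite [leRHS]big_mkcond big_seq [leRHS]big_seq.
    apply: ler_sum => t ts; case: ifPn => _; first by rewrite subrr normr0.
    rewrite /a addrAC subrr add0r normrN.
    by have /andP[? ?] := x2_occ w M1 (sitesP t ts) (V01 M); rewrite ger0_norm.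
  rewrite Ex_sum => [|t _]; last exact: bounded_mfun_indic.
  apply: (@le_trans _ _ (\sum_(t <- sites M | ~~ regular delta x1 M t) `|C1| * M%:R ^- d)).
    rewrite big_seq_cond [leRHS]big_seq_cond; apply: ler_sum => t /andP[/sitesP Dt _].
    rewrite Ex_indic//; apply: le_trans (HC1 M t M1 Dt) _.
    by rewrite ler_wpM2r ?invr_ge0 ?(ltW y0)// ler_norm.
  rewrite big_const_seq iter_addr addr0 -[leLHS]mulr_natl.
  apply: (@le_trans _ _ (h * M%:R ^+ d * (`|C1| * M%:R ^- d))).
    by rewrite ler_wpM2r// mulr_ge0// invr_ge0 ltW.
  have -> : h * M%:R ^+ d * (`|C1| * M%:R ^- d) = h * `|C1| * (M%:R ^+ d / M%:R ^+ d) by ring.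
  by rewrite divff ?mulr1// gt_eqF.
have d2 : `|expR (- \sum_(t <- sites M) q M (V M) t) -
    expR (- \sum_(t <- [seq t <- sites M | regular delta x1 M t]) q M (V M) t)| <= h * c.
  have q0 t : 0 <= q M (V M) t by have /andP[] := q_bound M t (V01 M).
  rewrite big_filter [X in expR (- X) - _](bigID (regular delta x1 M))/=.
  apply: le_trans (expR_diff _ _) _.
  - exact: sumr_ge0.
  - by rewrite lerDl sumr_ge0.
  rewrite addrAC subrr add0r.
  apply: (@le_trans _ _ (\sum_(t <- sites M | ~~ regular delta x1 M t) c * M%:R ^- d)).
    by apply: ler_sum => t _; have /andP[] := q_bound M t (V01 M).
  rewrite big_const_seq iter_addr addr0 -[leLHS]mulr_natl.
  apply: (@le_trans _ _ (h * M%:R ^+ d * (c * M%:R ^- d))).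
    by rewrite ler_wpM2r// mulr_ge0 ?(ltW hc)// invr_ge0 ltW.
  have -> : h * M%:R ^+ d * (c * M%:R ^- d) = h * c * (M%:R ^+ d / M%:R ^+ d) by ring.
  by rewrite divff ?mulr1// gt_eqF.
have hK : h * `|C1| + h * c = e / 2.
  by rewrite -mulrDr -/K /h divfK// gt_eqF.
move: est d1 d2; rewrite /a sub0r normrN !ler_norml.
by move=> /andP[? ?] /andP[? ?] /andP[? ?]; apply/andP; split; lra.
Unshelve. all: by end_near.
Qed.

End FixedPartitions.

(** * Cells, pieces and counts *)

Section Cells.
Variable R : realType.

Lemma partition_cell (d : measure_display) (X : measurableType d) (n : nat)
    (K : 'I_n -> set X) : finite_partition K ->
  exists f : X -> 'I_n, forall x p, K p x <-> p = f x.
Proof.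
move=> [[cK tK _] _].
have /choice[f Hf] : forall x, exists p, K p x.
  by move=> x; have : [set: X] x by []; rewrite -cK => -[p _ Kp]; exists p.
exists f => x p; split=> [Kpx|->//]; apply: tK => //.
by exists x; split.
Qed.

Lemma partition_mass (d : measure_display) (X : measurableType d)
    (m : probability X R) (n : nat) (K : 'I_n -> set X) : finite_partition K ->
  \sum_p fine (m (K p)) = 1.
Proof.
move=> fK; have [f Hf] := partition_cell fK; have [_ mK] := fK.
under eq_bigr do rewrite -Ex_indic//.
rewrite -Ex_sum => [|p _]; last exact: bounded_mfun_indic.
rewrite -[RHS](Ex_cst m); apply: eq_Ex => x.
rewrite (bigD1 (f x))//= big1 ?addr0 => [|p pf].
  by rewrite indicE mem_set//; exact/Hf.
by rewrite indicE memNset// => /Hf e; rewrite e eqxx in pf.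
Qed.

Lemma measurable_fun_count (d : measure_display) (T : measurableType d) (J : Type)
    (s : seq J) (A : J -> set T) : (forall t, measurable (A t)) ->
  measurable_fun setT (fun w => (\sum_(t <- s) `[< A t w >])%N).
Proof.
move=> mA; elim: s => [|t s IH].
  by under eq_fun do rewrite big_nil; exact: measurable_cst.
under eq_fun do rewrite big_cons.
apply: measurable_fun_addn => //.
move=> _ Y _; rewrite setTI.
have [Y1|Y1] := pselect (Y 1%N); have [Y0|Y0] := pselect (Y 0%N).
- rewrite (_ : _ @^-1` Y = setT)//; apply/seteqP; split => // w _ /=.
  by case: asboolP.
- rewrite (_ : _ @^-1` Y = A t)//; apply/seteqP; split => w /=; case: asboolP => //.
- rewrite (_ : _ @^-1` Y = ~` A t); first exact: measurableC.
  by apply/seteqP; split => w /=; case: asboolP.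
- rewrite (_ : _ @^-1` Y = set0)//; apply/seteqP; split => w //=.
  by case: asboolP.
Qed.

(** Pieces overlap only in their boundaries, where there are few sites. *)
Lemma few_overlaps (d S : nat) (D : set 'rV[R]_d) (piece : 'I_S -> set 'rV[R]_d)
    (e : R) : (0 < d)%N -> division D piece -> 0 < e ->
  exists M0 : nat, forall M, (M0 < M)%N -> card_le_real
    [set t | exists s s', [/\ s != s', piece s (rescale R M t) &
      piece s' (rescale R M t)]] (e * M%:R ^+ d).
Proof.
move=> d0 [_ dis _ _ psb] e0.
have := thin_bigcup (fun s => thin_boundary d0 (psb s)).
move=> /(_ e e0)[rho rho0 [M0 HM0]]; exists M0 => M /HM0.
apply: card_le_real_sub => // t [s [s' [ss' ps ps']]].
exists (rescale R M t); last by move=> i; rewrite subrr normr0 ltW.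
have [ints|nints] := pselect ((piece s)° (rescale R M t)); last first.
  by exists s => //; split=> //; exact: subset_closure.
exists s' => //; split; first exact: subset_closure.
move=> ints'; have : ((piece s)° `&` (piece s')°) (rescale R M t) by [].
by rewrite dis.
Qed.

(** Both terms agree when at most one factor is present. *)
Lemma inclusion_diff (S : nat) (b : pred 'I_S) (w : 'I_S -> R) :
  (forall s, 0 <= w s <= 1) ->
  `|(1 - \prod_(s | b s) w s) - \sum_(s | b s) (1 - w s)| <=
    S%:R * `[< exists s s', [/\ s != s', b s & b s'] >]%:R.
Proof.
move=> w01.
have P01 : 0 <= \prod_(s | b s) w s <= 1.
  apply/andP; split; first by apply: prodr_ge0 => s _; have /andP[] := w01 s.
  by apply: prodr_ile1 => s _; exact: w01.
have S01 : 0 <= \sum_(s | b s) (1 - w s) <= S%:R.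
  apply/andP; split.
    by apply: sumr_ge0 => s _; rewrite subr_ge0; have /andP[] := w01 s.
  apply: (@le_trans _ _ (\sum_(s < S) 1)); last by rewrite sumr_const card_ord.
  rewrite big_mkcond; apply: ler_sum => s _; case: ifP => // _.
  by have /andP[? ?] := w01 s; lra.
case: asboolP => [[s [s' [ss' bs bs']]]|nex].
  have S1 : 1 <= S%:R :> R by rewrite ler1n (leq_ltn_trans _ (ltn_ord s)).
  rewrite mulr1; have /andP[? ?] := P01; have /andP[? ?] := S01.
  by rewrite ler_norml; apply/andP; split; lra.
rewrite mulr0; have [/existsP[s bs]|/existsPn nb] := boolP [exists s, b s].
  have only s' : b s' -> s' = s.
    by move=> bs'; apply/eqP/negPn/negP => ne; apply: nex; exists s', s.
  rewrite (bigD1 s)//= [\prod_(i < S | _ && _) _]big1 => [|s' /andP[/only -> /eqP//]].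
  rewrite (bigD1 s)//= [\sum_(i < S | _ && _) _]big1 => [|s' /andP[/only -> /eqP//]].
  by rewrite mulr1 addr0 subrr normr0.
have b0 : b =1 pred0 by move=> s; exact/negbTE/nb.
by rewrite !(eq_bigl _ _ b0) !big_pred0_eq subrr subr0 normr0.
Qed.

(** Up to the few sites shared by two pieces the product has at most one factor,
    so that the sum splits over the pieces, in each of which the density of
    lattice points is known. *)
Lemma cell_density (d S : nat) (D : set 'rV[R]_d) (piece : 'I_S -> set 'rV[R]_d)
    (w : 'I_S -> R) :
  (0 < d)%N -> bounded_set D -> (forall x, D x -> forall i, 0 <= x ord0 i) ->
  division D piece -> (forall s, 0 <= w s <= 1) ->
  (fun M : nat => M%:R ^- d * \sum_(t <- fset_set (lattice_points D M))
     (1 - \prod_(s | `[< piece s (rescale R M t) >]) w s)) @ \oo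
  --> \sum_s fine (Leb (piece s)) * (1 - w s).
Proof.
move=> d0 bD pD divD w01; have [pieceD _ _ _ psb] := divD.
have bp s : bounded_set (piece s).
  have [b [br H]] := bD; exists b; split => // x bx y py.
  exact: (H x bx y (pieceD s y py)).
have pp s x : piece s x -> forall i, 0 <= x ord0 i by move=> ps; apply: pD; exact: (pieceD s).
pose cnt s M : R := #|` fset_set (lattice_points (piece s) M)|%:R.
have lim1 : (fun M : nat => \sum_s cnt s M / M%:R ^+ d * (1 - w s)) @ \oo
    --> \sum_s fine (Leb (piece s)) * (1 - w s).
  apply: (cvg_big (op := +%R)) => [|s _]; first exact: add_continuous.
  apply: cvgMr_tmp.
  exact: (lattice_density d0 (bp s) (pp s) (thin_boundary d0 (psb s))).
apply/cvgrPdist_le => e e0; have e2 : 0 < e / 2 by rewrite divr_gt0.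
have h0 : 0 < e / 2 / (S%:R + 1) by rewrite divr_gt0// ltr_wpDl.
have [M0 HM0] := few_overlaps d0 divD h0.
move/cvgrPdist_le : lim1 => /(_ _ e2) lim1; near=> M.
have MM0 : (M0 < M)%N by near: M; exists M0.+1.
have M1 : (0 < M)%N by exact: leq_ltn_trans MM0.
have y0 : 0 < M%:R ^+ d :> R by rewrite exprn_gt0// ltr0n.
have l1 : `|\sum_s fine (Leb (piece s)) * (1 - w s) -
    \sum_s cnt s M / M%:R ^+ d * (1 - w s)| <= e / 2 by near: M.
have [C _ /(_ M M1)[fD _]] := card_le_lattice_points bD.
set sites := fset_set (lattice_points D M).
have mem_sites t : (t \in sites) = `[< lattice_points D M t >].
  by rewrite in_fset_set//; apply/idP/asboolP => [/set_mem|/mem_set].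
pose b (t : 'rV[nat]_d) s := `[< piece s (rescale R M t) >].
have cntE s : \sum_(t <- sites | b t s) (1 - w s) = cnt s M * (1 - w s).
  rewrite big_const_seq iter_addr addr0 -[LHS]mulr_natl; congr (_%:R * _).
  rewrite -size_filter; apply/perm_size/uniq_perm.
  - by rewrite filter_uniq// fset_uniq.
  - exact: fset_uniq.
  have [C' _ /(_ M M1)[fP _]] := card_le_lattice_points (bp s).
  move=> t; rewrite mem_filter mem_sites in_fset_set// /b.
  apply/andP/idP => [[/asboolP ? _]|/set_mem pt]; first exact/mem_set.
  by split; apply/asboolP => //; exact: (pieceD s).
have EQ : M%:R ^- d * \sum_(t <- sites) (1 - \prod_(s | b t s) w s) -
    \sum_s cnt s M / M%:R ^+ d * (1 - w s) =
    M%:R ^- d * \sum_(t <- sites) ((1 - \prod_(s | b t s) w s) -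
       \sum_(s | b t s) (1 - w s)).
  rewrite [in RHS]sumrB [in RHS]mulrBr; congr (_ - _).
  rewrite (exchange_big_dep xpredT)//= mulr_sumr; apply: eq_bigr => s _.
  by rewrite cntE mulrAC mulrC.
pose ov (t : 'rV[nat]_d) := `[< exists s s', [/\ s != s', b t s & b t s'] >].
have covl : (count ov sites)%:R <= e / 2 / (S%:R + 1) * M%:R ^+ d.
  have [fS] := HM0 M MM0; apply: le_trans; rewrite ler_nat -size_filter.
  apply: uniq_leq_size; first by rewrite filter_uniq// fset_uniq.
  move=> t; rewrite mem_filter => /andP[/asboolP[s [s' [ss' /asboolP ps /asboolP ps']]] _].
  by rewrite in_fset_set//; apply/mem_set; exists s, s'.
have l2 : `|M%:R ^- d * \sum_(t <- sites) (1 - \prod_(s | b t s) w s) -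
    \sum_s cnt s M / M%:R ^+ d * (1 - w s)| <= e / 2.
  rewrite EQ normrM ger0_norm ?invr_ge0 ?(ltW y0)// mulrC ler_pdivrMr//.
  apply: le_trans (ler_norm_sum _ _ _) _.
  apply: (@le_trans _ _ (\sum_(t <- sites) S%:R * (ov t)%:R)).
    by apply: ler_sum => t _; exact: inclusion_diff.
  rewrite -mulr_sumr -natr_sum -big_mkcond /= sum1_count.
  apply: (@le_trans _ _ (S%:R * (e / 2 / (S%:R + 1) * M%:R ^+ d))).
    by rewrite ler_wpM2l.
  rewrite mulrA ler_pM2r// mulrA ler_pdivrMr ?ltr_wpDl//.
  by rewrite mulrC ler_pM2l// lerDl.
move: l1 l2; rewrite !ler_norml => /andP[? ?] /andP[? ?].
by apply/andP; split; lra.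
Unshelve. all: by end_near.
Qed.

End Cells.

Section Counts.
Variable R : realType.

Lemma rescale_inj (d M : nat) : (0 < M)%N -> injective (@rescale R d M).
Proof.
move=> M0 t t' /rowP e; apply/rowP => i; have := e i; rewrite !mxE.
have M0' : (M%:R : R)^-1 != 0 by rewrite invr_eq0 pnatr_eq0 -lt0n.
by move=> /(mulIf M0') /eqP; rewrite eqr_nat => /eqP.
Qed.

(** Distinct sites give distinct points because their positions differ. *)
Lemma number_in_count (d M : nat) (X Y : choiceType) (D : set 'rV[R]_d)
    (a : 'rV[nat]_d -> X) (b : 'rV[nat]_d -> Y) (x : 'rV[nat]_d -> nat)
    (A : set X) (B : set Y) (C : set 'rV[R]_d) :
  (0 < M)%N -> bounded_set D ->
  number_in [set (a t, b t, rescale R M t) |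
      t in [set t | lattice_points D M t /\ x t = 1%N]] (A `*` B `*` C) =
  (\sum_(t <- fset_set (lattice_points D M))
     `[< [/\ x t = 1%N, A (a t), B (b t) & C (rescale R M t)] >])%N.
Proof.
move=> M0 bD; have [c _ /(_ M M0)[fD _]] := card_le_lattice_points bD.
pose g t := (a t, b t, rescale R M t).
pose Q := [set t | lattice_points D M t /\
  [/\ x t = 1%N, A (a t), B (b t) & C (rescale R M t)]].
have fQ : finite_set Q by apply: sub_finite_set fD => t [].
rewrite /number_in (_ : _ `&` _ = g @` Q); last first.
  apply/seteqP; split => [_ [[t [Dt xt] <-] [[/= At Bt] Ct]]|_ [t [Dt [xt At Bt Ct]] <-]].
    by exists t.
  by split; [exists t|].
rewrite fset_set_image// card_in_imfset; last first.
  by move=> t t' _ _ [_ _ e]; exact: rescale_inj e.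
rewrite -big_mkcond /= sum1_count -size_filter.
apply/perm_size/uniq_perm; [exact: fset_uniq|by rewrite filter_uniq// fset_uniq|].
move=> t; rewrite mem_filter !in_fset_set//.
by apply/idP/andP => [/set_mem[Dt H]|[/asboolP H /set_mem Dt]];
  [split; [exact/asboolP|exact/mem_set]|apply/mem_set].
Qed.

(** An occupied site is counted in the cells over a single pair of atoms, so the
    sum on the right has at most one nonzero term. *)
Lemma site_factor (n m S : nat) (u : 'I_n * 'I_m * 'I_S -> R)
    (occ : Prop) (p0 : 'I_n) (j0 : 'I_m) (b : 'I_S -> Prop) :
  \prod_i u i ^+ `[< [/\ occ, i.1.1 = p0, i.1.2 = j0 & b i.2] >] =
  1 - \sum_p \sum_j (`[< p = p0 /\ occ >]%:R * `[< j = j0 >]%:R *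
    (1 - \prod_(s | `[< b s >]) u (p, j, s))).
Proof.
have [ho|ho] := pselect occ; last first.
  rewrite big1 => [|i _]; last by rewrite (_ : `[< _ >] = false)//; apply/asboolPn => -[].
  rewrite big1 ?subr0// => p _; rewrite big1// => j _.
  by rewrite (_ : `[< p = p0 /\ occ >] = false) ?mul0r//; apply/asboolPn => -[].
rewrite (bigD1 p0)//= [X in _ - (_ + X)]big1 ?addr0; last first.
  move=> p /eqP pp0; rewrite big1// => j _.
  by rewrite (_ : `[< p = p0 /\ occ >] = false) ?mul0r//; apply/asboolPn => -[].
rewrite (bigD1 j0)//= [X in _ - (_ + X)]big1 ?addr0; last first.
  move=> j /eqP jj0.
  by rewrite (_ : `[< j = j0 >] = false) ?mulr0 ?mul0r//; apply/asboolPn.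
rewrite (asboolT (conj erefl ho)) (asboolT erefl) !mul1r subKr.
transitivity (\prod_(k : 'I_n * 'I_m) \prod_s u (k, s) ^+
    `[< [/\ occ, k.1 = p0, k.2 = j0 & b s] >]).
  by rewrite pair_bigA; apply: eq_bigr => -[k s] _.
rewrite (bigD1 (p0, j0))//= [X in _ * X]big1 ?mulr1; last first.
  move=> [p j] pj; rewrite big1// => s _.
  rewrite (_ : `[< _ >] = false)//; apply/asboolPn => -[_ /= e1 e2 _].
  by move: pj; rewrite e1 e2 eqxx.
rewrite [RHS]big_mkcond; apply: eq_bigr => s _; case: (asboolP (b s)) => bs.
  by rewrite (asboolT (And4 ho erefl erefl bs)) expr1.
by rewrite asboolF// => -[].
Qed.

End Counts.

(** The exponent in the generating function of independent Poisson counts whose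
    rates are products. *)
Lemma sum_cells (R : comPzRingType) (n m S : nat) (c : R) (a : 'I_n -> R)
    (b : 'I_m -> R) (v : 'I_S -> R) (u : 'I_n * 'I_m * 'I_S -> R) :
  \sum_i c * a i.1.1 * b i.1.2 * v i.2 * (u i - 1) =
  - (c * \sum_p \sum_j a p * b j * \sum_s v s * (1 - u (p, j, s))).
Proof.
transitivity (\sum_(p < n) \sum_(j < m) \sum_(s < S)
    c * a p * b j * v s * (u (p, j, s) - 1)).
  by rewrite !pair_bigA; apply: eq_bigr => -[[p j] s] _.
rewrite mulr_sumr -sumrN; apply: eq_bigr => p _.
rewrite mulr_sumr -sumrN; apply: eq_bigr => j _.
by rewrite !mulr_sumr -sumrN; apply: eq_bigr => s _; ring.
Qed.

(** * Convergence to the Poisson process *)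

Theorem theorem6p2
  (R : realType)
  (dO : measure_display) (Omega : measurableType dO) (P : probability Omega R)
  (dX : measure_display) (X : measurableType dX) (m : probability X R)
  (nP : nat -> nat) (K : forall k, 'I_(nP k) -> set X)
  (hK : forall k, finite_partition (K k))
  (hKpt : cvg_point_partition m K)
  (dY : measure_display) (Y : measurableType dY) (m' : probability Y R)
  (nJ : nat -> nat) (K' : forall l, 'I_(nJ l) -> set Y)
  (hK' : forall l, finite_partition (K' l))
  (hKpt' : cvg_point_partition m' K')
  (d : nat) (D D' : set 'rV[R]_d)
  (hD : bounded_domain D) (hDbd : piecewise_smooth_boundary D)
  (hD' : bounded_domain D') (hDD' : D `<=` D')
  (* makes the index sets t : N^d exhaust the rescaled lattice in D' *)
  (hpos : forall x, D' x -> forall i, 0 <= x ord0 i)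
  (s0 : R) (s : 'rV[R]_d) (hs : s != 0)
  (sh0 : R) (sh : 'rV[R]_d) (hsh : sh != 0)
  (hlt : forall x, D° x -> affine_form s0 s x < affine_form sh0 sh x)
  (hmax : sup (affine_form sh0 sh @` D) < sup (affine_form s0 s @` D'))
  (lam1 lamh : nat -> 'rV[nat]_d -> R)
  (hlam1 : forall M t, lam1 M t = M%:R * affine_form s0 s (rescale R M t))
  (hlamh : forall M t, lamh M t = M%:R * affine_form sh0 sh (rescale R M t))
  (xi : nat -> 'rV[nat]_d -> {RV P >-> nat})
  (nu : nat -> 'rV[nat]_d -> {RV P >-> X})
  (zeta : nat -> 'rV[nat]_d -> {RV P >-> Y})
  (xip : forall k, nat -> 'rV[nat]_d -> 'I_(nP k) -> {RV P >-> nat})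
  (hxisum : forall k M t, (0 < M)%N -> lattice_points D' M t ->
     forall w, xi M t w = (\sum_(p < nP k) xip k M t p w)%N)
  (hxinu : forall k M t, (0 < M)%N -> lattice_points D' M t ->
     forall p w, xi M t w = 1%N ->
       xip k M t p w = nat_of_bool `[< K k p (nu M t w) >])
  (etap : forall k, nat -> 'rV[nat]_d -> 'I_(nP k) -> Omega -> R)
  (hetap : forall k M t p,
     etap k M t p = \1_[set w | xip k M t p w = 1%N /\ xi M t w = 1%N])
  (F : nat -> 'rV[nat]_d -> set (set Omega))
  (hF : forall M t, (0 < M)%N -> lattice_points D' M t ->
     measurable_partition P (F M t))
  (c : R) (hc : 0 < c)
  (r : nat -> nat -> R) (hr : forall k l, 0 < r k l)
  (E : nat -> nat -> nat -> set Omega)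
  (hEm : forall k l M, measurable (E k l M))
  (hE : forall k l, exists C : R, forall M, (0 < M)%N ->
     (P (~` E k l M) <= (C * M%:R ^- (100 * d))%:E)%E)
  (h1 : exists C : R, forall M t, (0 < M)%N -> lattice_points D' M t ->
     ('E_P[fun w => (xi M t w)%:R] <= (C * M%:R ^- d)%:E)%E)
  (h2 : exists C : R, forall M t, (0 < M)%N -> lattice_points D' M t ->
     (P [set w | (1 < xi M t w)%N] <= (C * M%:R ^- (2 * d))%:E)%E)
  (h3 : exists C : R, forall M t t', (0 < M)%N ->
     lattice_points D' M t -> lattice_points D' M t' -> t != t' ->
     (P [set w | (1 <= xi M t w)%N /\ (1 <= xi M t' w)%N]
        <= (C * M%:R ^- (2 * d))%:E)%E)
  (h4 : forall k l, exists C : R, forall M t t', (0 < M)%N ->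
     lattice_points D' M t -> lattice_points D' M t' ->
     lam1 M t >= lam1 M t' + r k l * ln M%:R ->
     forall p : 'I_(nP k),
     [/\ condexp_within P (F M t') (fun w => (xi M t w)%:R) (E k l M)
           (c * fine (m [set: X]) * M%:R ^- d) (C * M%:R ^- (2 * d)),
         condexp_within P (F M t') (fun w => (xip k M t p w)%:R) (E k l M)
           (c * fine (m (K k p)) * M%:R ^- d) (C * M%:R ^- (2 * d)) &
         condexp_within P (F M t') (etap k M t p) (E k l M)
           (c * fine (m (K k p)) * M%:R ^- d) (C * M%:R ^- (2 * d))])
  (h5 : forall k l M t tb, (0 < M)%N ->
     lattice_points D' M t -> lattice_points D' M tb ->
     lam1 M tb > lam1 M t + r k l * ln M%:R ->
     forall (p : 'I_(nP k)) w, E k l M w ->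
       constant_on (xip k M t p) (pblock (F M tb) id w))
  (h6 : forall k l M t tb, (0 < M)%N ->
     lattice_points D' M t -> lattice_points D' M tb ->
     lam1 M tb > lam1 M t + r k l * ln M%:R ->
     forall w, E k l M w ->
       pblock (F M tb) id w `<=` pblock (F M t) id w)
  (h7 : forall k l, exists2 ups : nat -> R, ups @ \oo --> (0 : R) &
     forall M t t', (0 < M)%N ->
     lattice_points D' M t -> lattice_points D' M t' ->
     lamh M t >= lam1 M t' + r k l * ln M%:R ->
     lam1 M t' + r k l * ln M%:R >= lam1 M t + 2 * r k l * ln M%:R ->
     forall j : 'I_(nJ l),
       condexp_within P (F M t') \1_(zeta M t @^-1` K' l j)
         (E k l M `&` [set w | xi M t w = 1%N]) (fine (m' (K' l j))) (ups M))
  (h8 : forall k l M t tb, (0 < M)%N ->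
     lattice_points D' M t -> lattice_points D' M tb ->
     lam1 M tb > lamh M t + r k l * ln M%:R ->
     forall (j : 'I_(nJ l)) w, E k l M w -> xi M t w = 1%N ->
       constant_on (\1_(zeta M t @^-1` K' l j) : Omega -> R)
         (pblock (F M tb) id w)) :
  cvg_poisson_process P m K m' K' D c
    (fun M w => [set (nu M t w, zeta M t w, rescale R M t) |
       t in [set t | lattice_points D M t /\ xi M t w = 1%N]]).
Proof.
move=> k l S piece divD.
have d0 : (0 < d)%N.
  by have /rV0Pn[i _] := hs; exact: leq_ltn_trans (ltn_ord i).
have bD : bounded_set D by case: hD.
have posD x : D x -> forall i, 0 <= x ord0 i by move=> /hDD'; exact: hpos.
have [pK HpK] := partition_cell (hK k).
have [pJ HpJ] := partition_cell (hK' l).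
have [_ mKk] := hK k; have [_ mKl] := hK' l.
pose mK p := fine (m (K k p)); pose mJ j := fine (m' (K' l j)).
have mK0 p : 0 <= mK p by exact: fine_ge0.
have mJ0 j : 0 <= mJ j by exact: fine_ge0.
have mK1 : \sum_p mK p = 1 := partition_mass m (hK k).
have mJ1 : \sum_j mJ j = 1 := partition_mass m' (hK' l).
pose vol q := fine (Leb (piece q)).
have vol0 q : 0 <= vol q by apply: fine_ge0; exact: Leb_ge0.
pose lam (i : 'I_(nP k) * 'I_(nJ l) * 'I_S) : R :=
  c * mK i.1.1 * mJ i.1.2 * vol i.2.
have lam0 i : 0 <= lam i by rewrite !mulr_ge0// ltW.
have [dZ [TZ [PZ [Z [indZ distZ pgfZ]]]]] := poisson_vector lam0.
exists dZ, TZ, PZ, Z; split=> //.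
pose zj M t (j : 'I_(nJ l)) : set Omega := zeta M t @^-1` K' l j.
pose eta M t (p : 'I_(nP k)) : set Omega :=
  [set w | xip k M t p w = 1%N /\ xi M t w = 1%N].
have mxi M t A : measurable (xi M t @^-1` A) by exact: measurable_funPTI.
have mxip M t p A : measurable (xip k M t p @^-1` A) by exact: measurable_funPTI.
have mzj M t j : measurable (zj M t j) by exact: measurable_funPTI.
have mnu M t p : measurable (nu M t @^-1` K k p) by exact: measurable_funPTI.
have mocc M t : measurable [set w | xi M t w = 1%N] := mxi M t [set 1%N].
have meta M t p : measurable (eta M t p).
  exact: measurableI (mxip M t p [set 1%N]) (mocc M t).
have etaP M t p w : (0 < M)%N -> lattice_points D' M t ->
    eta M t p w <-> p = pK (nu M t w) /\ xi M t w = 1%N.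
  move=> M0 Dt; split=> [[e x1]|[e x1]]; split=> //.
    have := hxinu k M t M0 Dt p w x1; rewrite e => /esym/eqP; rewrite eqb1.
    by move=> /asboolP/HpK.
  rewrite (hxinu k M t M0 Dt p w x1); apply/eqP; rewrite eqb1.
  by apply/asboolP/HpK.
have eta_sum M t w : (0 < M)%N -> lattice_points D' M t ->
    \sum_p (\1_(eta M t p) w : R) = \1_[set w | xi M t w = 1%N] w.
  move=> M0 Dt; rewrite (bigD1 (pK (nu M t w)))//= big1 ?addr0; last first.
    by move=> p /eqP ne; rewrite indicE memNset// => /(etaP M t p w M0 Dt)[].
  rewrite !indicE; congr (nat_of_bool _)%:R; apply/idP/idP => /set_mem.
    by case=> _ x1; exact/mem_set.
  by move=> x1; apply/mem_set/etaP.
have zeta_sum M t w : \sum_j (\1_(zj M t j) w : R) = 1.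
  rewrite (bigD1 (pJ (zeta M t w)))//= big1 ?addr0 => [|j /eqP ne].
    by rewrite indicE mem_set// /zj /= HpJ.
  by rewrite indicE memNset// /zj /= => /HpJ.
have h1' : exists C : R, forall M t, (0 < M)%N -> lattice_points D' M t ->
    fine (P [set w | xi M t w = 1%N]) <= C * M%:R ^- d.
  have [C HC] := h1; exists C => M t M0 Dt; rewrite -lee_fin fineK; last first.
    exact: fin_num_measure.
  apply: le_trans (HC M t M0 Dt); rewrite unlock.
  rewrite -[X in (P X <= _)%E]setIT -integral_indic//; apply: ge0_le_integral => //.
  - by apply/measurable_EFinP; exact: measurable_indic.
  - by apply/measurable_EFinP; exact: (measurableT_comp (f := fun i : nat => i%:R : R)).
  - move=> w _; rewrite lee_fin indicE.
    by have [/set_mem /= ->|_] := boolP (w \in _).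
have h3' : exists C : R, forall M t t', (0 < M)%N ->
    lattice_points D' M t -> lattice_points D' M t' -> t != t' ->
    fine (P ([set w | xi M t w = 1%N] `&` [set w | xi M t' w = 1%N]))
      <= C * M%:R ^- (2 * d).
  have [C HC] := h3; exists C => M t t' M0 Dt Dt' tt'.
  rewrite -lee_fin fineK; last by apply: fin_num_measure; exact: measurableI.
  apply: le_trans (HC M t t' M0 Dt Dt' tt'); apply: le_measure; rewrite ?inE.
  - exact: measurableI.
  - exact: (measurableI _ _ (mxi M t [set i | (1 <= i)%N]) (mxi M t' [set i | (1 <= i)%N])).
  - by move=> w [/= -> ->].
have h4' : exists C : R, forall M t t', (0 < M)%N ->
    lattice_points D' M t -> lattice_points D' M t' ->
    lam1 M t >= lam1 M t' + r k l * ln M%:R -> forall p,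
    condexp_within P (F M t') \1_(eta M t p) (E k l M)
      (c * mK p * M%:R ^- d) (C * M%:R ^- (2 * d)).
  have [C HC] := h4 k l; exists C => M t t' M0 Dt Dt' h p.
  by have [_ _] := HC M t t' M0 Dt Dt' h p; rewrite hetap.
have [ups cups h7'] := h7 k l.
pose V (u : 'I_(nP k) * 'I_(nJ l) * 'I_S -> R) M (t : 'rV[nat]_d) p j : R :=
  1 - \prod_(q | `[< piece q (rescale R M t) >]) u (p, j, q).
pose N M (i : 'I_(nP k) * 'I_(nJ l) * 'I_S) w : nat :=
  number_in [set (nu M t w, zeta M t w, rescale R M t) |
       t in [set t | lattice_points D M t /\ xi M t w = 1%N]]
    (K k i.1.1 `*` K' l i.1.2 `*` piece i.2).
have NE M i : (0 < M)%N -> N M i = fun w =>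
    (\sum_(t <- fset_set (lattice_points D M)) `[< [/\ xi M t w = 1%N,
      K k i.1.1 (nu M t w), K' l i.1.2 (zeta M t w) & piece i.2 (rescale R M t)] >])%N.
  by move=> M0; apply/funext => w; exact: number_in_count.
have mN M : (1 <= M)%N -> forall i, measurable_fun setT (N M i).
  move=> M0 i; rewrite NE//.
  apply: (@measurable_fun_count _ _ _ _ (fun t => [set w | [/\ xi M t w = 1%N,
    K k i.1.1 (nu M t w), K' l i.1.2 (zeta M t w) & piece i.2 (rescale R M t)]])) => t.
  have [pt|npt] := pselect (piece i.2 (rescale R M t)); last first.
    by rewrite (_ : [set w | _] = set0)//; apply/seteqP; split => // w [].
  rewrite (_ : [set w | _] = [set w | xi M t w = 1%N] `&`
    (nu M t @^-1` K k i.1.1 `&` zj M t i.1.2)).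
    by apply: measurableI => //; exact: measurableI.
  by apply/seteqP; split => [w [? ? ? ?]|w [? [? ?]]].
have mZ i : measurable_fun setT (Z i) by [].
(* The generating functions of the counts converge to that of the Poisson vector. *)
have pgf (u : 'I_(nP k) * 'I_(nJ l) * 'I_S -> R) : (forall i, 0 < u i <= 1) ->
    (fun M => Ex P (fun w => \prod_i u i ^+ N M i w)) @ \oo -->
    Ex PZ (fun w => \prod_i u i ^+ Z i w).
  move=> u01.
  have u01' i : 0 <= u i <= 1 by have /andP[/ltW -> ->] := u01 i.
  have V01 M t p j : 0 <= V u M t p j <= 1.
    have a0 : 0 <= \prod_(q | `[< piece q (rescale R M t) >]) u (p, j, q).
      by apply: prodr_ge0 => q _; have /andP[] := u01' (p, j, q).
    have a1 : \prod_(q | `[< piece q (rescale R M t) >]) u (p, j, q) <= 1.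
      by apply: prodr_ile1 => q _; exact: u01'.
    by apply/andP; split; rewrite /V; lra.
  have lim := pgf_limit hD hD' hDD' hpos hs hsh hlt hmax hlam1 hlamh hc (hr k l)
    mocc meta mzj (hEm k l) eta_sum zeta_sum mK0 mJ0 mK1 mJ1 hF (hE k l) h1' h3' h4'
    (hxisum k) (h5 k l) cups h7' (h8 k l) V01.
  (* Both limits are the exponential of the same triple sum over cells. *)
  have EZ : Ex PZ (fun w => \prod_i u i ^+ Z i w) =
      expR (- (c * \sum_p \sum_j mK p * mJ j *
        \sum_q vol q * (1 - u (p, j, q)))).
    have bu : bounded_counts (fun k : _ -> nat => \prod_i u i ^+ k i).
      exists 1 => k0; rewrite normr_prod; apply: prodr_ile1 => i _.
      have /andP[? ?] := u01' i.
      by rewrite normr_ge0 ger0_norm ?exprn_ge0 ?exprn_ile1.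
    have := pgfZ u (fun i => proj1 (andP (u01 i))).
    rewrite (expectationEx PZ (counts_bounded_mfun mZ bu)) => -[->].
    rewrite -expR_sum; congr expR; exact: sum_cells.
  have qlim : (fun M : nat => \sum_(t <- fset_set (lattice_points D M))
      (c * M%:R ^- d * \sum_p \sum_j mK p * mJ j * V u M t p j)) @ \oo -->
      c * \sum_p \sum_j mK p * mJ j * \sum_q vol q * (1 - u (p, j, q)).
    have lim0 : (fun M : nat => c * \sum_p \sum_j mK p * mJ j *
        (M%:R ^- d * \sum_(t <- fset_set (lattice_points D M)) V u M t p j)) @ \oo -->
        c * \sum_p \sum_j mK p * mJ j * \sum_q vol q * (1 - u (p, j, q)).
      apply: cvgMl_tmp.
      apply: (cvg_big (op := +%R)) => [|p _]; first exact: add_continuous.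
      apply: (cvg_big (op := +%R)) => [|j _]; first exact: add_continuous.
      apply: cvgMl_tmp.
      by apply: cell_density => // q; exact: u01'.
    apply: cvg_trans lim0; apply: near_eq_cvg; apply: nearW => M; apply: esym.
    rewrite -mulr_sumr -mulrA; congr (c * _).
    rewrite exchange_big mulr_sumr; apply: eq_bigr => p _ /=.
    rewrite exchange_big mulr_sumr; apply: eq_bigr => j _ /=.
    by rewrite -mulr_sumr mulrCA.
  rewrite EZ.
  pose q M := \sum_(t <- fset_set (lattice_points D M))
    (c * M%:R ^- d * \sum_p \sum_j mK p * mJ j * V u M t p j).
  have elim : (fun M => expR (- q M)) @ \oo --> expR (- (c * \sum_p \sum_j mK p *
      mJ j * \sum_s vol s * (1 - u (p, j, s)))).
    by apply: continuous_cvg; [exact: continuous_expR|exact: cvgN].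
  have sumlim : (fun M : nat => Ex P (fun w => \prod_(t <- fset_set (lattice_points D M))
      (1 - \sum_p \sum_j \1_(eta M t p) w * \1_(zj M t j) w * V u M t p j)) -
      expR (- q M) + expR (- q M)) @ \oo --> expR (- (c * \sum_p \sum_j mK p *
      mJ j * \sum_s vol s * (1 - u (p, j, s)))).
    by rewrite -[expR (- (c * _))]add0r; exact: cvgD lim elim.
  apply: cvg_trans sumlim; apply: near_eq_cvg.
  exists 1%N => // M /= M0; rewrite subrK; apply: eq_Ex => w.
  have [C _ /(_ M M0)[fD _]] := card_le_lattice_points bD.
  transitivity (\prod_(t <- fset_set (lattice_points D M)) \prod_i u i ^+
      `[< [/\ xi M t w = 1%N, i.1.1 = pK (nu M t w), i.1.2 = pJ (zeta M t w) &
        piece i.2 (rescale R M t)] >]).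
    apply: eq_big_seq => t; rewrite in_fset_set// => /set_mem Dt.
    have D't : lattice_points D' M t by exact: hDD'.
    rewrite (site_factor u (xi M t w = 1%N) (pK (nu M t w)) (pJ (zeta M t w))
      (fun q => piece q (rescale R M t))).
    congr (1 - _); apply: eq_bigr => p _; apply: eq_bigr => j _.
    have e1 := etaP M t p w M0 D't; have e2 := HpJ (zeta M t w) j.
    rewrite !indicE; congr ((nat_of_bool _)%:R * (nat_of_bool _)%:R * _).
      by apply/idP/asboolP => [/set_mem/e1|/e1/mem_set].
    by apply/idP/asboolP => [/set_mem/e2|/e2/mem_set].
  rewrite exchange_big; apply: eq_bigr => i _ /=; rewrite NE// -prodrXr.
  apply: eq_bigr => t _; congr (_ ^+ nat_of_bool _).
  by apply: asbool_equiv_eq; split=> -[? ? ? ?]; split=> //; (exact/HpK || exact/HpJ).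
move=> f bf.
have bZf := counts_bounded_mfun mZ bf.
rewrite (expectationEx PZ bZf).
have lim := cvg_pgf_cvg_counts mN mZ pgf bf.
have limE : (fun M => (Ex P (fun w => f (fun i => N M i w)))%:E) @ \oo -->
    (Ex PZ (fun w => f (fun i => Z i w)))%:E by apply: cvg_EFin; [exact: nearW|exact: lim].
apply: cvg_trans limE; apply: near_eq_cvg; exists 1%N => // M /= M1.
by rewrite -expectationEx//; exact: counts_bounded_mfun (mN M M1) bf.
Qed.
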